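(* Let $$P_6(x)=5460x^4-8341x^3+4864x^2-1280x+128,\qquad f_6(x)=\frac{P_6(x)\,\Gamma(4x-1)\,\Gamma(x)^{16}}{256\,\Gamma(2x)^{10}}.$$ Then $$\sum_{n=1}^{\infty}f_6(n)=\frac{\pi^4}{15},$$ and moreover \begin{align*} \sum_{n=1}^{\infty}f_6'(n)&=-48\zeta(5),\\ \sum_{n=1}^{\infty}f_6''(n)&=356\zeta(6),\\ \sum_{n=1}^{\infty}f_6^{(3)}(n)&=288\bigl(4\zeta(2)\zeta(5)-15\zeta(7)\bigr),\\ \sum_{n=1}^{\infty}f_6^{(4)}(n)&=12512\zeta(8),\\ \sum_{n=1}^{\infty}f_6^{(5)}(n)&=5760\bigl(60\zeta(2)\zeta(7)-48\zeta(4)\zeta(5)-49\zeta(9)\bigr),\\ \sum_{n=1}^{\infty}f_6^{(6)}(n)&=1728\bigl(1440\zeta(5)^2-1999\zeta(10)\bigr),\\ \frac1{241920}\sum_{n=1}^{\infty}f_6^{(7)}(n)&=885\zeta(11)+196\zeta(2)\zeta(9)-720\zeta(4)\zeta(7)-336\zeta(5)\zeta(6). \end{align*}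
   Context: $\zeta$ is the Riemann zeta function; $f_6^{(r)}$ denotes the $r$-th derivative of $f_6$ in the real variable $x$ (near $x\ge1$, where $f_6$ is smooth). *)

(* Defs.v *)
From Stdlib Require Import Reals.
From Coquelicot Require Import Coquelicot.
Open Scope R_scope.

(* Euler's integral of the second kind; meaningful for x > 0, which covers
   every use below ([f6] is only evaluated and differentiated at x >= 1). *)
Definition Gamma (x : R) : R :=
  RInt_gen (fun t : R => Rpower t (x - 1) * exp (- t))
           (at_right 0) (Rbar_locally p_infty).

(* The Dirichlet series; meaningful for s > 1. *)
Definition zeta (s : R) : R :=
  Series (fun n : nat => / Rpower (INR (S n)) s).

Definition P6 (x : R) : R :=
  5460 * x ^ 4 - 8341 * x ^ 3 + 4864 * x ^ 2 - 1280 * x + 128.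

Definition f6 (x : R) : R :=
  P6 x * Gamma (4 * x - 1) * Gamma x ^ 16 / (256 * Gamma (2 * x) ^ 10).

(* Main.v *)
Require Import Defs.
From Stdlib Require Import Reals.
From Coquelicot Require Import Coquelicot.
From Stdlib Require Import Lra Lia ZArith FunctionalExtensionality List Psatz.
Import ListNotations.
Open Scope R_scope.

(** For small a put S(a) = sum_(n >= 1) f6(n + a).  As f6^(r)(n) is r! times the
    coefficient of a^r in f6(n + a), the theorem gives the first eight
    coefficients of S, where the sum is taken coefficient by coefficient.
    All computations are therefore made with power series in a (written X
    below), one series for each n, and only coefficients up to a^7 matter.

    Deformation.  Up to a polynomial factor, f6(n + a) is a quotient of gamma
    values whose arguments contain a with the weights 1 (sixteen times), 4
    (once) in the numerator and 2 (ten times) in the denominator.  It is the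
    member j = 0 of a family of five terms, j = 0, ..., 4, in which other
    integers replace these weights.  The integers are chosen so that the sum
    of their k-th powers is, for k <= 7, a polynomial in j of degree at most
    k/2; the polynomial factors behave in the same way.  Hence the coefficient
    of a^r in the j-th term is, for r <= 7, a polynomial in j of degree at
    most r/2 <= 3.  Its fourth difference vanishes ([family_tame],
    [family_fourth_difference]), so that, up to a^7,
      term_0 = 4 term_1 - 6 term_2 + 4 term_3 - term_4.
    It remains to sum the terms with j >= 1, which are easier.

    Closed forms on a grid.  For j >= 1 the term is the sum of two adjacent
    edges of a grid carrying a closed discrete 1-form, that is, functions P and
    M of (p, q) with P(p,q) + M(p+1,q) = M(p,q) + P(p,q+1) ([grid_closed]).
    The form is a product of gamma values times a polynomial, and closedness is
    the polynomial identity [wz_identity].  The sum along the staircase from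
    (0,0) to (N,N) equals the sum along the row q = 0 plus the sum along the
    column p = N, which tends to 0 ([column_vanishes]).  On the row one of two
    things happens.  For j = 1, 3 the summand is a rational function,
    homogeneous of degree -4, and its coefficients sum to multiples of zeta
    values.  For j = 2, 4 the summand times a constant multiple of a^4
    telescopes, by [tel_identity].  Both give S_j explicitly ([diagonal_sum1]
    to [diagonal_sum4]) in terms of series e with X e' = l e, where the
    coefficient of X^k in l is an integer multiple of zeta(k).

    Analysis.  Log-convexity of the gamma integral ([Gamma_ineq]) yields the
    Gauss product and hence the Taylor series of the gamma quotient at 1
    ([germ_gam_quot]), which links the formal terms to the derivatives of f6
    ([derivative_sum]).  The sine product, obtained from the integrals of
    cos(zt) cos(t)^(2M) over [0, PI/2], gives zeta(2), ..., zeta(10)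
    ([zeta_even]).  A finite computation in PI and the odd zeta values then
    evaluates 4 S_1 - 6 S_2 + 4 S_3 - S_4 ([sum_coef_values]). *)

(** * Formal power series *)

Definition fps := nat -> R.
Definition fadd (a b : fps) : fps := fun n => a n + b n.
Definition fopp (a : fps) : fps := fun n => - a n.
Definition fsub (a b : fps) : fps := fadd a (fopp b).
Definition fC (c : R) : fps := fun n => match n with O => c | _ => 0 end.
Definition fX : fps := fun n => match n with 1%nat => 1 | _ => 0 end.
Definition shift (a : fps) : fps := fun n => a (S n).

(** Recursion on the first coefficient, rather than a sum over k <= n, lets
    associativity and the Leibniz rule be proved by induction through
    [shift]. *)
Fixpoint fmulc (n : nat) (a b : fps) : R :=
  match n with
  | O => a O * b O
  | S n' => a O * b n + fmulc n' (shift a) b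
  end.
Definition fmul (a b : fps) : fps := fun n => fmulc n a b.

Declare Scope fps_scope.
Delimit Scope fps_scope with F.
Bind Scope fps_scope with fps.
Infix "+" := fadd : fps_scope.
Infix "*" := fmul : fps_scope.
Infix "-" := fsub : fps_scope.
Notation "- a" := (fopp a) : fps_scope.

Lemma fps_ext (a b : fps) : (forall n, a n = b n) -> a = b.
Proof. intros H; apply functional_extensionality; exact H. Qed.

Lemma fmulc_addl n : forall a b c : fps,
  fmulc n (a + b)%F c = fmulc n a c + fmulc n b c.
Proof.
  induction n as [|n IH]; intros a b c; simpl; unfold fadd at 1; [ring|].
  change (shift (a + b)%F) with (shift a + shift b)%F. rewrite IH. ring.
Qed.

Lemma fmulc_scal n : forall x (b c : fps),
  fmulc n (fun k => x * b k) c = x * fmulc n b c.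
Proof.
  induction n as [|n IH]; intros x b c; simpl; [ring|].
  change (shift (fun k => x * b k)) with (fun k => x * shift b k).
  rewrite IH. ring.
Qed.

Lemma fmulc_S n (a b : fps) :
  fmulc (S n) a b = fmulc n a (shift b) + a (S n) * b O.
Proof.
  revert a b; induction n as [|n IH]; intros a b; [simpl; unfold shift; ring|].
  change (fmulc (S (S n)) a b) with (a O * b (S (S n)) + fmulc (S n) (shift a) b).
  rewrite IH. simpl. unfold shift. ring.
Qed.

Lemma fmulc_comm n : forall a b : fps, fmulc n a b = fmulc n b a.
Proof.
  induction n as [|n IH]; intros a b; [simpl; ring|].
  rewrite fmulc_S, IH. simpl. unfold shift. ring.
Qed.

Lemma shift_mul (a b : fps) :
  shift (a * b)%F = fadd (fun k => a O * shift b k) (shift a * b)%F.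
Proof. apply fps_ext; intros n; reflexivity. Qed.

Lemma fmulc_assoc n : forall a b c : fps,
  fmulc n (a * b)%F c = fmulc n a (b * c)%F.
Proof.
  induction n as [|n IH]; intros a b c; [simpl; unfold fmul; simpl; ring|].
  cbn [fmulc]. rewrite shift_mul, fmulc_addl, fmulc_scal, IH.
  change ((a * b)%F O) with (a O * b O).
  change ((b * c)%F (S n)) with (b O * c (S n) + fmulc n (shift b) c). ring.
Qed.

Lemma fmulc_1l n : forall b : fps, fmulc n (fC 1) b = b n.
Proof.
  intros b; destruct n as [|n]; simpl; [ring|].
  replace (shift (fC 1)) with (fun k => 0 * fC 1 k).
  - rewrite fmulc_scal; ring.
  - apply fps_ext; intros k; unfold shift, fC; simpl; ring.
Qed.

Lemma fps_ring : ring_theory (fC 0) (fC 1) fadd fmul fsub fopp eq.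
Proof.
  constructor.
  - intros x; apply fps_ext; intros [|n]; unfold fadd; simpl; ring.
  - intros x y; apply fps_ext; intros n; unfold fadd; ring.
  - intros x y z; apply fps_ext; intros n; unfold fadd; ring.
  - intros x; apply fps_ext; intros n; apply fmulc_1l.
  - intros x y; apply fps_ext; intros n; apply fmulc_comm.
  - intros x y z; apply fps_ext; intros n; symmetry; apply fmulc_assoc.
  - intros x y z; apply fps_ext; intros n; apply fmulc_addl.
  - reflexivity.
  - intros x; apply fps_ext; intros [|n]; unfold fadd, fopp; simpl; ring.
Qed.

Lemma fC_add x y : fC (x + y) = (fC x + fC y)%F.
Proof. apply fps_ext; intros [|n]; unfold fadd; simpl; ring. Qed.
Lemma fC_mul x y : fC (x * y) = (fC x * fC y)%F.
Proof.
  apply fps_ext; intros [|n]; unfold fmul; simpl; [reflexivity|].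
  replace (shift (fC x)) with (fun k => 0 * fC 1 k).
  - rewrite fmulc_scal; ring.
  - apply fps_ext; intros k; unfold shift, fC; simpl; ring.
Qed.
Lemma fC_opp x : fC (- x) = (- fC x)%F.
Proof. apply fps_ext; intros [|n]; unfold fopp; simpl; ring. Qed.
Lemma fC_sub x y : fC (x - y) = (fC x - fC y)%F.
Proof. apply fps_ext; intros [|n]; unfold fsub, fadd, fopp; simpl; ring. Qed.

Lemma fps_morph : ring_morph (fC 0) (fC 1) fadd fmul fsub fopp eq
  0%Z 1%Z Z.add Z.mul Z.sub Z.opp Z.eqb (fun z => fC (IZR z)).
Proof.
  split; intros; try reflexivity.
  - now rewrite plus_IZR, fC_add.
  - now rewrite minus_IZR, fC_sub.
  - now rewrite mult_IZR, fC_mul.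
  - now rewrite opp_IZR, fC_opp.
  - apply Z.eqb_eq in H; now subst.
Qed.

(* With [fC (IZR z)] recognised as a constant, [ring] decides identities with
   numerical coefficients. *)
Ltac fps_cst t :=
  match t with
  | fC (IZR ?z) => match isZcst z with true => z | _ => constr:(InitialRing.NotConstant) end
  | fC R0 => constr:(0%Z)
  | fC R1 => constr:(1%Z)
  | _ => constr:(InitialRing.NotConstant)
  end.

Fixpoint fpow (a : fps) (n : nat) : fps :=
  match n with O => fC 1 | S n => (a * fpow a n)%F end.
Infix "^" := fpow : fps_scope.

Lemma fpow_theory : power_theory (fC 1) fmul eq N.to_nat fpow.
Proof.
  split; intros r n; destruct n as [|p]; [reflexivity|].
  simpl N.to_nat. simpl pow_N.
  induction p using Pos.peano_ind; [simpl; apply fps_ext; intros k; unfold fmul; rewrite fmulc_comm; apply fmulc_1l|].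
  rewrite Pos2Nat.inj_succ. simpl. rewrite IHp.
  rewrite (pow_pos_succ (Eqsth fps)
     ltac:(intros x x' Hx y y' Hy; now subst)
     (fun x y z => Rmul_assoc fps_ring x y z)). reflexivity.
Qed.

Ltac fpow_tac t :=
  match t with
  | O => constr:(N0) | S ?n => let c := isnatcst t in
     match c with true => let r := eval compute in (N.of_nat t) in r | _ => constr:(InitialRing.NotConstant) end
  | _ => constr:(InitialRing.NotConstant)
  end.

Add Ring fps_ring_inst : fps_ring
  (morphism fps_morph, constants [fps_cst], power_tac fpow_theory [fpow_tac]).

(** * Four specialisations and their polynomial identities *)

Definition lin (z : fps) (c : Z) : fps := (z + fC (IZR c) * fX)%F.
Definition qprod (l : list Z) (z : fps) : fps :=
  fold_right (fun c acc => (lin z c * acc)%F) (fC 1) l.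

(** In units of a, [mus] consists of mu_1, ..., mu_4 and their opposites,
    [nus] of x_1, ..., x_4 and their opposites; mu is the image of x under the
    half-spin map of D_4, [sg] is half the sum of the mu_i^2 and [pt] is their
    product.  In the case j the first j - 1 of the x_i are 2 and the others
    are 0. *)
Record case := Case { mus : list Z; nus : list Z; sg : Z; pt : Z }.
Definition case1 := Case [0;0;0;0;0;0;0;0]%Z [0;0;0;0;0;0;0;0]%Z 0 0.
Definition case2 := Case [1;1;1;1;-1;-1;-1;-1]%Z [2;-2;0;0;0;0;0;0]%Z 2 1.
Definition case3 := Case [2;2;-2;-2;0;0;0;0]%Z [2;2;-2;-2;0;0;0;0]%Z 4 0.
Definition case4 := Case [3;-3;1;1;1;-1;-1;-1]%Z [2;2;2;-2;-2;-2;0;0]%Z 6 (-3).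

(** The polynomial B(k, M) of the WZ pair; all of its dependence on the case
    is in [sg] and [pt]. *)
Definition wzB (c : case) (k M : fps) : fps :=
  (k * (fC 6 * k^3 + fC 9 * k^2 * M + fC 5 * k * M^2 + M^3)
   - fC (IZR (sg c)) * fX^2 * k * (fC 2 * k + M) + fC (IZR (pt c)) * fX^4)%F.

(** Closedness of the 1-form on the grid at (k, m), after division by the
    common product of gamma values. *)
Definition wz_identity (c : case) := forall k m : fps,
  (qprod (nus c) (k + m) *
    (wzB c k (m - fC 1) * (fC 2 * m * (fC 2 * m - fC 1))
     - wzB c m (k - fC 1) * (fC 2 * k * (fC 2 * k - fC 1)))
  = fC 2 * (fC 2 * k + fC 2 * m - fC 1) * (k + m) *
    (qprod (mus c) m * wzB c k m - qprod (mus c) k * wzB c m k))%F.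

(** On the bottom row B(k, 0) is the whole numerator of the summand, and this
    identity makes the summand a difference of consecutive products. *)
Definition tel_identity (c : case) := forall k : fps,
  (qprod (mus c) k - qprod (nus c) k = fC (IZR (pt c)) * fX^4 * wzB c k (fC 0))%F.

Lemma wz_case1 : wz_identity case1.
Proof. intros k m; unfold wzB, qprod, lin; simpl fold_right; simpl sg; simpl pt. ring. Qed.
Lemma wz_case2 : wz_identity case2.
Proof. intros k m; unfold wzB, qprod, lin; simpl fold_right; simpl sg; simpl pt. ring. Qed.
Lemma wz_case3 : wz_identity case3.
Proof. intros k m; unfold wzB, qprod, lin; simpl fold_right; simpl sg; simpl pt. ring. Qed.
Lemma wz_case4 : wz_identity case4.
Proof. intros k m; unfold wzB, qprod, lin; simpl fold_right; simpl sg; simpl pt. ring. Qed.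

(** * Series given by their logarithmic derivative *)

(** The Euler operator X d/dX.  A series with constant term 1 is determined by
    its logarithmic derivative with respect to it, and products become
    sums. *)
Definition theta (a : fps) : fps := fun n => INR n * a n.

Lemma theta_mulc n : forall a b : fps,
  INR n * fmulc n a b = fmulc n (theta a) b + fmulc n a (theta b).
Proof.
  induction n as [|n IH]; intros a b; [unfold theta; simpl; ring|].
  cbn [fmulc].
  replace (shift (theta a)) with (theta (shift a) + shift a)%F
    by (apply fps_ext; intros k; unfold shift, theta, fadd; rewrite S_INR; ring).
  rewrite fmulc_addl.
  assert (E := IH (shift a) b).
  unfold theta at 1 3. rewrite S_INR. simpl INR at 2. nra.
Qed.

Lemma theta_mul (a b : fps) : theta (a * b)%F = (theta a * b + a * theta b)%F.
Proof. apply fps_ext; intros n; apply theta_mulc. Qed.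

Definition logder (l e : fps) : Prop := theta e = (l * e)%F.

Lemma logder_mul (l m e f : fps) : logder l e -> logder m f -> logder (l + m)%F (e * f)%F.
Proof. unfold logder; intros H1 H2; rewrite theta_mul, H1, H2; ring. Qed.

Lemma logder_fC c : logder (fC 0) (fC c).
Proof.
  unfold logder; apply fps_ext; intros n.
  replace (fC 0 * fC c)%F with (fC 0) by ring.
  destruct n; unfold theta; simpl; ring.
Qed.

Lemma fmulc_ext n : forall a b a' b' : fps,
  (forall k, (k <= n)%nat -> a k = a' k) -> (forall k, (k <= n)%nat -> b k = b' k) ->
  fmulc n a b = fmulc n a' b'.
Proof.
  induction n as [|n IH]; intros a b a' b' Ha Hb; simpl.
  - now rewrite Ha, Hb by lia.
  - rewrite Ha, Hb by lia. f_equal. apply IH; intros k Hk.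
    + unfold shift; apply Ha; lia.
    + apply Hb; lia.
Qed.

Lemma logder_S (l e : fps) n : l O = 0 -> logder l e ->
  e (S n) = fmulc n (shift l) e / INR (S n).
Proof.
  intros Hl H. apply (f_equal (fun f => f (S n))) in H.
  unfold theta, fmul in H; cbn [fmulc] in H. rewrite Hl in H.
  apply Rmult_eq_reg_l with (INR (S n)); [|apply not_0_INR; lia].
  rewrite H. field. apply not_0_INR; lia.
Qed.

Lemma logder_unique (l e f : fps) : l O = 0 -> logder l e -> logder l f -> e O = f O -> e = f.
Proof.
  intros Hl He Hf H0. apply fps_ext.
  enough (forall n k, (k <= n)%nat -> e k = f k) by eauto.
  induction n as [|n IH]; intros k Hk.
  - now replace k with O by lia.
  - destruct (Nat.eq_dec k (S n)) as [->|Hn]; [|apply IH; lia].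
    rewrite (logder_S l e), (logder_S l f) by assumption.
    f_equal. apply fmulc_ext; [reflexivity|exact IH].
Qed.

(** Course-of-values recursion: [texp_upto l n] is right up to the coefficient
    n. *)
Fixpoint texp_upto (l : fps) (n : nat) : fps :=
  match n with
  | O => fC 1
  | S n' => let e := texp_upto l n' in
    fun k => if Nat.leb k n' then e k else fmulc n' (shift l) e / INR (S n')
  end.

(** The series exp (sum_k l_k X^k / k): the solution e of X e' = l e with
    constant term 1, from n e_n = sum_(k >= 1) l_k e_(n-k). *)
Definition texp (l : fps) : fps := fun n => texp_upto l n n.

Lemma texp_upto_texp (l : fps) n k : (k <= n)%nat -> texp_upto l n k = texp l k.
Proof.
  induction n as [|n IH]; intros Hk.
  - now replace k with O by lia.
  - destruct (Nat.eq_dec k (S n)) as [->|Hn]; [reflexivity|].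
    simpl. destruct (Nat.leb_spec k n); [apply IH; lia|lia].
Qed.

Lemma texp_S (l : fps) n : texp l (S n) = fmulc n (shift l) (texp l) / INR (S n).
Proof.
  unfold texp at 1. cbn [texp_upto]. destruct (Nat.leb_spec (S n) n); [lia|].
  f_equal. apply fmulc_ext; [reflexivity|]. intros k Hk. now apply texp_upto_texp.
Qed.
Lemma texp_0 (l : fps) : texp l O = 1.
Proof. reflexivity. Qed.

Lemma texp_logder (l : fps) : l O = 0 -> logder l (texp l).
Proof.
  intros Hl; apply fps_ext; intros [|n].
  - unfold theta, fmul; simpl; rewrite Hl; ring.
  - unfold theta, fmul; cbn [fmulc]. rewrite texp_S, Hl. field. apply not_0_INR; lia.
Qed.

Lemma logder_texp (l e : fps) : l O = 0 -> logder l e -> e = (fC (e O) * texp l)%F.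
Proof.
  intros Hl H. apply (logder_unique l); auto.
  - assert (E := logder_mul _ _ _ _ (logder_fC (e O)) (texp_logder l Hl)).
    replace (fC 0 + l)%F with l in E by ring. exact E.
  - unfold fmul; simpl. rewrite texp_0; ring.
Qed.

Lemma texp_add (l m : fps) : l O = 0 -> m O = 0 -> texp (l + m)%F = (texp l * texp m)%F.
Proof.
  intros Hl Hm. symmetry. rewrite (logder_texp (l + m)%F (texp l * texp m)%F) at 1.
  - replace ((texp l * texp m)%F O) with 1 by (unfold fmul; simpl; rewrite !texp_0; ring). ring.
  - unfold fadd; rewrite Hl, Hm; ring.
  - apply logder_mul; now apply texp_logder.
Qed.

Lemma texp_zero : texp (fC 0) = fC 1.
Proof.
  symmetry. rewrite (logder_texp (fC 0) (fC 1)) at 1; [simpl; ring|reflexivity|apply logder_fC].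
Qed.

Lemma texp_opp (l : fps) : l O = 0 -> (texp l * texp (- l))%F = fC 1.
Proof.
  intros Hl. rewrite <- texp_add by (unfold fopp; rewrite ?Hl; ring || assumption).
  replace (l + - l)%F with (fC 0) by ring. apply texp_zero.
Qed.

Definition flim (u : nat -> fps) (l : fps) : Prop :=
  forall k, is_lim_seq (fun n => u n k) (l k).

Lemma flim_mulc n : forall (u v : nat -> fps) (a b : fps),
  (forall k, (k <= n)%nat -> is_lim_seq (fun N => u N k) (a k)) ->
  (forall k, (k <= n)%nat -> is_lim_seq (fun N => v N k) (b k)) ->
  is_lim_seq (fun N => fmulc n (u N) (v N)) (fmulc n a b).
Proof.
  induction n as [|n IH]; intros u v a b Hu Hv.
  - simpl. apply (is_lim_seq_mult' _ _ (a O) (b O)); auto.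
  - cbn [fmulc]. apply is_lim_seq_plus'.
    + apply (is_lim_seq_mult' _ _ (a O) (b (S n))); [apply Hu|apply Hv]; lia.
    + apply (IH (fun N => shift (u N)) v (shift a) b).
      * intros k Hk. unfold shift. apply Hu; lia.
      * intros k Hk. apply Hv; lia.
Qed.

Lemma flim_mul (u v : nat -> fps) (a b : fps) : flim u a -> flim v b -> flim (fun n => (u n * v n)%F) (a * b)%F.
Proof. intros Hu Hv k. apply flim_mulc; intros; auto. Qed.

Lemma flim_texp (u : nat -> fps) (l : fps) : flim u l -> flim (fun n => texp (u n)) (texp l).
Proof.
  intros H. enough (forall n k, (k <= n)%nat -> is_lim_seq (fun N => texp (u N) k) (texp l k)).
  { intros k; eauto. }
  induction n as [|n IH]; intros k Hk.
  - replace k with O by lia. apply is_lim_seq_const.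
  - destruct (Nat.eq_dec k (S n)) as [->|Hn]; [|apply IH; lia].
    apply is_lim_seq_ext with (fun N => fmulc n (shift (u N)) (texp (u N)) * / INR (S n)).
    { intros N. now rewrite texp_S. }
    rewrite texp_S. unfold Rdiv.
    apply (is_lim_seq_mult' _ _ (fmulc n (shift l) (texp l)) (/ INR (S n))); [|apply is_lim_seq_const].
    apply (flim_mulc n (fun N => shift (u N)) (fun N => texp (u N))).
    + intros j Hj; unfold shift; apply H.
    + exact IH.
Qed.

(** With D = B (C + 1) the sum of C B^k D^(n+1-k) over k = 1, ..., n + 1 is
    D^(n+1) - B^(n+1). *)
Lemma fmulc_geom n : forall (l e : fps) C B D, 0 <= C -> 0 <= B -> B * (C + 1) = D ->
  (forall k, Rabs (l (S k)) <= C * B ^ S k) -> (forall k, (k <= n)%nat -> Rabs (e k) <= D ^ k) ->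
  Rabs (fmulc n (shift l) e) <= D ^ S n.
Proof.
  (* The term - B ^ S n makes the statement inductive. *)
  assert (aux : forall n (l e : fps) C B D, 0 <= C -> 0 <= B -> B * (C + 1) = D ->
    (forall k, Rabs (l (S k)) <= C * B ^ S k) -> (forall k, (k <= n)%nat -> Rabs (e k) <= D ^ k) ->
    Rabs (fmulc n (shift l) e) <= D ^ S n - B ^ S n).
  { clear n. induction n as [|n IH]; intros l e C B D HC HB HD Hl He.
    - cbn [fmulc]. unfold shift. rewrite Rabs_mult.
      specialize (Hl O). specialize (He O ltac:(lia)).
      assert (0 <= Rabs (l 1%nat)) by apply Rabs_pos. assert (0 <= Rabs (e 0%nat)) by apply Rabs_pos.
      simpl in *. subst D. nra.
    - rewrite fmulc_S. eapply Rle_trans; [apply Rabs_triang|]. rewrite Rabs_mult.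
      assert (E1 : Rabs (fmulc n (shift l) (shift e)) <= D * (D ^ S n - B ^ S n)).
      { assert (HDp : 0 <= D) by (subst D; nra).
        destruct (Req_dec D 0) as [D0|D0].
        -
          assert (fmulc n (shift l) (shift e) = 0) as ->.
          { transitivity (fmulc n (shift l) (fC 0)).
            - apply fmulc_ext; [reflexivity|]. intros k Hk.
              specialize (He (S k) ltac:(lia)). rewrite D0 in He. simpl in He.
              rewrite Rmult_0_l in He. unfold shift.
              assert (0 <= Rabs (e (S k))) by apply Rabs_pos.
              assert (Rabs (e (S k)) = 0) by lra.
              destruct k; simpl; apply Rabs_eq_0; assumption.
            - change (fmulc n (shift l) (fC 0)) with ((shift l * fC 0)%F n).
              replace (shift l * fC 0)%F with (fC 0) by ring. destruct n; reflexivity. }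
          rewrite Rabs_R0, D0. lra.
        - replace (fmulc n (shift l) (shift e)) with (D * fmulc n (shift l) (fun k => / D * shift e k)).
          2:{ rewrite (fmulc_comm n _ (fun k => _)), fmulc_scal, (fmulc_comm n (shift e)). field; assumption. }
          rewrite Rabs_mult, (Rabs_pos_eq D) by assumption.
          apply Rmult_le_compat_l; [assumption|].
          apply (IH l _ C B D); auto.
          intros k Hk. rewrite Rabs_mult, Rabs_inv, (Rabs_pos_eq D) by assumption.
          specialize (He (S k) ltac:(lia)). simpl in He. unfold shift.
          apply Rmult_le_reg_l with D; [lra|].
          rewrite <- Rmult_assoc, Rinv_r, Rmult_1_l by assumption. exact He. }
      specialize (He O ltac:(lia)). simpl in He.
      change (shift l (S n)) with (l (S (S n))).
      assert (E2 := Hl (S n)).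
      assert (0 <= Rabs (l (S (S n)))) by apply Rabs_pos. assert (0 <= Rabs (e 0%nat)) by apply Rabs_pos.
      assert (0 <= B ^ S n) by (apply pow_le; assumption).
      assert (Rabs (l (S (S n))) * Rabs (e 0%nat) <= C * B ^ S (S n)) by nra.
      change (B ^ S (S n)) with (B * B ^ S n) in *.
      change (D ^ S (S n)) with (D * D ^ S n).
      assert (D * B ^ S n = C * (B * B ^ S n) + B * B ^ S n) by (subst D; ring).
      lra. }
  intros l e C B D HC HB HD Hl He.
  eapply Rle_trans; [apply (aux n l e C B D); auto|].
  assert (0 <= B ^ S n) by (apply pow_le; assumption). lra.
Qed.

(** The power series of [texp l] converges on a disc that depends only on a
    geometric bound for l; this uniformity is what permits limits of infinite
    products. *)
Lemma texp_geom (l : fps) C B : 0 <= C -> 0 <= B ->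
  (forall k, Rabs (l (S k)) <= C * B ^ S k) ->
  forall n, Rabs (texp l n) <= (B * (C + 1)) ^ n.
Proof.
  intros HC HB Hl.
  enough (forall n k, (k <= n)%nat -> Rabs (texp l k) <= (B * (C + 1)) ^ k) by eauto.
  induction n as [|n IH]; intros k Hk.
  - replace k with O by lia. rewrite texp_0, Rabs_R1; simpl; lra.
  - destruct (Nat.eq_dec k (S n)) as [->|Hn]; [|apply IH; lia].
    rewrite texp_S. unfold Rdiv. rewrite Rabs_mult.
    assert (H1 : Rabs (/ INR (S n)) <= 1).
    { rewrite Rabs_inv, Rabs_pos_eq by apply pos_INR.
      rewrite <- Rinv_1. apply Rinv_le_contravar; [lra|]. rewrite S_INR.
      pose proof (pos_INR n); lra. }
    assert (H2 := fmulc_geom n l (texp l) C B _ HC HB eq_refl Hl IH).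
    assert (0 <= Rabs (/ INR (S n))) by apply Rabs_pos.
    assert (0 <= Rabs (fmulc n (shift l) (texp l))) by apply Rabs_pos.
    nra.
Qed.

(** * Products of linear factors *)

Lemma fC_mul_n c (e : fps) n : (fC c * e)%F n = c * e n.
Proof.
  unfold fmul; destruct n as [|n]; [reflexivity|]. cbn [fmulc].
  replace (shift (fC c)) with (fun k => 0 * fC 1 k).
  - rewrite fmulc_scal. simpl. ring.
  - apply fps_ext; intros k; unfold shift, fC; simpl; ring.
Qed.
Lemma fX_mul_0 (e : fps) : (fX * e)%F O = 0.
Proof. unfold fmul; simpl; ring. Qed.
Lemma fX_mul_S (e : fps) n : (fX * e)%F (S n) = e n.
Proof.
  unfold fmul; cbn [fmulc]. replace (shift fX) with (fC 1).
  - rewrite fmulc_1l. simpl; ring.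
  - apply fps_ext; intros [|k]; reflexivity.
Qed.

Definition psum (l : list Z) (k : nat) : R :=
  fold_right (fun c acc => IZR c ^ k + acc) 0 l.

(** Logarithmic derivative of the product of the factors 1 + c x X, where w k
    is the sum of the c^k. *)
Definition lam_one (w : nat -> R) (x : R) : fps :=
  fun k => match k with O => 0 | S _ => - (- x) ^ k * w k end.

Lemma lin_logder z c : z <> 0 -> logder (lam_one (psum [c]) (/ z)) (lin (fC z) c).
Proof.
  intros Hz. unfold logder, lin. set (l := lam_one (psum [c]) (/ z)).
  replace (l * (fC z + fC (IZR c) * fX))%F with (fC z * l + fC (IZR c) * (fX * l))%F by ring.
  apply fps_ext; intros [|[|n]]; unfold theta, fadd; rewrite !fC_mul_n, ?fX_mul_0, ?fX_mul_S;
    rewrite ?fC_mul_n; unfold l, lam_one.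
  - simpl; ring.
  - simpl. field; assumption.
  - simpl fC. simpl fX. unfold psum; simpl fold_right. rewrite !Rplus_0_r.
    replace ((- / z) ^ S (S n)) with ((- / z) ^ S n * (- / z)) by (simpl; ring).
    replace (IZR c ^ S (S n)) with (IZR c ^ S n * IZR c) by (simpl; ring).
    field; assumption.
Qed.

Lemma lam_one_add w v x : lam_one (fun k => w k + v k) x = (lam_one w x + lam_one v x)%F.
Proof. apply fps_ext; intros [|k]; unfold fadd, lam_one; ring. Qed.

Lemma qprod_logder z l : z <> 0 -> logder (lam_one (psum l) (/ z)) (qprod l (fC z)).
Proof.
  intros Hz; induction l as [|c l IH].
  - simpl. replace (lam_one (psum []) (/ z)) with (fC 0); [apply logder_fC|].
    apply fps_ext; intros [|k]; unfold lam_one; simpl; ring.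
  - simpl qprod. replace (lam_one (psum (c :: l)) (/ z)) with (lam_one (psum [c]) (/ z) + lam_one (psum l) (/ z))%F.
    + apply logder_mul; [now apply lin_logder|exact IH].
    + rewrite <- lam_one_add. f_equal. apply functional_extensionality; intros k; simpl; ring.
Qed.

Lemma qprod_0 z l : qprod l (fC z) O = z ^ length l.
Proof.
  induction l as [|c l IH]; [reflexivity|]. simpl qprod.
  change ((lin (fC z) c * qprod l (fC z))%F O) with (lin (fC z) c O * qprod l (fC z) O).
  rewrite IH. unfold lin, fadd. rewrite fC_mul_n. simpl; ring.
Qed.

(** Inverse of [qprod l z] at a nonzero constant z, by changing the sign of
    the logarithmic derivative. *)
Definition qinv (l : list Z) (z : R) : fps := (fC (/ z ^ length l) * texp (- lam_one (psum l) (/ z)))%F.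

Lemma qprod_texp z l : z <> 0 -> qprod l (fC z) = (fC (z ^ length l) * texp (lam_one (psum l) (/ z)))%F.
Proof. intros Hz. rewrite <- qprod_0. apply logder_texp; [reflexivity|now apply qprod_logder]. Qed.

Lemma fC_inv z : z <> 0 -> (fC z * fC (/ z))%F = fC 1.
Proof. intros; rewrite <- fC_mul; f_equal; field; assumption. Qed.

Lemma qprod_qinv z l : z <> 0 -> (qprod l (fC z) * qinv l z)%F = fC 1.
Proof.
  intros Hz. rewrite qprod_texp by assumption. unfold qinv.
  transitivity ((fC (z ^ length l) * fC (/ z ^ length l)) * (texp (lam_one (psum l) (/ z)) * texp (- lam_one (psum l) (/ z))))%F; [ring|].
  rewrite texp_opp by reflexivity. rewrite fC_inv by (now apply pow_nonzero). ring.
Qed.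

Lemma qinv_logder z l : logder (- lam_one (psum l) (/ z))%F (qinv l z).
Proof.
  unfold qinv. assert (E := logder_mul _ _ _ _ (logder_fC (/ z ^ length l)) (texp_logder (- lam_one (psum l) (/ z))%F
     ltac:(unfold fopp, lam_one; ring))).
  replace (fC 0 + - lam_one (psum l) (/ z))%F with (- lam_one (psum l) (/ z))%F in E by ring. exact E.
Qed.
Lemma qinv_cons z c l : z <> 0 -> qinv (c :: l) z = (qinv [c] z * qinv l z)%F.
Proof.
  intros Hz.
  transitivity ((qprod (c :: l) (fC z) * (qinv [c] z * qinv l z)) * qinv (c :: l) z)%F.
  - replace (qprod (c :: l) (fC z)) with (qprod [c] (fC z) * qprod l (fC z))%F by (simpl; ring).
    transitivity ((qprod [c] (fC z) * qinv [c] z) * (qprod l (fC z) * qinv l z) * qinv (c :: l) z)%F;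
      [rewrite !qprod_qinv by assumption|]; ring.
  - transitivity ((qprod (c :: l) (fC z) * qinv (c :: l) z) * (qinv [c] z * qinv l z))%F; [ring|].
    rewrite qprod_qinv by assumption; ring.
Qed.

(** Moving z by 2 X adds 2 to every shift; the row variable p + 1 + 2a is
    treated in this way. *)
Lemma qprod_shift l z : qprod l (z + fC 2 * fX)%F = qprod (map (Z.add 2) l) z.
Proof.
  induction l as [|c l IH]; [reflexivity|]. cbn [qprod fold_right map] in *.
  change (fold_right (fun c acc => (lin (z + fC 2 * fX) c * acc)%F) (fC 1) l) with (qprod l (z + fC 2 * fX)%F).
  rewrite IH. unfold lin. rewrite plus_IZR, fC_add. unfold qprod at 1. unfold lin. ring.
Qed.

Fixpoint pfac (l : list Z) (N : nat) : fps :=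
  match N with O => fC 1 | S n => (pfac l n * qprod l (fC (INR (S n))))%F end.
Fixpoint pfac_inv (l : list Z) (N : nat) : fps :=
  match N with O => fC 1 | S n => (pfac_inv l n * qinv l (INR (S n)))%F end.
Fixpoint harm (N k : nat) : R :=
  match N with O => 0 | S n => harm n k + / INR (S n) ^ k end.
Definition zetak (k : nat) : R := Series (fun n => / INR (S n) ^ k).

Lemma INR_S_neq n : INR (S n) <> 0.
Proof. apply not_0_INR; lia. Qed.

Definition lam_part (w : nat -> R) (N : nat) : fps :=
  fun k => match k with O => 0 | S _ => - (-1) ^ k * (w k * harm N k) end.

Lemma lam_part_S w N : lam_part w (S N) = (lam_part w N + lam_one w (/ INR (S N)))%F.
Proof.
  apply fps_ext; intros [|k]; unfold lam_part, fadd, lam_one; [ring|].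
  cbn [harm]. replace (- / INR (S N)) with (-1 * / INR (S N)) by ring.
  rewrite Rpow_mult_distr, pow_inv. ring.
Qed.

(** Only the length of l and the power sums of its entries enter, which is the
    reason why terms built from different integers can be compared. *)
Lemma pfac_logder l N : logder (lam_part (psum l) N) (pfac l N).
Proof.
  induction N as [|n IH].
  - simpl. replace (lam_part (psum l) 0) with (fC 0); [apply logder_fC|].
    apply fps_ext; intros [|k]; unfold lam_part; simpl; ring.
  - rewrite lam_part_S. cbn [pfac]. apply logder_mul; [exact IH|]. apply qprod_logder, INR_S_neq.
Qed.
Lemma pfac_inv_logder l N : logder (- lam_part (psum l) N)%F (pfac_inv l N).
Proof.
  induction N as [|n IH].
  - simpl. replace (- lam_part (psum l) 0)%F with (fC 0); [apply logder_fC|].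
    apply fps_ext; intros [|k]; unfold lam_part, fopp; simpl; ring.
  - rewrite lam_part_S. cbn [pfac_inv].
    replace (- (lam_part (psum l) n + lam_one (psum l) (/ INR (S n))))%F
      with (- lam_part (psum l) n + - lam_one (psum l) (/ INR (S n)))%F by ring.
    apply logder_mul; [exact IH|]. apply qinv_logder.
Qed.
Lemma pfac_pfac_inv l N : (pfac l N * pfac_inv l N)%F = fC 1.
Proof.
  induction N as [|n IH]; [simpl; ring|]. cbn [pfac pfac_inv].
  transitivity ((pfac l n * pfac_inv l n) * (qprod l (fC (INR (S n))) * qinv l (INR (S n))))%F; [ring|].
  rewrite IH, qprod_qinv by apply INR_S_neq. ring.
Qed.
Lemma pfac_0 l N : pfac l N O = INR (fact N) ^ length l.
Proof.
  induction N as [|n IH]; [simpl; now rewrite pow1|].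
  cbn [pfac]. change ((pfac l n * qprod l (fC (INR (S n))))%F O) with (pfac l n O * qprod l (fC (INR (S n))) O).
  rewrite IH, qprod_0, <- Rpow_mult_distr. f_equal.
  rewrite fact_simpl, mult_INR. ring.
Qed.
Lemma pfac_inv_0 l N : pfac_inv l N O = / INR (fact N) ^ length l.
Proof.
  assert (H : pfac l N O * pfac_inv l N O = 1).
  { change (pfac l N O * pfac_inv l N O) with ((pfac l N * pfac_inv l N)%F O). now rewrite pfac_pfac_inv. }
  rewrite pfac_0 in H.
  apply Rmult_eq_reg_l with (INR (fact N) ^ length l); [|apply pow_nonzero, INR_fact_neq_0].
  rewrite H. field. apply pow_nonzero, INR_fact_neq_0.
Qed.

Lemma harm_series N k : harm (S N) k = sum_n (fun n => / INR (S n) ^ k) N.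
Proof.
  induction N as [|N IH].
  - rewrite sum_O. simpl harm. apply Rplus_0_l.
  - rewrite sum_Sn, <- IH. reflexivity.
Qed.

Lemma harm_pos N k : 0 <= harm N k.
Proof.
  induction N as [|N IH]; simpl; [lra|].
  assert (0 < / INR (S N) ^ k) by (apply Rinv_0_lt_compat, pow_lt, lt_0_INR; lia).
  simpl in *; lra.
Qed.
Lemma harm_2 N : harm (S N) 2 <= 2 - / INR (S N).
Proof.
  induction N as [|N IH]; [simpl; lra|].
  change (harm (S (S N)) 2) with (harm (S N) 2 + / INR (S (S N)) ^ 2).
  rewrite (S_INR (S N)). assert (0 < INR (S N)) by (apply lt_0_INR; lia). set (x := INR (S N)) in *.
  assert (/ (x + 1) ^ 2 <= / x - / (x + 1)).
  { replace (/ x - / (x + 1)) with (/ (x * (x + 1))) by (field; lra).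
    apply Rinv_le_contravar; [apply Rmult_lt_0_compat; lra|nra]. }
  lra.
Qed.
Lemma harm_mono_k N k j : (k <= j)%nat -> harm N j <= harm N k.
Proof.
  intros Hkj. induction N as [|N IH]; [simpl; lra|].
  cbn [harm]. assert (1 <= INR (S N)) by (rewrite S_INR; pose proof (pos_INR N); lra).
  assert (/ INR (S N) ^ j <= / INR (S N) ^ k); [|lra].
  apply Rinv_le_contravar; [apply pow_lt; lra|]. now apply Rle_pow.
Qed.

(** The bound is uniform in N and k, so the finite products below have power
    series on a common disc. *)
Lemma harm_bound N k : (2 <= k)%nat -> harm N k <= 2.
Proof.
  intros Hk. destruct N as [|N]; [simpl; lra|].
  eapply Rle_trans; [apply (harm_mono_k _ 2); assumption|].
  eapply Rle_trans; [apply harm_2|].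
  assert (0 < / INR (S N)) by (apply Rinv_0_lt_compat, lt_0_INR; lia). lra.
Qed.
Lemma zetak_is_series k : (2 <= k)%nat -> is_series (fun n => / INR (S n) ^ k) (zetak k).
Proof.
  intros Hk. apply Series_correct.
  destruct (ex_finite_lim_seq_incr (sum_n (fun n => / INR (S n) ^ k)) 2) as [l Hl].
  - intros n. rewrite sum_Sn. unfold plus; simpl.
    assert (0 < / INR (S (S n)) ^ k) by (apply Rinv_0_lt_compat, pow_lt, lt_0_INR; lia).
    simpl in *; lra.
  - intros n. rewrite <- harm_series. now apply harm_bound.
  - exists l. exact Hl.
Qed.
Lemma harm_lim k : (2 <= k)%nat -> is_lim_seq (fun N => harm N k) (zetak k).
Proof.
  intros Hk. apply is_lim_seq_incr_1.
  apply is_lim_seq_ext with (sum_n (fun n => / INR (S n) ^ k)).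
  - intros n; symmetry; apply harm_series.
  - apply (zetak_is_series k Hk).
Qed.
Lemma zetak_bounds k : (2 <= k)%nat -> 0 <= zetak k <= 2.
Proof.
  intros Hk; split.
  - apply (is_lim_seq_le (fun _ => 0) (fun N => harm N k) 0 (zetak k)); [intros; apply harm_pos|apply is_lim_seq_const|now apply harm_lim].
  - apply (is_lim_seq_le (fun N => harm N k) (fun _ => 2) (zetak k) 2); [intros; now apply harm_bound|now apply harm_lim|apply is_lim_seq_const].
Qed.

(** The coefficient 1, which would involve the divergent harmonic series, is
    replaced by 0; in the uses below its weight w 1 vanishes. *)
Definition lam_full (w : nat -> R) : fps :=
  fun k => match k with O => 0 | 1%nat => 0 | _ => - (-1) ^ k * (w k * zetak k) end.

Lemma lam_part_lim w : w 1%nat = 0 -> flim (lam_part w) (lam_full w).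
Proof.
  intros Hw [|[|k]].
  - apply is_lim_seq_const.
  - apply is_lim_seq_ext with (fun _ => 0); [intros; unfold lam_part; rewrite Hw; ring|apply is_lim_seq_const].
  - unfold lam_part, lam_full.
    apply (is_lim_seq_scal_l (fun N => w (S (S k)) * harm N (S (S k))) _ (w (S (S k)) * zetak (S (S k)))).
    apply (is_lim_seq_scal_l (fun N => harm N (S (S k))) _ (zetak (S (S k)))). apply harm_lim; lia.
Qed.

(** * A norm on jets, and the grid of WZ pairs *)

(** In the norm that follows X has size at most 1/1000, so that i + c X with
    |c| <= 5 is a small perturbation of i; the estimates of the grid leave
    this much room. *)
Definition rho : R := / 1000.

(** The sum of |a_k| rho^k over k <= n, which is submultiplicative. *)
Fixpoint nrm (n : nat) (a : fps) : R :=
  match n with O => Rabs (a O) | S n' => Rabs (a O) + rho * nrm n' (shift a) end.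

Lemma rho_pos : 0 < rho. Proof. unfold rho; lra. Qed.
Lemma nrm_pos n : forall a, 0 <= nrm n a.
Proof.
  induction n as [|n IH]; intros a; simpl; [apply Rabs_pos|].
  pose proof (Rabs_pos (a O)). pose proof (IH (shift a)). pose proof rho_pos. nra.
Qed.
Lemma nrm_add n : forall a b, nrm n (a + b)%F <= nrm n a + nrm n b.
Proof.
  induction n as [|n IH]; intros a b; simpl; unfold fadd at 1.
  - apply Rabs_triang.
  - pose proof (Rabs_triang (a O) (b O)). pose proof (IH (shift a) (shift b)).
    change (shift (a + b)%F) with (shift a + shift b)%F. pose proof rho_pos. nra.
Qed.
Lemma nrm_opp n : forall a, nrm n (- a)%F = nrm n a.
Proof.
  induction n as [|n IH]; intros a; simpl; unfold fopp at 1; rewrite Rabs_Ropp; [reflexivity|].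
  change (shift (- a)%F) with (- shift a)%F. now rewrite IH.
Qed.
Lemma nrm_scal n x : forall a, nrm n (fun k => x * a k) = Rabs x * nrm n a.
Proof.
  induction n as [|n IH]; intros a; simpl; rewrite Rabs_mult; [reflexivity|].
  change (shift (fun k => x * a k)) with (fun k => x * shift a k). rewrite IH. ring.
Qed.
Lemma nrm_le_S n : forall a, nrm n a <= nrm (S n) a.
Proof.
  induction n as [|n IH]; intros a.
  - simpl. pose proof (Rabs_pos (shift a O)). pose proof rho_pos. nra.
  - change (nrm (S n) a) with (Rabs (a O) + rho * nrm n (shift a)).
    change (nrm (S (S n)) a) with (Rabs (a O) + rho * nrm (S n) (shift a)).
    specialize (IH (shift a)). pose proof rho_pos. nra.
Qed.
Lemma nrm_mul n : forall a b, nrm n (a * b)%F <= nrm n a * nrm n b.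
Proof.
  induction n as [|n IH]; intros a b.
  - simpl. unfold fmul; simpl. rewrite Rabs_mult; lra.
  - change (nrm (S n) (a * b)%F) with (Rabs (a O * b O) + rho * nrm n (shift (a * b)%F)).
    rewrite shift_mul, Rabs_mult.
    pose proof (nrm_add n (fun k => a O * shift b k) (shift a * b)%F) as H1.
    rewrite nrm_scal in H1.
    pose proof (IH (shift a) b) as H2. pose proof (nrm_le_S n b) as H3.
    change (nrm (S n) a) with (Rabs (a O) + rho * nrm n (shift a)).
    pose proof (nrm_pos n (shift a)). pose proof (nrm_pos n b). pose proof rho_pos as Hr.
    pose proof (Rabs_pos (a O)).
    assert (nrm n (shift a) * nrm n b <= nrm n (shift a) * nrm (S n) b) by (apply Rmult_le_compat_l; lra).
    replace ((Rabs (a O) + rho * nrm n (shift a)) * nrm (S n) b)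
      with (Rabs (a O) * nrm (S n) b + rho * (nrm n (shift a) * nrm (S n) b)) by ring.
    assert (E : Rabs (a O) * nrm (S n) b = Rabs (a O) * Rabs (b O) + rho * (Rabs (a O) * nrm n (shift b))) by (simpl; ring).
    rewrite E. nra.
Qed.
Lemma nrm_fC n c : nrm n (fC c) = Rabs c.
Proof.
  destruct n; simpl; [reflexivity|].
  replace (shift (fC c)) with (fun k => 0 * fC 0 k).
  - rewrite nrm_scal, Rabs_R0. ring.
  - apply fps_ext; intros k; unfold shift; destruct k; simpl; ring.
Qed.
Lemma nrm_fX n : nrm n fX <= rho.
Proof.
  pose proof rho_pos. destruct n; simpl; rewrite Rabs_R0; [lra|].
  replace (shift fX) with (fC 1) by (apply fps_ext; intros [|k]; reflexivity).
  rewrite nrm_fC, Rabs_R1. lra.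
Qed.
Lemma nrm_coef n : forall (a : fps) k, (k <= n)%nat -> Rabs (a k) <= (/ rho) ^ k * nrm n a.
Proof.
  induction n as [|n IH]; intros a k Hk.
  - replace k with O by lia. simpl; lra.
  - destruct k as [|k].
    + pose proof (nrm_pos n (shift a)). pose proof rho_pos. simpl. nra.
    + specialize (IH (shift a) k ltac:(lia)). unfold shift in IH at 1.
      change (nrm (S n) a) with (Rabs (a O) + rho * nrm n (shift a)).
      pose proof rho_pos. pose proof (Rabs_pos (a O)).
      assert (0 < (/ rho) ^ k) by (apply pow_lt, Rinv_0_lt_compat; assumption).
      eapply Rle_trans; [exact IH|]. simpl.
      replace (/ rho * (/ rho) ^ k * (Rabs (a O) + rho * nrm n (shift a)))
        with ((/ rho) ^ k * nrm n (shift a) + / rho * ((/ rho) ^ k * Rabs (a O))) by (field; lra).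
      assert (0 <= / rho * ((/ rho) ^ k * Rabs (a O))); [|lra].
      apply Rmult_le_pos; [left; now apply Rinv_0_lt_compat|]. apply Rmult_le_pos; lra.
Qed.

Lemma nrm_mul_le n a b x y : nrm n a <= x -> nrm n b <= y -> nrm n (a * b)%F <= x * y.
Proof.
  intros Ha Hb. eapply Rle_trans; [apply nrm_mul|].
  apply Rmult_le_compat; auto using nrm_pos.
Qed.
Lemma nrm_add_le n a b x y : nrm n a <= x -> nrm n b <= y -> nrm n (a + b)%F <= x + y.
Proof. intros Ha Hb. eapply Rle_trans; [apply nrm_add|]. lra. Qed.
Lemma nrm_sub_le n a b x y : nrm n a <= x -> nrm n b <= y -> nrm n (a - b)%F <= x + y.
Proof. intros Ha Hb. unfold fsub. apply nrm_add_le; [assumption|]. now rewrite nrm_opp. Qed.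
Lemma nrm_fC_le n c x : Rabs c <= x -> nrm n (fC c) <= x.
Proof. now rewrite nrm_fC. Qed.

Definition bounded_by (M : R) (l : list Z) := List.Forall (fun c => Rabs (IZR c) <= M) l.

Lemma nrm_lin n M c z : 0 <= z -> Rabs (IZR c) <= M -> nrm n (lin (fC z) c) <= z + M * rho.
Proof.
  intros Hz Hc. unfold lin. apply nrm_add_le.
  - rewrite nrm_fC, Rabs_pos_eq; lra.
  - apply nrm_mul_le; [now apply nrm_fC_le|apply nrm_fX].
Qed.

Lemma nrm_qprod n M l z : 0 <= z -> bounded_by M l -> nrm n (qprod l (fC z)) <= (z + M * rho) ^ length l.
Proof.
  intros Hz Hl; induction Hl as [|c l Hc Hl IH].
  - simpl. rewrite nrm_fC, Rabs_R1; lra.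
  - cbn [qprod fold_right length]. simpl pow. apply nrm_mul_le; [now apply nrm_lin|exact IH].
Qed.

(** The inverse u of z + c X satisfies u = (1 - c X u) / z; take norms and
    solve for that of u. *)
Lemma nrm_qinv1 n M c z : 0 < z -> Rabs (IZR c) <= M -> M * rho < z ->
  nrm n (qinv [c] z) <= / (z - M * rho).
Proof.
  intros Hz Hc HM.
  assert (E : qinv [c] z = (fC (/ z) * (fC 1 - fC (IZR c) * fX * qinv [c] z))%F).
  { assert (H := qprod_qinv z [c] ltac:(lra)). unfold qprod, lin in H; simpl in H.
    rewrite <- H.
    transitivity ((fC z * fC (/ z)) * qinv [c] z)%F; [rewrite fC_inv by lra; ring|ring]. }
  assert (H : nrm n (qinv [c] z) <= / z * (1 + M * rho * nrm n (qinv [c] z))).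
  { rewrite E at 1. apply nrm_mul_le.
    - apply nrm_fC_le. rewrite Rabs_pos_eq; [lra|left; now apply Rinv_0_lt_compat].
    - apply nrm_sub_le; [rewrite nrm_fC, Rabs_R1; lra|].
      apply nrm_mul_le; [apply nrm_mul_le; [now apply nrm_fC_le|apply nrm_fX]|lra]. }
  set (x := nrm n (qinv [c] z)) in *.
  apply Rmult_le_reg_l with (z - M * rho); [lra|]. rewrite Rinv_r by lra.
  assert (z * x <= 1 + M * rho * x).
  { apply Rmult_le_reg_l with (/ z); [now apply Rinv_0_lt_compat|].
    rewrite <- Rmult_assoc, Rinv_l, Rmult_1_l by lra. exact H. }
  lra.
Qed.

Lemma nrm_qinv n M l z : 0 < z -> bounded_by M l -> M * rho < z ->
  nrm n (qinv l z) <= (/ (z - M * rho)) ^ length l.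
Proof.
  intros Hz Hl HM; induction Hl as [|c l Hc Hl IH].
  - unfold qinv. simpl length. simpl pow.
    replace (- lam_one (psum []) (/ z))%F with (fC 0)
      by (apply fps_ext; intros [|k]; unfold fopp, lam_one; simpl; ring).
    rewrite texp_zero. replace (fC (/ 1) * fC 1)%F with (fC 1) by (rewrite Rinv_1; ring).
    rewrite nrm_fC, Rabs_R1; lra.
  - rewrite qinv_cons by lra. cbn [length pow]. apply nrm_mul_le; [now apply nrm_qinv1|exact IH].
Qed.

Fixpoint fsum (f : nat -> fps) (N : nat) : fps :=
  match N with O => fC 0 | S n => (fsum f n + f n)%F end.

Definition shift2 (l : list Z) := map (Z.add 2) l.

(** The three variables of the grid point (p, q): kappa = p + 1 + 2a, m = q +
    1 and s = kappa + m - 1. *)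
Definition kvar (p : nat) : fps := (fC (INR (S p)) + fC 2 * fX)%F.
Definition mvar (q : nat) : fps := fC (INR (S q)).
Definition svar (t : nat) : fps := (fC (INR (S t)) + fC 2 * fX)%F.

Lemma kvar_S p : kvar (S p) = (kvar p + fC 1)%F.
Proof. unfold kvar. rewrite (S_INR (S p)), (fC_add (INR (S p)) 1). ring. Qed.
Lemma mvar_S q : mvar (S q) = (mvar q + fC 1)%F.
Proof. unfold mvar. now rewrite (S_INR (S q)), (fC_add (INR (S q)) 1). Qed.
Lemma svar_S p q : svar (S (p + q)) = (kvar p + mvar q)%F.
Proof.
  unfold svar, kvar, mvar. replace (INR (S (S (p + q)))) with (INR (S p) + INR (S q)) by (rewrite !S_INR, plus_INR; ring).
  rewrite (fC_add (INR (S p)) (INR (S q))). ring.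
Qed.
Lemma svar_add p q : svar (p + q) = (kvar p + mvar q - fC 1)%F.
Proof. rewrite <- svar_S. change (svar (S (p + q))) with (kvar (S (p + q))). rewrite kvar_S. change (kvar (p + q)) with (svar (p + q)). ring. Qed.
Lemma lin_even t : lin (fC (2 * INR (S t))) 4 = (fC 2 * svar t)%F.
Proof. unfold lin, svar. rewrite (fC_mul 2 (INR (S t))). ring. Qed.
Lemma lin_odd t : lin (fC (2 * INR (S t) + 1)) 4 = (fC 2 * svar t + fC 1)%F.
Proof. rewrite <- lin_even. unfold lin. rewrite (fC_add (2 * INR (S t)) 1). ring. Qed.
Lemma qprod4 z : qprod [4%Z] z = lin z 4.
Proof. unfold qprod; cbn [fold_right]. ring. Qed.
Lemma kvar_inv p : (fC 2 * kvar p * qinv [4%Z] (2 * INR (S p)))%F = fC 1.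
Proof.
  change (kvar p) with (svar p). rewrite <- lin_even, <- qprod4. apply qprod_qinv. pose proof (INR_S_neq p). lra.
Qed.
Lemma kvar_inv1 p : ((fC 2 * kvar p + fC 1) * qinv [4%Z] (2 * INR (S p) + 1))%F = fC 1.
Proof.
  change (kvar p) with (svar p). rewrite <- lin_odd, <- qprod4. apply qprod_qinv. pose proof (pos_INR (S p)). lra.
Qed.
Lemma kvar_inv2 p : ((fC 2 * kvar p + fC 2) * qinv [4%Z] (2 * INR (S p) + 2))%F = fC 1.
Proof.
  rewrite <- (kvar_inv (S p)), kvar_S. f_equal; [ring|]. f_equal. rewrite (S_INR (S p)). ring.
Qed.
Lemma qprod_svar l p q : (qprod l (kvar p + mvar q) * qinv (shift2 l) (INR (S (p + q)) + 1))%F = fC 1.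
Proof.
  rewrite <- svar_S, <- S_INR. unfold svar. rewrite qprod_shift. apply qprod_qinv, INR_S_neq.
Qed.

Section Grid.
Variable c : case.

(** The factors [baseA], [baseB], [baseC] of the product of gamma values
    depend on p, q and p + q respectively, and each is normalised to 1 at
    0. *)
Fixpoint baseA (p : nat) : fps :=
  match p with O => fC 1 | S p' =>
    (baseA p' * (qprod (shift2 (mus c)) (fC (INR p)) * (qinv [4%Z] (2 * INR p + 1) * qinv [4%Z] (2 * INR p + 2))))%F end.
Fixpoint baseB (q : nat) : fps :=
  match q with O => fC 1 | S q' =>
    (baseB q' * (qprod (mus c) (fC (INR q)) * fC (/ ((2 * INR q + 1) * (2 * INR q + 2)))))%F end.
Fixpoint baseC (t : nat) : fps :=
  match t with O => fC 1 | S t' =>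
    (baseC t' * (lin (fC (2 * INR t)) 4 * lin (fC (2 * INR t + 1)) 4 * qinv (shift2 (nus c)) (INR t + 1)))%F end.
Definition base (p q : nat) : fps := (baseA p * baseB q * baseC (p + q))%F.
Definition flowP (p q : nat) : fps :=
  (base p q * (fC 2 * svar (p + q)) * (wzB c (kvar p) (mvar q - fC 1) * (fC 2 * mvar q * (fC 2 * mvar q - fC 1))))%F.
Definition flowM (p q : nat) : fps :=
  (base p q * (fC 2 * svar (p + q)) * (wzB c (mvar q) (kvar p - fC 1) * (fC 2 * kvar p * (fC 2 * kvar p - fC 1))))%F.

Hypothesis HWZ : wz_identity c.

(** Dividing by [base p q] and clearing the denominators of one step leaves
    [wz_identity] at (kappa, m). *)
Lemma grid_closed p q : (flowP p q + flowM (S p) q = flowM p q + flowP p (S q))%F.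
Proof.
  unfold flowP, flowM, base. rewrite Nat.add_succ_r, Nat.add_succ_l. cbn [baseA baseB baseC].
  set (t := (p + q)%nat).
  assert (Hk : qprod (shift2 (mus c)) (fC (INR (S p))) = qprod (mus c) (kvar p)) by (symmetry; apply qprod_shift).
  rewrite Hk.
  set (u := qinv (shift2 (nus c)) (INR (S t) + 1)).
  set (i1 := qinv [4%Z] (2 * INR (S p) + 1)). set (i2 := qinv [4%Z] (2 * INR (S p) + 2)).
  assert (Hq : 0 < INR (S q)) by (apply lt_0_INR; lia).
  assert (E1 : ((fC 2 * kvar p + fC 1) * i1 = fC 1)%F) by apply kvar_inv1.
  assert (E2 : ((fC 2 * kvar p + fC 2) * i2 = fC 1)%F) by apply kvar_inv2.
  assert (E3 : (qprod (nus c) (kvar p + mvar q) * u = fC 1)%F) by apply qprod_svar.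
  assert (E4 : (((fC 2 * mvar q + fC 1) * (fC 2 * mvar q + fC 2)) * fC (/ ((2 * INR (S q) + 1) * (2 * INR (S q) + 2))) = fC 1)%F).
  { unfold mvar. rewrite <- (fC_mul 2 (INR (S q))), <- (fC_add (2 * INR (S q)) 1), <- (fC_add (2 * INR (S q)) 2),
      <- (fC_mul (2 * INR (S q) + 1)), <- (fC_mul ((2 * INR (S q) + 1) * (2 * INR (S q) + 2))). f_equal. field. split; lra. }
  set (i3 := fC (/ ((2 * INR (S q) + 1) * (2 * INR (S q) + 2)))) in *.
  rewrite lin_even, lin_odd, (kvar_S p), mvar_S. unfold t. rewrite svar_S, svar_add. fold t.
change (qprod (mus c) (fC (INR (S q)))) with (qprod (mus c) (mvar q)).
  assert (W := HWZ (kvar p) (mvar q)).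
  set (k := kvar p) in *. set (m := mvar q) in *.
  replace (k + fC 1 - fC 1)%F with k by ring. replace (m + fC 1 - fC 1)%F with m by ring.
  set (Bkm := wzB c k m) in *. set (Bmk := wzB c m k) in *.
  set (B1 := wzB c k (m - fC 1)%F) in *. set (B2 := wzB c m (k - fC 1)%F) in *.
  set (D := qprod (nus c) (k + m)%F) in *. set (qk := qprod (mus c) k) in *. set (qm := qprod (mus c) m) in *.
  set (b := (baseA p * baseB q * baseC t)%F).
  transitivity ((b * (fC 2 * (k + m - fC 1)) * (B2 * (fC 2 * k * (fC 2 * k - fC 1)))) +
     b * (fC 2 * (k + m - fC 1)) * u * (D * (B1 * (fC 2 * m * (fC 2 * m - fC 1)) - B2 * (fC 2 * k * (fC 2 * k - fC 1))))
     + b * (fC 2 * (k + m - fC 1)) * (fC 2 * (k + m - fC 1) + fC 1) * u * qk * (fC 2 * (k + m)) * Bmk * (((fC 2 * k + fC 1) * i1) * ((fC 2 * k + fC 2) * i2)))%F.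
  - transitivity ((b * (fC 2 * (k + m - fC 1)) * (B2 * (fC 2 * k * (fC 2 * k - fC 1)))) +
     b * (fC 2 * (k + m - fC 1)) * (D * u) * (B1 * (fC 2 * m * (fC 2 * m - fC 1)) - B2 * (fC 2 * k * (fC 2 * k - fC 1)))
     + b * (fC 2 * (k + m - fC 1)) * (fC 2 * (k + m - fC 1) + fC 1) * u * qk * (fC 2 * (k + m)) * Bmk * (((fC 2 * k + fC 1) * i1) * ((fC 2 * k + fC 2) * i2)))%F; [|ring].
    rewrite E3. unfold b; ring.
  - rewrite W, E1, E2.
    transitivity (b * (fC 2 * (k + m - fC 1)) * (B2 * (fC 2 * k * (fC 2 * k - fC 1))) +
      b * (fC 2 * (k + m - fC 1)) * (fC 2 * (k + m - fC 1) + fC 1) * u * qm * (fC 2 * (k + m)) * Bkm *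
        (((fC 2 * m + fC 1) * (fC 2 * m + fC 2)) * i3))%F; [rewrite E4; ring|unfold b; ring].
Qed.

Lemma column_shift p Q : (fsum (flowM (S p)) Q = fsum (flowM p) Q + flowP p Q - flowP p 0)%F.
Proof.
  induction Q as [|Q IH]; cbn [fsum]; [ring|].
  rewrite IH. assert (E := grid_closed p Q).
  transitivity (fsum (flowM p) Q + (flowP p Q + flowM (S p) Q) - flowP p 0)%F; [ring|]. rewrite E; ring.
Qed.

(** The staircase and the path along the row q = 0 and then up the column p =
    N have the same end points. *)
Lemma diagonal_path N :
  (fsum (fun n => flowP n n + flowM (S n) n) N = fsum (fun p => flowP p 0) N + fsum (flowM N) N)%F.
Proof.
  induction N as [|N IH]; cbn [fsum]; [ring|].
  rewrite IH, column_shift. ring.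
Qed.
End Grid.

(** * Decay on the grid *)

(** The left-hand ratio of consecutive values is about (x / (x + 1))^9.  One
    power more than needed leaves a factor of about 1 - 1/x, which absorbs the
    terms in rho. *)
Lemma row_ratio_bound x : 1 <= x ->
  (x + 5 * rho) ^ 8 * ((2 * x + 4 * rho) * (/ (2 * x + 2 - 4 * rho)) ^ 1 * (/ (x + 1 - 4 * rho)) ^ 8)
    * (x + 1) ^ 8 <= x ^ 8.
Proof.
  intros Hx. unfold rho.
  set (w := x + 1 - 4 * / 1000). assert (Hw : 0 < w) by (unfold w; lra).
  set (d := / 100 * / x).
  assert (Hix : 0 < / x <= 1).
  { split; [apply Rinv_0_lt_compat; lra|]. rewrite <- Rinv_1. apply Rinv_le_contravar; lra. }
  (* The terms in rho cost less than a factor 1 + d in each of the eight powers, and 9 d is small against 1 / x. *)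
  assert (Hd : 0 < d <= / 100) by (unfold d; split; nra).
  assert (Hxd : d * x = / 100) by (unfold d; field; lra).
  assert (Hy : (x + 5 * / 1000) * (x + 1) * / w <= x * (1 + d)).
  { apply Rmult_le_reg_r with w; [assumption|].
    replace ((x + 5 * / 1000) * (x + 1) * / w * w) with ((x + 5 * / 1000) * (x + 1)) by (field; lra).
    unfold w. nra. }
  assert (Hy0 : 0 <= (x + 5 * / 1000) * (x + 1) * / w).
  { apply Rmult_le_pos; [nra|]. left; now apply Rinv_0_lt_compat. }
  assert (Hz : (2 * x + 4 * / 1000) * / (2 * x + 2 - 4 * / 1000) * (1 + 9 * d) <= 1).
  { apply Rmult_le_reg_r with (2 * x + 2 - 4 * / 1000); [lra|].
    replace ((2 * x + 4 * / 1000) * / (2 * x + 2 - 4 * / 1000) * (1 + 9 * d) * (2 * x + 2 - 4 * / 1000))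
      with ((2 * x + 4 * / 1000) * (1 + 9 * d)) by (field; lra). nra. }
  set (z := (2 * x + 4 * / 1000) * / (2 * x + 2 - 4 * / 1000)) in *.
  assert (Hz0 : 0 <= z).
  { unfold z; apply Rmult_le_pos; [lra|]. left; apply Rinv_0_lt_compat; lra. }
  assert (H8 : ((x + 5 * / 1000) * (x + 1) * / w) ^ 8 <= x ^ 8 * (1 + 9 * d)).
  { eapply Rle_trans; [apply pow_incr; split; [exact Hy0|exact Hy]|].
    rewrite Rpow_mult_distr. apply Rmult_le_compat_l; [apply pow_le; lra|].
    assert (E2 : (1 + d) ^ 2 <= 1 + 2.01 * d) by (simpl; nra).
    assert (E4 : ((1 + d) ^ 2) ^ 2 <= 1 + 4.07 * d).
    { eapply Rle_trans; [apply pow_incr; split; [apply pow_le; lra|exact E2]|]. simpl; nra. }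
    replace ((1 + d) ^ 8) with ((((1 + d) ^ 2) ^ 2) ^ 2) by ring.
    eapply Rle_trans; [apply pow_incr; split; [do 2 apply pow_le; lra|exact E4]|]. simpl; nra. }
  replace ((x + 5 * / 1000) ^ 8 * ((2 * x + 4 * / 1000) * (/ (2 * x + 2 - 4 * / 1000)) ^ 1 * (/ w) ^ 8) * (x + 1) ^ 8)
    with (z * ((x + 5 * / 1000) * (x + 1) * / w) ^ 8) by (unfold z; rewrite !Rpow_mult_distr; ring).
  eapply Rle_trans; [apply Rmult_le_compat_l; [exact Hz0|exact H8]|].
  replace (z * (x ^ 8 * (1 + 9 * d))) with (x ^ 8 * (z * (1 + 9 * d))) by ring.
  rewrite <- (Rmult_1_r (x ^ 8)) at 2. apply Rmult_le_compat_l; [apply pow_le; clear - Hx; lra|exact Hz].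
Qed.

(** A step up a column multiplies by about (m / s)^6, and m / s <= 1/2 below
    the diagonal. *)
Lemma col_ratio_bound m s0 : 1 <= m -> 2 * m <= s0 ->
  (m + 3 * rho) ^ 8 * / ((2 * m + 1) * (2 * m + 2)) *
   ((2 * s0 + 4 * rho) * (2 * s0 + 1 + 4 * rho) * (/ (s0 + 1 - 4 * rho)) ^ 8) <= / 2.
Proof.
  intros Hm Hs. unfold rho. set (w := s0 + 1 - 4 * / 1000). assert (Hw : 0 < w) by (unfold w; lra).
  set (a := m + 3 * / 1000). set (r := a * / w).
  assert (Hiw : 0 < / w) by now apply Rinv_0_lt_compat.
  assert (Hr : 0 <= r <= / 2).
  { split; [unfold r, a; apply Rmult_le_pos; lra|].
    apply Rmult_le_reg_r with w; [assumption|]. unfold r. rewrite Rmult_assoc, Rinv_l by lra. unfold a, w. lra. }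
  assert (H6 : r ^ 6 <= / 64).
  { replace (/ 64) with ((/ 2) ^ 6) by lra. apply pow_incr. exact Hr. }
  assert (Hs2 : (2 * s0 + 4 * / 1000) * (2 * s0 + 1 + 4 * / 1000) <= 4 * w ^ 2) by (unfold w; nra).
  assert (Hden : 0 < (2 * m + 1) * (2 * m + 2)) by nra.
  replace (a ^ 8 * / ((2 * m + 1) * (2 * m + 2)) * ((2 * s0 + 4 * / 1000) * (2 * s0 + 1 + 4 * / 1000) * (/ w) ^ 8))
    with (r ^ 6 * (r ^ 2 * ((2 * s0 + 4 * / 1000) * (2 * s0 + 1 + 4 * / 1000))) * / ((2 * m + 1) * (2 * m + 2)))
    by (unfold r; rewrite !Rpow_mult_distr; ring).
  assert (H2 : r ^ 2 * ((2 * s0 + 4 * / 1000) * (2 * s0 + 1 + 4 * / 1000)) <= 4 * a ^ 2).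
  { eapply Rle_trans; [apply Rmult_le_compat_l; [apply pow_le; lra|exact Hs2]|].
    unfold r. right; field; lra. }
  apply Rmult_le_reg_r with ((2 * m + 1) * (2 * m + 2)); [assumption|].
  rewrite Rmult_assoc, Rinv_l, Rmult_1_r by lra.
  assert (0 <= r ^ 6) by (apply pow_le; lra).
  assert (0 <= 4 * a ^ 2) by (assert (0 <= a ^ 2) by apply pow2_ge_0; lra).
  assert (r ^ 6 * (r ^ 2 * ((2 * s0 + 4 * / 1000) * (2 * s0 + 1 + 4 * / 1000))) <= / 64 * (4 * a ^ 2)).
  { eapply Rle_trans; [apply Rmult_le_compat_l; [assumption|exact H2]|]. nra. }
  assert (a ^ 2 <= (2 * m + 1) * (2 * m + 2)) by (unfold a; nra). lra.
Qed.

Section Col.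
Variable c : case.
Hypothesis HWZ : wz_identity c.
Hypothesis Hcs : bounded_by 3 (mus c).
Hypothesis Hds : bounded_by 2 (nus c).
Hypothesis Lcs : length (mus c) = 8%nat.
Hypothesis Lds : length (nus c) = 8%nat.
Let n := 7%nat.

Lemma bounded_by_shift2 M l : bounded_by M l -> bounded_by (M + 2) (shift2 l).
Proof.
  intros H; induction H as [|x l Hx Hl IH]; constructor; [|exact IH].
  rewrite plus_IZR. eapply Rle_trans; [apply Rabs_triang|].
  rewrite (Rabs_pos_eq 2) by lra. lra.
Qed.
Lemma len_shift2 l : length (shift2 l) = length l.
Proof. apply length_map. Qed.

Lemma bnd4 : Rabs (IZR 4) <= 4.
Proof. rewrite Rabs_pos_eq; lra. Qed.

Lemma base_row_step p : (base c (S p) 0 = base c p 0 *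
  (qprod (shift2 (mus c)) (fC (INR (S p))) * (lin (fC (2 * INR (S p))) 4 * qinv [4%Z] (2 * INR (S p) + 2)
    * qinv (shift2 (nus c)) (INR (S p) + 1))))%F.
Proof.
  unfold base. rewrite !Nat.add_0_r. cbn [baseA baseB baseC].
  assert (Hp : 0 < INR (S p)) by (clear; apply lt_0_INR; lia).
  assert (E : (lin (fC (2 * INR (S p) + 1)) 4 * qinv [4%Z] (2 * INR (S p) + 1))%F = fC 1).
  { rewrite <- (qprod_qinv (2 * INR (S p) + 1) [4%Z]) by lra.
    cbn [qprod fold_right]. ring. }
  transitivity (baseA c p * fC 1 * baseC c p *
  (qprod (shift2 (mus c)) (fC (INR (S p))) * (lin (fC (2 * INR (S p))) 4 * qinv [4%Z] (2 * INR (S p) + 2)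
    * qinv (shift2 (nus c)) (INR (S p) + 1))) * (lin (fC (2 * INR (S p) + 1)) 4 * qinv [4%Z] (2 * INR (S p) + 1)))%F;
   [ring|rewrite E; ring].
Qed.

Lemma base_row_bound p : nrm n (base c p 0) * INR (S p) ^ 8 <= 1.
Proof.
  induction p as [|p IH].
  - unfold base; simpl baseA; simpl baseB; simpl baseC. replace (fC 1 * fC 1 * fC 1)%F with (fC 1) by ring.
    rewrite nrm_fC, Rabs_R1. simpl; lra.
  - set (x := INR (S p)) in *. assert (Hx : 1 <= x) by (unfold x; rewrite S_INR; pose proof (pos_INR p); lra).
    assert (E : nrm n (base c (S p) 0) <= nrm n (base c p 0) *
      ((x + 5 * rho) ^ 8 * ((2 * x + 4 * rho) * (/ (2 * x + 2 - 4 * rho)) ^ 1 * (/ (x + 1 - 4 * rho)) ^ 8))).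
    { rewrite base_row_step. fold x. apply nrm_mul_le; [lra|]. apply nrm_mul_le.
      - rewrite <- Lcs, <- (len_shift2 (mus c)). apply nrm_qprod; [lra|]. replace 5 with (3 + 2) by ring. now apply bounded_by_shift2.
      - assert (R := rho_pos). assert (Rv : rho = / 1000) by reflexivity.
        apply nrm_mul_le; [apply nrm_mul_le|].
        + apply nrm_lin; [lra|apply bnd4].
        + apply (nrm_qinv n 4 [4%Z]); [lra|constructor; [apply bnd4|constructor]|lra].
        + rewrite <- Lds, <- (len_shift2 (nus c)). apply nrm_qinv; [lra| |lra]. replace 4 with (2 + 2) by ring. now apply bounded_by_shift2. }
    rewrite (S_INR (S p)). fold x.
    eapply Rle_trans; [apply Rmult_le_compat_r; [apply pow_le; lra|exact E]|].
    rewrite Rmult_assoc. eapply Rle_trans; [|exact IH].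
    apply Rmult_le_compat_l; [apply nrm_pos|]. now apply row_ratio_bound.
Qed.

Lemma base_col_step p q : (q < p)%nat -> nrm n (base c p (S q)) <= nrm n (base c p q) * / 2.
Proof.
  intros Hq. unfold base at 1. rewrite Nat.add_succ_r. cbn [baseB baseC]. set (t := (p + q)%nat).
  set (m := INR (S q)). set (s0 := INR (S t)).
  assert (Hm : 1 <= m) by (unfold m; rewrite S_INR; pose proof (pos_INR q); lra).
  assert (Hs : 2 * m <= s0).
  { unfold m, s0, t.
    replace 2 with (INR 2) by reflexivity. rewrite <- mult_INR. apply le_INR. lia. }
  replace (baseA c p * (baseB c q * (qprod (mus c) (fC m) * fC (/ ((2 * m + 1) * (2 * m + 2))))) *
    (baseC c t * (lin (fC (2 * s0)) 4 * lin (fC (2 * s0 + 1)) 4 * qinv (shift2 (nus c)) (s0 + 1))))%F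
  with (base c p q * (qprod (mus c) (fC m) * fC (/ ((2 * m + 1) * (2 * m + 2))) *
     (lin (fC (2 * s0)) 4 * lin (fC (2 * s0 + 1)) 4 * qinv (shift2 (nus c)) (s0 + 1))))%F
   by (unfold base, t; ring).
  apply nrm_mul_le; [lra|].
  eapply Rle_trans; [|apply (col_ratio_bound m s0 Hm Hs)].
  assert (R := rho_pos). assert (Rv : rho = / 1000) by reflexivity.
  apply nrm_mul_le; [apply nrm_mul_le|apply nrm_mul_le; [apply nrm_mul_le|]].
  - rewrite <- Lcs. apply nrm_qprod; [lra|assumption].
  - apply nrm_fC_le. rewrite Rabs_pos_eq; [lra|]. left; apply Rinv_0_lt_compat; nra.
  - apply nrm_lin; [lra|apply bnd4].
  - apply nrm_lin; [lra|apply bnd4].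
  - rewrite <- Lds, <- (len_shift2 (nus c)). apply nrm_qinv; [lra| |lra]. replace 4 with (2 + 2) by ring. now apply bounded_by_shift2.
Qed.

Lemma base_bound p q : (q <= p)%nat -> nrm n (base c p q) * INR (S p) ^ 8 <= (/ 2) ^ q.
Proof.
  intros Hq; induction q as [|q IH]; [apply base_row_bound|].
  specialize (IH ltac:(lia)). pose proof (base_col_step p q ltac:(lia)) as H.
  assert (0 <= INR (S p) ^ 8) by (apply pow_le, pos_INR).
  simpl ((/ 2) ^ S q). nra.
Qed.

Definition wzB_const : R := 24 + 3 * Rabs (IZR (sg c)) + Rabs (IZR (pt c)).
Lemma wzB_const_pos : 0 < wzB_const.
Proof. unfold wzB_const. pose proof (Rabs_pos (IZR (sg c))). pose proof (Rabs_pos (IZR (pt c))). lra. Qed.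

Lemma nrm_pow_le a x k : nrm n a <= x -> nrm n (fpow a k) <= x ^ k.
Proof.
  intros H; induction k as [|k IH]; simpl fpow; simpl pow.
  - rewrite nrm_fC, Rabs_R1; lra.
  - now apply nrm_mul_le.
Qed.

Lemma nrm_wzB k m L : 1 <= L -> nrm n k <= L -> nrm n m <= L -> nrm n (wzB c k m) <= wzB_const * L ^ 4.
Proof.
  intros HL Hk Hm. unfold wzB.
  assert (HX : nrm n fX <= 1) by (pose proof (nrm_fX n); unfold rho in *; lra).
  assert (C : forall z, 0 <= z -> nrm n (fC z) <= z) by (intros z Hz; rewrite nrm_fC, Rabs_pos_eq; lra).
  eapply Rle_trans.
  - apply nrm_add_le; [apply nrm_sub_le|].
    + apply nrm_mul_le; [exact Hk|]. apply nrm_add_le; [apply nrm_add_le; [apply nrm_add_le|]|].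
      * apply nrm_mul_le; [apply (C 6); lra|apply nrm_pow_le, Hk].
      * apply nrm_mul_le; [apply nrm_mul_le; [apply (C 9); lra|apply nrm_pow_le, Hk]|exact Hm].
      * apply nrm_mul_le; [apply nrm_mul_le; [apply (C 5); lra|exact Hk]|apply nrm_pow_le, Hm].
      * apply nrm_pow_le, Hm.
    + apply nrm_mul_le; [apply nrm_mul_le; [apply nrm_mul_le; [apply nrm_fC_le, Rle_refl|apply nrm_pow_le, HX]|exact Hk]|].
      apply nrm_add_le; [apply nrm_mul_le; [apply (C 2); lra|exact Hk]|exact Hm].
    + apply nrm_mul_le; [apply nrm_fC_le, Rle_refl|apply nrm_pow_le, HX].
  - rewrite !pow1. unfold wzB_const.
    set (u := Rabs (IZR (sg c))). set (v := Rabs (IZR (pt c))).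
    assert (0 <= u) by apply Rabs_pos. assert (0 <= v) by apply Rabs_pos.
    assert (L ^ 2 <= L ^ 4) by (apply Rle_pow; [lra|lia]).
    assert (1 <= L ^ 4) by (apply pow_R1_Rle; lra).
    replace (L * (6 * L ^ 3 + 9 * L ^ 2 * L + 5 * L * L ^ 2 + L ^ 3)) with (21 * L ^ 4) by ring.
    replace (u * 1 * L * (2 * L + L)) with (3 * u * L ^ 2) by ring.
    nra.
Qed.

(** The polynomial factors grow like the seventh power of N, the gamma factor
    decays like the eighth. *)
Lemma flowM_bound N q : (q < N)%nat -> nrm n (flowM c N q) <= 2048 * wzB_const * / INR (S N) * (/ 2) ^ q.
Proof.
  intros Hq. set (x := INR (S N)).
  assert (HN1 : 1 <= INR N) by (apply (le_INR 1); lia).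
  assert (Hx : x = INR N + 1) by (unfold x; apply S_INR).
  assert (HqN : INR (S q) <= INR N) by (apply le_INR; lia).
  set (L := 2 * x).
  assert (HX2 : nrm n (fC 2 * fX)%F <= 2 * / 1000).
  { apply nrm_mul_le; [rewrite nrm_fC, Rabs_pos_eq; lra|apply nrm_fX]. }
  assert (Hk : nrm n (kvar N) <= x + 2 * / 1000).
  { unfold kvar. apply nrm_add_le; [|exact HX2]. fold x. rewrite nrm_fC, Rabs_pos_eq; lra. }
  assert (Hk1 : nrm n (kvar N - fC 1)%F <= L).
  { eapply Rle_trans; [apply nrm_sub_le; [exact Hk|rewrite nrm_fC, Rabs_R1; apply Rle_refl]|]. unfold L; lra. }
  assert (Hm : nrm n (mvar q) <= L).
  { unfold mvar. rewrite nrm_fC, Rabs_pos_eq by apply pos_INR. unfold L; lra. }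
  assert (Hs : nrm n (svar (N + q)) <= L).
  { unfold svar. eapply Rle_trans; [apply nrm_add_le; [|exact HX2]|].
    - rewrite nrm_fC, Rabs_pos_eq by apply pos_INR. apply Rle_refl.
    - rewrite S_INR, plus_INR. rewrite S_INR in HqN. unfold L; lra. }
  assert (HkL : nrm n (kvar N) <= L) by (unfold L; lra).
  assert (H2 : nrm n (fC 2) <= 2) by (rewrite nrm_fC, Rabs_pos_eq; lra).
  assert (HL : 1 <= L) by (unfold L; lra).
  assert (HF : nrm n (flowM c N q) <= nrm n (base c N q) * (2 * L) * (wzB_const * L ^ 4 * (2 * L * (2 * L + 1)))).
  { unfold flowM. apply nrm_mul_le; [apply nrm_mul_le; [apply Rle_refl|apply nrm_mul_le; assumption]|].
    apply nrm_mul_le; [now apply nrm_wzB|]. apply nrm_mul_le; [now apply nrm_mul_le|].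
    apply nrm_sub_le; [now apply nrm_mul_le|]. rewrite nrm_fC, Rabs_R1; lra. }
  assert (Hb := base_bound N q ltac:(lia)). fold x in Hb.
  assert (Hxp : 0 < x) by lra.
  assert (HKB := wzB_const_pos).
  eapply Rle_trans; [exact HF|].
  assert (Hg : 0 <= nrm n (base c N q)) by apply nrm_pos.
  assert (HL7 : (2 * L) * (wzB_const * L ^ 4 * (2 * L * (2 * L + 1))) <= 2048 * wzB_const * x ^ 7).
  { assert (2 * L + 1 <= 4 * L) by lra.
    assert (0 <= L ^ 4) by (apply pow_le; lra).
    replace (2048 * wzB_const * x ^ 7) with ((2 * L) * (wzB_const * L ^ 4 * (2 * L * (4 * L)))) by (unfold L; ring).
    apply Rmult_le_compat_l; [lra|]. apply Rmult_le_compat_l; [apply Rmult_le_pos; lra|]. nra. }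
  rewrite Rmult_assoc.
  eapply Rle_trans; [apply Rmult_le_compat_l; [exact Hg|exact HL7]|].
  replace (nrm n (base c N q) * (2048 * wzB_const * x ^ 7)) with (2048 * wzB_const * / x * (nrm n (base c N q) * x ^ 8)) by (field; lra).
  apply Rmult_le_compat_l; [|exact Hb].
  apply Rmult_le_pos; [lra|]. left; now apply Rinv_0_lt_compat.
Qed.

Lemma column_bound N : nrm n (fsum (flowM c N) N) <= 4096 * wzB_const * / INR (S N).
Proof.
  set (A := 2048 * wzB_const * / INR (S N)).
  assert (HA : 0 <= A).
  { unfold A. pose proof wzB_const_pos. apply Rmult_le_pos; [lra|]. left; apply Rinv_0_lt_compat, lt_0_INR; lia. }
  assert (H : forall Q, (Q <= N)%nat -> nrm n (fsum (flowM c N) Q) <= A * (2 - 2 * (/ 2) ^ Q)).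
  { induction Q as [|Q IH]; intros HQ; cbn [fsum].
    - rewrite nrm_fC, Rabs_R0. simpl. nra.
    - eapply Rle_trans; [apply nrm_add_le; [apply IH; lia|apply flowM_bound; lia]|].
      fold A. right. simpl. field. }
  eapply Rle_trans; [apply H, le_n|].
  assert (0 <= (/ 2) ^ N) by (apply pow_le; lra).
  replace (4096 * wzB_const * / INR (S N)) with (A * 2) by (unfold A; ring). nra.
Qed.

Lemma column_vanishes k : (k <= n)%nat -> is_lim_seq (fun N => fsum (flowM c N) N k) 0.
Proof.
  intros Hk. set (K := (/ rho) ^ k * (4096 * wzB_const)).
  apply is_lim_seq_abs_0.
  apply is_lim_seq_le_le with (fun _ => 0) (fun N => K * / INR (S N)).
  - intros N. split; [apply Rabs_pos|].
    eapply Rle_trans; [apply (nrm_coef n _ k Hk)|].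
    unfold K. rewrite Rmult_assoc. apply Rmult_le_compat_l.
    + apply pow_le. left. apply Rinv_0_lt_compat, rho_pos.
    + apply column_bound.
  - apply is_lim_seq_const.
  - replace (Finite 0) with (Rbar_mult K 0) by (simpl; f_equal; ring).
    apply is_lim_seq_scal_l.
    replace (Finite 0) with (Rbar_inv p_infty) by reflexivity.
    apply is_lim_seq_inv; [|discriminate].
    apply -> is_lim_seq_incr_1. apply is_lim_seq_INR.
Qed.

Lemma fsum_coef f N k : fsum f (S N) k = sum_n (fun i => f i k) N.
Proof.
  induction N as [|N IH].
  - rewrite sum_O. simpl. unfold fadd. destruct k; simpl; ring.
  - rewrite sum_Sn, <- IH. reflexivity.
Qed.

Definition diag_term (i : nat) : fps := (flowP c i i + flowM c (S i) i)%F.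

Lemma diagonal_limit (l : fps) : (forall k, (k <= n)%nat -> is_lim_seq (fun N => fsum (fun p => flowP c p 0) N k) (l k)) ->
  forall k, (k <= n)%nat -> is_lim_seq (fun N => fsum diag_term N k) (l k).
Proof.
  intros H k Hk.
  apply is_lim_seq_ext with (fun N => fsum (fun p => flowP c p 0) N k + fsum (flowM c N) N k).
  - intros N. symmetry. exact (f_equal (fun f : fps => f k) (diagonal_path c HWZ N)).
  - replace (Finite (l k)) with (Finite (l k + 0)) by (f_equal; ring).
    apply is_lim_seq_plus'; [now apply H|now apply column_vanishes].
Qed.
End Col.

(** * From the diagonal to the bottom row *)

Lemma tel_case2 : tel_identity case2.
Proof. intros k; unfold wzB, qprod, lin; simpl fold_right; simpl sg; simpl pt. ring. Qed.
Lemma tel_case4 : tel_identity case4.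
Proof. intros k; unfold wzB, qprod, lin; simpl fold_right; simpl sg; simpl pt. ring. Qed.

Lemma qprod_app l l' z : qprod (l ++ l') z = (qprod l z * qprod l' z)%F.
Proof.
  induction l as [|c l IH]; [change (qprod [] z) with (fC 1); cbn [app]; ring|].
  change (qprod ((c :: l) ++ l') z) with (lin z c * qprod (l ++ l') z)%F.
  change (qprod (c :: l) z) with (lin z c * qprod l z)%F. rewrite IH; ring.
Qed.
Lemma pfac_app l l' N : pfac (l ++ l') N = (pfac l N * pfac l' N)%F.
Proof. induction N as [|n IH]; cbn [pfac]; [ring|]. rewrite IH, qprod_app; ring. Qed.
Lemma inv_unique (a b c : fps) : (a * b)%F = fC 1 -> (a * c)%F = fC 1 -> b = c.
Proof.
  intros H1 H2. transitivity (b * (a * c))%F; [rewrite H2; ring|].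
  transitivity ((a * b) * c)%F; [ring|rewrite H1; ring].
Qed.
Lemma pfac_inv_app l l' N : pfac_inv (l ++ l') N = (pfac_inv l N * pfac_inv l' N)%F.
Proof.
  apply (inv_unique (pfac (l ++ l') N)); [apply pfac_pfac_inv|].
  rewrite pfac_app. transitivity ((pfac l N * pfac_inv l N) * (pfac l' N * pfac_inv l' N))%F; [ring|].
  rewrite !pfac_pfac_inv. ring.
Qed.

Lemma fsum_scal (a : fps) f N : fsum (fun i => (a * f i)%F) N = (a * fsum f N)%F.
Proof. induction N as [|n IH]; cbn [fsum]; [ring|rewrite IH; ring]. Qed.
Lemma fsum_ext f g N : (forall i, f i = g i) -> fsum f N = fsum g N.
Proof. intros H; induction N as [|n IH]; cbn [fsum]; [ring|now rewrite IH, H]. Qed.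

(** Only the coefficients up to 7 converge: the estimates on the grid are
    those of the norm of order 7. *)
Definition flim7 (u : nat -> fps) (l : fps) := forall k, (k <= 7)%nat -> is_lim_seq (fun N => u N k) (l k).
Lemma flim7_mul (a : fps) u l : flim7 u l -> flim7 (fun N => (a * u N)%F) (a * l)%F.
Proof.
  intros H k Hk. apply (flim_mulc k (fun _ => a) u a l).
  - intros; apply is_lim_seq_const.
  - intros i Hi. apply H; lia.
Qed.

Section Row.
Variable c : case.

(** Summand of the bottom row without the unit [grid_unit], which does not
    depend on p. *)
Definition row_term (p : nat) : fps :=
  (pfac (shift2 (mus c)) p * pfac_inv (shift2 (nus c)) (S p) * wzB c (kvar p) (fC 0))%F.
Definition grid_unit : fps := (fC (/ 2) * qinv [4%Z] 2 * qinv (shift2 (nus c)) 1)%F.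

(** Along the row the factors with weight 4 telescope. *)
Lemma row_base p : (base c p 0 * (fC 2 * kvar p) =
  lin (fC 2) 4 * qprod (shift2 (nus c)) (fC 1) * (pfac (shift2 (mus c)) p * pfac_inv (shift2 (nus c)) (S p)))%F.
Proof.
  induction p as [|p IH].
  - unfold base; cbn [baseA baseB baseC Nat.add pfac pfac_inv]. change (kvar 0) with (svar 0). rewrite <- lin_even.
    change (INR 1) with 1. rewrite Rmult_1_r.
    transitivity (lin (fC 2) 4 * (qprod (shift2 (nus c)) (fC 1) * qinv (shift2 (nus c)) 1))%F; [|ring].
    rewrite qprod_qinv by lra. ring.
  - rewrite base_row_step, lin_even. change (svar p) with (kvar p).
    set (Qi := qinv (shift2 (nus c)) (INR (S p) + 1)).
    transitivity ((base c p 0 * (fC 2 * kvar p)) * qprod (shift2 (mus c)) (fC (INR (S p))) * Qi *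
       (fC 2 * kvar (S p) * qinv [4%Z] (2 * INR (S p) + 2)))%F; [ring|].
    replace (2 * INR (S p) + 2) with (2 * INR (S (S p))) by (rewrite (S_INR (S p)); ring).
    rewrite kvar_inv, IH. unfold Qi. rewrite <- S_INR. cbn [pfac pfac_inv]. ring.
Qed.

Lemma grid_unit_row p : (grid_unit * flowP c p 0)%F = row_term p.
Proof.
  unfold flowP. rewrite Nat.add_0_r. change (svar p) with (kvar p).
  replace (mvar 0 - fC 1)%F with (fC 0) by (unfold mvar; change (INR 1) with 1; ring).
  change (mvar 0) with (fC 1).
  rewrite row_base. unfold grid_unit, row_term.
  transitivity ((qprod [4%Z] (fC 2) * qinv [4%Z] 2) * (qprod (shift2 (nus c)) (fC 1) * qinv (shift2 (nus c)) 1) *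
     (pfac (shift2 (mus c)) p * pfac_inv (shift2 (nus c)) (S p) * wzB c (kvar p) (fC 0)) * (fC 2 * fC (/ 2)))%F.
  - rewrite qprod4. ring.
  - rewrite fC_inv by lra. rewrite !qprod_qinv by lra. ring.
Qed.

(** Numerator of the sum of the two edges at a diagonal vertex. *)
Definition diag_poly (k m : fps) : fps :=
  (qprod (nus c) (k + m) * (wzB c k (m - fC 1) * (fC 2 * m * (fC 2 * m - fC 1)))
   + fC 2 * (fC 2 * (k + m) - fC 1) * (k + m) * qprod (mus c) k * wzB c m k)%F.

Lemma baseA_prod n : baseA c n = (pfac (shift2 (mus c)) n * pfac [4%Z] 2 * pfac_inv [4%Z] (2 * n + 2))%F.
Proof.
  induction n as [|n IH].
  - cbn [baseA]. change (2 * 0 + 2)%nat with 2%nat.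
    transitivity (pfac (shift2 (mus c)) 0 * (pfac [4%Z] 2 * pfac_inv [4%Z] 2))%F; [rewrite pfac_pfac_inv; cbn [pfac]|]; ring.
  - cbn [baseA]. rewrite IH. replace (2 * S n + 2)%nat with (S (S (2 * n + 2))) by lia.
    cbn [pfac_inv pfac]. replace (INR (S (S (2 * n + 2)))) with (2 * INR (S n) + 2)
      by (rewrite !S_INR, plus_INR, mult_INR; simpl; ring).
    replace (INR (S (2 * n + 2))) with (2 * INR (S n) + 1)
      by (rewrite !S_INR, plus_INR, mult_INR; simpl; ring).
    ring.
Qed.

Lemma Pq0_fact N : pfac [0%Z] N = fC (INR (fact N)).
Proof.
  induction N as [|N IH]; [reflexivity|]. cbn [pfac]. rewrite IH, fact_simpl, mult_INR, fC_mul.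
  unfold qprod, lin; cbn [fold_right]. ring.
Qed.
Lemma Pinv0_fact N : pfac_inv [0%Z] N = fC (/ INR (fact N)).
Proof.
  apply (inv_unique (pfac [0%Z] N)); [apply pfac_pfac_inv|]. rewrite Pq0_fact. apply fC_inv, INR_fact_neq_0.
Qed.
Lemma baseB_prod n : baseB c n = (pfac (mus c) n * fC 2 * pfac_inv [0%Z] (2 * n + 2))%F.
Proof.
  induction n as [|n IH].
  - cbn [baseB pfac]. rewrite Pinv0_fact.
    transitivity (fC 2 * fC (/ 2))%F; [now rewrite fC_inv by lra|].
    change (INR (fact (2 * 0 + 2))) with 2. ring.
  - cbn [baseB]. rewrite IH, !Pinv0_fact. replace (2 * S n + 2)%nat with (S (S (2 * n + 2))) by lia.
    rewrite !fact_simpl, !mult_INR.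
    replace (INR (S (S (2 * n + 2)))) with (2 * INR (S n) + 2)
      by (rewrite !S_INR, plus_INR, mult_INR; simpl; ring).
    replace (INR (S (2 * n + 2))) with (2 * INR (S n) + 1)
      by (rewrite !S_INR, plus_INR, mult_INR; simpl; ring).
    assert (0 < INR (S n)) by (apply lt_0_INR; lia). pose proof (INR_fact_neq_0 (2 * n + 2)).
    set (x := INR (S n)) in *. set (F := INR (fact (2 * n + 2))) in *.
    replace (/ ((2 * x + 2) * ((2 * x + 1) * F))) with (/ F * / ((2 * x + 1) * (2 * x + 2))) by (field; repeat split; lra).
    rewrite (fC_mul (/ F)). cbn [pfac]. unfold x. ring.
Qed.

Lemma baseC_prod t : baseC c t = (pfac [4%Z] (2 * t + 1) * pfac_inv (shift2 (nus c)) (S t)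
    * (qprod (shift2 (nus c)) (fC 1) * qinv [4%Z] 1))%F.
Proof.
  induction t as [|t IH].
  - cbn [baseC]. change (2 * 0 + 1)%nat with 1%nat. cbn [pfac pfac_inv]. change (INR 1) with 1.
    transitivity ((qprod [4%Z] (fC 1) * qinv [4%Z] 1) * (qprod (shift2 (nus c)) (fC 1) * qinv (shift2 (nus c)) 1))%F;
      [rewrite !qprod_qinv by lra|]; ring.
  - cbn [baseC]. rewrite IH. replace (2 * S t + 1)%nat with (S (S (2 * t + 1))) by lia.
    cbn [pfac pfac_inv]. rewrite !qprod4.
    replace (INR (S (S (2 * t + 1)))) with (2 * INR (S t) + 1)
      by (rewrite !S_INR, plus_INR, mult_INR; simpl; ring).
    replace (INR (S (2 * t + 1))) with (2 * INR (S t))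
      by (rewrite !S_INR, plus_INR, mult_INR; simpl; ring).
    rewrite (S_INR (S t)). ring.
Qed.

(** The second edge starts at (n + 1, n); its gamma factor is that of (n, n)
    times a rational function.  Products up to 2n + 2 arise because [baseA]
    and [baseB] contain the factors 2i + 1 and 2i + 2 of the denominators. *)
Lemma diag_term_prod n : (grid_unit * diag_term c n)%F =
  (pfac [4%Z] (4 * n + 1) * pfac (shift2 (mus c) ++ mus c) n * pfac_inv (shift2 (nus c) ++ [4%Z; 0%Z]) (2 * n + 2)
    * (fC 2 * svar (2 * n)) * diag_poly (kvar n) (mvar n))%F.
Proof.
  assert (Es : svar (2 * n) = (kvar n + mvar n - fC 1)%F) by (rewrite <- svar_add; f_equal; lia).
  assert (Es1 : svar (S (2 * n)) = (kvar n + mvar n)%F) by (rewrite <- svar_S; do 2 f_equal; lia).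
  set (u := qinv (shift2 (nus c)) (INR (S (2 * n)) + 1)).
  assert (Hqx : (qprod (nus c) (kvar n + mvar n) * u)%F = fC 1).
  { unfold u. replace (2 * n)%nat with (n + n)%nat by lia. apply qprod_svar. }
  assert (E : diag_term c n = (base c n n * u * (fC 2 * svar (2 * n)) * diag_poly (kvar n) (mvar n))%F).
  { unfold diag_term, flowP, flowM. replace (n + n)%nat with (2 * n)%nat by lia.
    replace (S n + n)%nat with (S (2 * n)) by lia. rewrite Es1, kvar_S, Es.
    unfold base. replace (S n + n)%nat with (S (2 * n)) by lia. cbn [baseA baseC]. fold u.
    replace (n + n)%nat with (2 * n)%nat by lia.
    replace (qprod (shift2 (mus c)) (fC (INR (S n)))) with (qprod (mus c) (kvar n)) by apply qprod_shift.
    rewrite lin_even, lin_odd, Es.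
    assert (I1 := kvar_inv1 n). assert (I2 := kvar_inv2 n).
    set (i1 := qinv [4%Z] (2 * INR (S n) + 1)) in *. set (i2 := qinv [4%Z] (2 * INR (S n) + 2)) in *.
    unfold diag_poly. set (k := kvar n) in *. set (m := mvar n) in *.
    replace (k + fC 1 - fC 1)%F with k by ring.
    set (b := (baseA c n * baseB c n * baseC c (2 * n))%F).
    set (B1 := wzB c k (m - fC 1)%F). set (B2 := wzB c m k). set (Q := qprod (nus c) (k + m)%F) in *.
    set (q := qprod (mus c) k).
    transitivity (b * (fC 2 * (k + m - fC 1)) * (B1 * (fC 2 * m * (fC 2 * m - fC 1)))
      + b * q * (fC 2 * (k + m - fC 1)) * (fC 2 * (k + m) - fC 1) * u * (fC 2 * (k + m)) * B2
       * (((fC 2 * k + fC 1) * i1) * ((fC 2 * k + fC 2) * i2)))%F; [unfold b; ring|].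
    rewrite I1, I2.
    transitivity (b * (fC 2 * (k + m - fC 1)) * (B1 * (fC 2 * m * (fC 2 * m - fC 1))) * (Q * u)
      + b * q * (fC 2 * (k + m - fC 1)) * (fC 2 * (k + m) - fC 1) * u * (fC 2 * (k + m)) * B2)%F;
      [rewrite Hqx|]; ring. }
  rewrite E. unfold base. replace (n + n)%nat with (2 * n)%nat by lia.
  rewrite baseA_prod, baseB_prod, baseC_prod. unfold grid_unit.
  rewrite pfac_app, pfac_inv_app. change [4%Z; 0%Z] with ([4%Z] ++ [0%Z]). rewrite pfac_inv_app.
  replace (2 * (2 * n) + 1)%nat with (4 * n + 1)%nat by lia.
  assert (Ei : pfac_inv (shift2 (nus c)) (2 * n + 2) = (pfac_inv (shift2 (nus c)) (S (2 * n)) * u)%F).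
  { replace (2 * n + 2)%nat with (S (S (2 * n))) by lia. cbn [pfac_inv]. unfold u. now rewrite <- (S_INR (S (2 * n))). }
  rewrite Ei.
  set (p1 := pfac_inv (shift2 (nus c)) (S (2 * n))). set (p2 := pfac_inv [4%Z] (2 * n + 2)). set (p3 := pfac_inv [0%Z] (2 * n + 2)).
  set (p4 := pfac [4%Z] (4 * n + 1)). set (p5 := pfac (mus c) n). set (p6 := pfac (shift2 (mus c)) n).
  set (G := diag_poly (kvar n) (mvar n)). set (s := svar (2 * n)). cbn [pfac]. change (INR 1) with 1. change (INR 2) with 2.
  transitivity ((fC 2 * fC (/ 2)) * (qprod [4%Z] (fC 2) * qinv [4%Z] 2) * (qprod [4%Z] (fC 1) * qinv [4%Z] 1)
     * (qprod (shift2 (nus c)) (fC 1) * qinv (shift2 (nus c)) 1) * (p4 * (p6 * p5) * (p1 * u * (p2 * p3)) * (fC 2 * s) * G))%F; [ring|].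
  rewrite fC_inv by lra. rewrite !qprod_qinv by lra. ring.
Qed.

Hypothesis HWZ : wz_identity c.
Hypothesis Hcs : bounded_by 3 (mus c).
Hypothesis Hds : bounded_by 2 (nus c).
Hypothesis Lcs : length (mus c) = 8%nat.
Hypothesis Lds : length (nus c) = 8%nat.

Lemma grid_unit_inv : exists K : fps, (grid_unit * K)%F = fC 1.
Proof.
  exists (fC 2 * qprod [4%Z] (fC 2) * qprod (shift2 (nus c)) (fC 1))%F. unfold grid_unit.
  transitivity ((fC 2 * fC (/ 2)) * (qprod [4%Z] (fC 2) * qinv [4%Z] 2) * (qprod (shift2 (nus c)) (fC 1) * qinv (shift2 (nus c)) 1))%F; [ring|].
  rewrite fC_inv by lra. rewrite !qprod_qinv by lra. ring.
Qed.

Lemma diag_eq_row (l : fps) : flim7 (fsum row_term) l -> flim7 (fsum (fun i => (grid_unit * diag_term c i)%F)) l.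
Proof.
  intros H. destruct grid_unit_inv as [K HK].
  assert (H1 : flim7 (fsum (fun p => flowP c p 0)) (K * l)%F).
  { intros k Hk. apply is_lim_seq_ext with (fun N => (K * fsum row_term N)%F k).
    - intros N. apply (f_equal (fun f : fps => f k)). rewrite (fsum_ext row_term (fun p => (grid_unit * flowP c p 0)%F)) by (intros; symmetry; apply grid_unit_row).
      rewrite fsum_scal. transitivity ((grid_unit * K) * fsum (fun p => flowP c p 0) N)%F; [ring|rewrite HK; ring].
    - now apply (flim7_mul K (fsum row_term) l). }
  assert (H2 : flim7 (fsum (diag_term c)) (K * l)%F).
  { intros k Hk. exact (diagonal_limit c HWZ Hcs Hds Lcs Lds (K * l)%F H1 k Hk). }
  intros k Hk. apply is_lim_seq_ext with (fun N => (grid_unit * fsum (diag_term c) N)%F k).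
  - intros N. now rewrite fsum_scal.
  - replace (l k) with ((grid_unit * (K * l))%F k); [now apply (flim7_mul grid_unit)|].
    apply (f_equal (fun f : fps => f k)). transitivity ((grid_unit * K) * l)%F; [ring|rewrite HK; ring].
Qed.
End Row.

(** * Evaluation of the row sums *)

Lemma fXpow_low (a : fps) n k : (k < n)%nat -> (fX ^ n * a)%F k = 0.
Proof.
  revert k; induction n as [|n IH]; intros k Hk; [lia|]. cbn [fpow].
  replace (fX * fX ^ n * a)%F with (fX * (fX ^ n * a))%F by ring.
  destruct k as [|k]; [apply fX_mul_0|]. rewrite fX_mul_S. apply IH; lia.
Qed.
Lemma fXpow_high (a : fps) n k : (fX ^ n * a)%F (n + k)%nat = a k.
Proof.
  induction n as [|n IH]; [cbn [fpow Nat.add]; now replace (fC 1 * a)%F with a by ring|].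
  cbn [fpow Nat.add].
  replace (fX * fX ^ n * a)%F with (fX * (fX ^ n * a))%F by ring.
  now rewrite fX_mul_S.
Qed.

(** The substitution of x X for X.  It expresses homogeneity in (z, X): a
    product of n factors z + c X is z^n times its value at z = 1 with X / z
    for X. *)
Definition fscale (x : R) (a : fps) : fps := fun n => x ^ n * a n.
Lemma fscale_mulc x n : forall a b : fps, x ^ n * fmulc n a b = fmulc n (fscale x a) (fscale x b).
Proof.
  induction n as [|n IH]; intros a b; [unfold fscale; simpl; ring|].
  cbn [fmulc]. change (shift (fscale x a)) with (fun k => x ^ S k * shift a k).
  replace (fun k => x ^ S k * shift a k) with (fun k => x * fscale x (shift a) k)
    by (apply functional_extensionality; intros k; unfold fscale; simpl; ring).
  rewrite fmulc_scal, <- IH. unfold fscale. simpl; ring.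
Qed.
Lemma fscale_mul x (a b : fps) : fscale x (a * b)%F = (fscale x a * fscale x b)%F.
Proof. apply fps_ext; intros n; apply fscale_mulc. Qed.
Lemma fscale_add x (a b : fps) : fscale x (a + b)%F = (fscale x a + fscale x b)%F.
Proof. apply fps_ext; intros n; unfold fscale, fadd; ring. Qed.
Lemma fscale_sub x (a b : fps) : fscale x (a - b)%F = (fscale x a - fscale x b)%F.
Proof. apply fps_ext; intros n; unfold fscale, fsub, fadd, fopp; ring. Qed.
Lemma fscale_C x c : fscale x (fC c) = fC c.
Proof. apply fps_ext; intros [|n]; unfold fscale; simpl; ring. Qed.
Lemma fscale_X x : fscale x fX = (fC x * fX)%F.
Proof. apply fps_ext; intros n; rewrite fC_mul_n; unfold fscale; destruct n as [|[|n]]; simpl; ring. Qed.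
Lemma fscale_pow x (a : fps) n : fscale x (a ^ n)%F = (fscale x a ^ n)%F.
Proof. induction n as [|n IH]; cbn [fpow]; [apply fscale_C|]. now rewrite fscale_mul, IH. Qed.
Lemma fC_pow z n : (fC z ^ n)%F = fC (z ^ n).
Proof. induction n as [|n IH]; cbn [fpow pow]; [reflexivity|]. now rewrite IH, fC_mul. Qed.

Lemma qprod_scale l z : z <> 0 -> qprod l (fC z) = (fC (z ^ length l) * fscale (/ z) (qprod l (fC 1)))%F.
Proof.
  intros Hz; induction l as [|c l IH].
  - change (qprod [] (fC z)) with (fC 1). change (qprod [] (fC 1)) with (fC 1). rewrite fscale_C. simpl length. simpl pow. ring.
  - change (qprod (c :: l) (fC z)) with (lin (fC z) c * qprod l (fC z))%F.
    change (qprod (c :: l) (fC 1)) with (lin (fC 1) c * qprod l (fC 1))%F.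
    rewrite IH, fscale_mul. cbn [length pow]. rewrite (fC_mul z (z ^ length l)).
    unfold lin. rewrite fscale_add, fscale_mul, !fscale_C, fscale_X.
    transitivity ((fC z * fC 1 + fC (IZR c) * (fC z * fC (/ z)) * fX) * (fC (z ^ length l) * fscale (/ z) (qprod l (fC 1))))%F;
      [rewrite fC_inv by assumption|]; ring.
Qed.
Lemma qinv_scale l z : z <> 0 -> qinv l z = (fC (/ z ^ length l) * fscale (/ z) (qinv l 1))%F.
Proof.
  intros Hz. apply (inv_unique (qprod l (fC z))); [now apply qprod_qinv|].
  rewrite qprod_scale by assumption.
  transitivity ((fC (z ^ length l) * fC (/ z ^ length l)) * fscale (/ z) (qprod l (fC 1) * qinv l 1))%F;
    [rewrite fscale_mul; ring|].
  rewrite qprod_qinv by lra. rewrite fC_inv by (now apply pow_nonzero). rewrite fscale_C; ring.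
Qed.
Lemma wzB_scale c z : z <> 0 -> wzB c (fC z + fC 2 * fX)%F (fC 0) =
  (fC (z ^ 4) * fscale (/ z) (wzB c (fC 1 + fC 2 * fX)%F (fC 0)))%F.
Proof.
  intros Hz. unfold wzB.
  repeat first [rewrite fscale_add | rewrite fscale_sub | rewrite fscale_mul | rewrite fscale_pow | rewrite fscale_C | rewrite fscale_X].
  rewrite <- fC_pow. set (i := fC (/ z)). set (y := fC z).
  assert (E : (y * i)%F = fC 1) by (now apply fC_inv).
  transitivity (let X := ((y * i) * fX)%F in let k := (y + fC 2 * X)%F in
   (k * (fC 6 * k^3 + fC 9 * k^2 * fC 0 + fC 5 * k * fC 0^2 + fC 0^3)
   - fC (IZR (sg c)) * X^2 * k * (fC 2 * k + fC 0) + fC (IZR (pt c)) * X^4)%F); cbv zeta; [rewrite E|]; ring.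
Qed.

Definition row_series (c : case) : fps := (qinv (shift2 (nus c)) 1 * wzB c (fC 1 + fC 2 * fX)%F (fC 0))%F.

(** If the two products cancel, the row summand is homogeneous of degree -4 in
    (z, X), so its coefficient of X^r is a constant over z^(4 + r). *)
Lemma row_term_coef c p r : mus c = nus c \/ shift2 (mus c) = shift2 (nus c) -> length (nus c) = 8%nat ->
  row_term c p r = row_series c r * / INR (S p) ^ (4 + r).
Proof.
  intros E L. assert (E' : shift2 (mus c) = shift2 (nus c)) by (destruct E as [->|E]; auto).
  unfold row_term. rewrite E'. cbn [pfac_inv].
  transitivity (((pfac (shift2 (nus c)) p * pfac_inv (shift2 (nus c)) p) * (qinv (shift2 (nus c)) (INR (S p)) * wzB c (kvar p) (fC 0)))%F r).
  { apply (f_equal (fun f : fps => f r)). ring. }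
  rewrite pfac_pfac_inv. unfold kvar. set (z := INR (S p)). assert (Hz : z <> 0) by apply INR_S_neq.
  rewrite wzB_scale, qinv_scale by assumption. rewrite len_shift2, L.
  transitivity ((fC (/ z ^ 8 * z ^ 4) * fscale (/ z) (row_series c))%F r).
  { apply (f_equal (fun f : fps => f r)). unfold row_series. rewrite fscale_mul, fC_mul. ring. }
  rewrite fC_mul_n. unfold fscale. rewrite pow_inv, pow_add. field.
  split; [now apply pow_nonzero|assumption].
Qed.

Lemma row_limit_const c (d : fps) : mus c = nus c -> length (nus c) = 8%nat ->
  (forall r, (r <= 7)%nat -> row_series c r = d r) ->
  flim7 (fsum (row_term c)) (fun r => d r * zetak (4 + r)).
Proof.
  intros E L Hd r Hr. apply is_lim_seq_incr_1.
  apply is_lim_seq_ext with (fun N => d r * sum_n (fun n => / INR (S n) ^ (4 + r)) N).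
  - intros N. rewrite fsum_coef, <- (sum_n_mult_l (d r)). apply sum_n_ext; intros n.
    rewrite (row_term_coef c n r) by auto. now rewrite Hd.
  - apply (is_lim_seq_scal_l _ (d r) (zetak (4 + r))). apply zetak_is_series; lia.
Qed.

Fixpoint fpoly (l : list Z) : fps :=
  match l with nil => fC 0 | x :: l => (fC (IZR x) + fX * fpoly l)%F end.
Lemma fpoly_coef l r : fpoly l r = IZR (nth r l 0%Z).
Proof.
  revert r; induction l as [|x l IH]; intros [|r]; cbn [fpoly nth]; try reflexivity.
  - unfold fadd. rewrite fX_mul_0. simpl; ring.
  - unfold fadd. rewrite fX_mul_S, IH. simpl; ring.
Qed.

(** The division is certified by the quotient D and the remainder X^8 E. *)
Lemma row_series_coef c (D E : fps) :
  (wzB c (fC 1 + fC 2 * fX)%F (fC 0) + fX ^ 8 * E = D * qprod (shift2 (nus c)) (fC 1))%F ->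
  forall r, (r <= 7)%nat -> row_series c r = D r.
Proof.
  intros H r Hr. unfold row_series.
  assert (H' : (qinv (shift2 (nus c)) 1 * wzB c (fC 1 + fC 2 * fX)%F (fC 0))%F = (D - fX ^ 8 * (E * qinv (shift2 (nus c)) 1))%F).
  { transitivity (qinv (shift2 (nus c)) 1 * (wzB c (fC 1 + fC 2 * fX)%F (fC 0) + fX ^ 8 * E) - fX ^ 8 * (E * qinv (shift2 (nus c)) 1))%F; [ring|].
    rewrite H. transitivity (D * (qprod (shift2 (nus c)) (fC 1) * qinv (shift2 (nus c)) 1) - fX ^ 8 * (E * qinv (shift2 (nus c)) 1))%F; [ring|].
    rewrite qprod_qinv by lra. ring. }
  rewrite H'. unfold fsub, fadd, fopp. rewrite fXpow_low by lia. ring.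
Qed.

Definition row_coef1 : list Z := [6; -48; 240; -960; 3360; -10752; 32256; -92160]%Z.
Definition row_coef3 : list Z := [6; -48; 280; -1440; 6944; -32256; 146304; -652800]%Z.

Lemma row_limit1 : flim7 (fsum (row_term case1)) (fun r => IZR (nth r row_coef1 0%Z) * zetak (4 + r)).
Proof.
  apply (row_limit_const case1 (fun r => IZR (nth r row_coef1 0%Z))); [reflexivity|reflexivity|].
  intros r Hr. rewrite <- fpoly_coef. revert r Hr.
  apply row_series_coef with (E := fpoly [-253440; -3379200; -19329024; -61489152; -117497856; -134873088; -86114304; -23592960]%Z).
  unfold wzB, qprod, lin, row_coef1; cbn [fpoly fold_right sg pt case1 nus shift2 map Z.add]. ring.
Qed.
Lemma row_limit3 : flim7 (fsum (row_term case3)) (fun r => IZR (nth r row_coef3 0%Z) * zetak (4 + r)).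
Proof.
  apply (row_limit_const case3 (fun r => IZR (nth r row_coef3 0%Z))); [reflexivity|reflexivity|].
  intros r Hr. rewrite <- fpoly_coef. revert r Hr.
  apply row_series_coef with (E := fpoly [-2877952; -33476608; -152676352; -342859776; -380338176; -167116800]%Z).
  unfold wzB, qprod, lin, row_coef3; simpl. ring.
Qed.

Lemma row_telescope c N : tel_identity c ->
  (fC (IZR (pt c)) * fX ^ 4 * fsum (row_term c) N = pfac (shift2 (mus c)) N * pfac_inv (shift2 (nus c)) N - fC 1)%F.
Proof.
  intros H; induction N as [|N IH]; cbn [fsum]; [cbn [pfac pfac_inv]; ring|].
  transitivity (fC (IZR (pt c)) * fX ^ 4 * fsum (row_term c) N + fC (IZR (pt c)) * fX ^ 4 * row_term c N)%F; [ring|].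
  rewrite IH. unfold row_term. cbn [pfac pfac_inv].
  set (Q := qinv (shift2 (nus c)) (INR (S N))).
  transitivity (pfac (shift2 (mus c)) N * pfac_inv (shift2 (nus c)) N - fC 1 +
    pfac (shift2 (mus c)) N * pfac_inv (shift2 (nus c)) N * Q * (fC (IZR (pt c)) * fX ^ 4 * wzB c (kvar N) (fC 0)))%F; [ring|].
  rewrite <- (H (kvar N)).
  replace (qprod (mus c) (kvar N)) with (qprod (shift2 (mus c)) (fC (INR (S N)))) by (symmetry; apply qprod_shift).
  replace (qprod (nus c) (kvar N)) with (qprod (shift2 (nus c)) (fC (INR (S N)))) by (symmetry; apply qprod_shift).
  assert (E : (qprod (shift2 (nus c)) (fC (INR (S N))) * Q)%F = fC 1) by apply qprod_qinv, INR_S_neq.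
  set (D := qprod (shift2 (nus c)) (fC (INR (S N)))) in *.
  transitivity (pfac (shift2 (mus c)) N * pfac_inv (shift2 (nus c)) N - fC 1 +
    pfac (shift2 (mus c)) N * pfac_inv (shift2 (nus c)) N * (Q * qprod (shift2 (mus c)) (fC (INR (S N))) - D * Q))%F; [ring|].
  rewrite E. ring.
Qed.

Lemma lam_part_0 w N : lam_part w N O = 0. Proof. reflexivity. Qed.
Lemma lam_part_sub w v N : lam_part (fun k => w k - v k) N = (lam_part w N + - lam_part v N)%F.
Proof. apply fps_ext; intros [|k]; unfold lam_part, fadd, fopp; ring. Qed.
Lemma lam_full_add w v : lam_full (fun k => w k + v k) = (lam_full w + lam_full v)%F.
Proof. apply fps_ext; intros [|[|k]]; unfold lam_full, fadd; ring. Qed.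
Lemma lam_full_ext w v : (forall k, w (S k) = v (S k)) -> lam_full w = lam_full v.
Proof. intros H; apply fps_ext; intros [|[|k]]; unfold lam_full; [reflexivity..|now rewrite H]. Qed.

Lemma pfac_texp l N : pfac l N = (fC (INR (fact N) ^ length l) * texp (lam_part (psum l) N))%F.
Proof. rewrite <- pfac_0. apply logder_texp; [reflexivity|apply pfac_logder]. Qed.
Lemma pfac_inv_texp l N : pfac_inv l N = (fC (/ INR (fact N) ^ length l) * texp (- lam_part (psum l) N))%F.
Proof. rewrite <- pfac_inv_0. apply logder_texp; [unfold fopp; rewrite lam_part_0; ring|apply pfac_inv_logder]. Qed.

Lemma pfac_pfac_inv_texp l l' N : length l = length l' ->
  (pfac l N * pfac_inv l' N)%F = texp (lam_part (fun k => psum l k - psum l' k) N).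
Proof.
  intros L. rewrite pfac_texp, pfac_inv_texp, L, lam_part_sub, texp_add by (unfold fopp; rewrite ?lam_part_0; ring).
  transitivity ((fC (INR (fact N) ^ length l') * fC (/ INR (fact N) ^ length l')) * (texp (lam_part (psum l) N) * texp (- lam_part (psum l') N)))%F; [ring|].
  rewrite fC_inv by (apply pow_nonzero, INR_fact_neq_0). ring.
Qed.

(** The k-th power sums of the weights of the gamma quotient, denominator
    minus numerator; the weight 4 comes from Gamma(4x - 1). *)
Definition gam_wts (num_wts den_wts : list Z) (k : nat) : R := psum den_wts k - psum num_wts k - 4 ^ k.
Definition num_wts c := shift2 (mus c) ++ mus c.
Definition den_wts c := shift2 (nus c) ++ [4; 0]%Z.

(** Taylor series at a = 0 of the gamma quotient without its rational part.
    It depends on the case, and only with this factor do the five members form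
    one family. *)
Definition gam_unit (c : case) : fps := texp (lam_full (gam_wts (num_wts c) (den_wts c))).
Definition sin_unit (c : case) : fps := texp (lam_full (fun k => - psum (mus c) k)).

Lemma psum_app l l' k : psum (l ++ l') k = psum l k + psum l' k.
Proof.
  induction l as [|x l IH]; [change (psum [] k) with 0; cbn [app]; ring|].
  change (psum ((x :: l) ++ l') k) with (IZR x ^ k + psum (l ++ l') k).
  change (psum (x :: l) k) with (IZR x ^ k + psum l k). rewrite IH; ring.
Qed.

Lemma gam_wts_case c k : gam_wts (num_wts c) (den_wts c) (S k) = - psum (mus c) (S k) + (psum (shift2 (nus c)) (S k) - psum (shift2 (mus c)) (S k)).
Proof. unfold gam_wts, num_wts, den_wts. rewrite !psum_app.
  replace (psum [4; 0]%Z (S k)) with (4 ^ S k) by (unfold psum; cbn [fold_right]; rewrite (pow_i (S k)) by lia; ring). ring. Qed.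

(** The limit of the telescoping product completes each gamma value to a
    product of sines by reflection; this is why only even zeta values occur in
    [sin_unit]. *)
Lemma gam_unit_sin_unit c : (gam_unit c * texp (lam_full (fun k => (psum (shift2 (mus c)) k - psum (shift2 (nus c)) k)%R)))%F = sin_unit c.
Proof.
  unfold gam_unit, sin_unit. rewrite <- texp_add by reflexivity. rewrite <- lam_full_add. f_equal.
  apply lam_full_ext; intros k. rewrite gam_wts_case. ring.
Qed.

(** The constant 1 of the telescoping sum does not contribute in degree at
    least 4, and division by X^4 shifts the coefficients by four. *)
Lemma row_limit_tel c : tel_identity c -> length (mus c) = length (nus c) ->
  psum (shift2 (mus c)) 1 = psum (shift2 (nus c)) 1 -> IZR (pt c) <> 0 ->
  flim7 (fsum (fun p => (gam_unit c * row_term c p)%F)) (fun r => / IZR (pt c) * (sin_unit c - gam_unit c)%F (4 + r)%nat).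
Proof.
  intros H L H1 Hp r Hr.
  apply is_lim_seq_ext with (fun N => / IZR (pt c) * (gam_unit c * (pfac (shift2 (mus c)) N * pfac_inv (shift2 (nus c)) N) - gam_unit c)%F (4 + r)%nat).
  - intros N.
    replace (gam_unit c * (pfac (shift2 (mus c)) N * pfac_inv (shift2 (nus c)) N) - gam_unit c)%F
      with (fC (IZR (pt c)) * (fX ^ 4 * fsum (fun p => (gam_unit c * row_term c p)%F) N))%F.
    + rewrite fC_mul_n, fXpow_high. field; assumption.
    + rewrite fsum_scal. transitivity (gam_unit c * (fC (IZR (pt c)) * fX ^ 4 * fsum (row_term c) N))%F; [ring|].
      rewrite row_telescope by assumption. ring.
  - apply (is_lim_seq_scal_l _ (/ IZR (pt c)) ((sin_unit c - gam_unit c)%F (4 + r)%nat)).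
    unfold fsub. unfold fadd.
    apply is_lim_seq_plus'; [|apply is_lim_seq_const].
    rewrite <- gam_unit_sin_unit. apply flim_mul; [intros k; apply is_lim_seq_const|].
    intros k. apply is_lim_seq_ext with (fun N => texp (lam_part (fun k => psum (shift2 (mus c)) k - psum (shift2 (nus c)) k) N) k).
    + intros N. rewrite pfac_pfac_inv_texp; [reflexivity|]. now rewrite !len_shift2.
    + apply flim_texp, lam_part_lim. lra.
Qed.

Definition diag_hat (c : case) (n : nat) : fps := (gam_unit c * (grid_unit c * diag_term c n))%F.

Lemma gam_unit_inv c : exists K : fps, (gam_unit c * K)%F = fC 1.
Proof. exists (texp (- lam_full (gam_wts (num_wts c) (den_wts c))))%F. apply texp_opp. reflexivity. Qed.

Record admissible (c : case) := Good { admissible_W : wz_identity c; admissible_mus : bounded_by 3 (mus c); admissible_nus : bounded_by 2 (nus c);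
   admissible_lcs : length (mus c) = 8%nat; admissible_lds : length (nus c) = 8%nat }.

Lemma diag_hat_limit c l : admissible c -> flim7 (fsum (fun p => (gam_unit c * row_term c p)%F)) l -> flim7 (fsum (diag_hat c)) l.
Proof.
  intros [W B1 B2 L1 L2] H. destruct (gam_unit_inv c) as [K HK].
  assert (H1 : flim7 (fsum (row_term c)) (K * l)%F).
  { intros k Hk. apply is_lim_seq_ext with (fun N => (K * fsum (fun p => (gam_unit c * row_term c p)%F) N)%F k).
    - intros N. apply (f_equal (fun f : fps => f k)). rewrite fsum_scal.
      transitivity ((gam_unit c * K) * fsum (row_term c) N)%F; [ring|rewrite HK; ring].
    - now apply (flim7_mul K). }
  apply (diag_eq_row c W B1 B2 L1 L2) in H1.
  intros k Hk. apply is_lim_seq_ext with (fun N => (gam_unit c * fsum (fun i => (grid_unit c * diag_term c i)%F) N)%F k).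
  - intros N. apply (f_equal (fun f : fps => f k)). unfold diag_hat. now rewrite (fsum_scal (gam_unit c)).
  - replace (l k) with ((gam_unit c * (K * l))%F k); [now apply (flim7_mul (gam_unit c))|].
    apply (f_equal (fun f : fps => f k)). transitivity ((gam_unit c * K) * l)%F; [ring|rewrite HK; ring].
Qed.

Ltac bounded_tac := repeat (apply List.Forall_cons; [apply Rabs_le; simpl; lra|]); apply List.Forall_nil.
Lemma admissible1 : admissible case1. Proof. constructor; [exact wz_case1|bounded_tac|bounded_tac|reflexivity|reflexivity]. Qed.
Lemma admissible2 : admissible case2. Proof. constructor; [exact wz_case2|bounded_tac|bounded_tac|reflexivity|reflexivity]. Qed.
Lemma admissible3 : admissible case3. Proof. constructor; [exact wz_case3|bounded_tac|bounded_tac|reflexivity|reflexivity]. Qed.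
Lemma admissible4 : admissible case4. Proof. constructor; [exact wz_case4|bounded_tac|bounded_tac|reflexivity|reflexivity]. Qed.

Lemma gam_unit_eq c : mus c = nus c -> gam_unit c = sin_unit c.
Proof.
  intros E. rewrite <- gam_unit_sin_unit. rewrite E.
  replace (lam_full (fun k => psum (shift2 (nus c)) k - psum (shift2 (nus c)) k)) with (fC 0); [rewrite texp_zero; ring|].
  apply fps_ext; intros [|[|k]]; unfold lam_full; simpl; ring.
Qed.

Definition row_series1 : fps := fun r => IZR (nth r row_coef1 0%Z) * zetak (4 + r).
Definition row_series3 : fps := fun r => IZR (nth r row_coef3 0%Z) * zetak (4 + r).

Lemma diagonal_sum1 : flim7 (fsum (diag_hat case1)) (sin_unit case1 * row_series1)%F.
Proof.
  apply diag_hat_limit; [apply admissible1|]. intros k Hk.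
  apply is_lim_seq_ext with (fun N => (gam_unit case1 * fsum (row_term case1) N)%F k).
  - intros N. now rewrite fsum_scal.
  - rewrite <- gam_unit_eq by reflexivity. now apply (flim7_mul _ _ row_series1 row_limit1).
Qed.
Lemma diagonal_sum3 : flim7 (fsum (diag_hat case3)) (sin_unit case3 * row_series3)%F.
Proof.
  apply diag_hat_limit; [apply admissible3|]. intros k Hk.
  apply is_lim_seq_ext with (fun N => (gam_unit case3 * fsum (row_term case3) N)%F k).
  - intros N. now rewrite fsum_scal.
  - rewrite <- gam_unit_eq by reflexivity. now apply (flim7_mul _ _ row_series3 row_limit3).
Qed.
Lemma diagonal_sum2 : flim7 (fsum (diag_hat case2)) (fun r => (sin_unit case2 - gam_unit case2)%F (4 + r)%nat).
Proof.
  apply diag_hat_limit; [apply admissible2|]. intros k Hk.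
  replace ((sin_unit case2 - gam_unit case2)%F (4 + k)%nat) with (/ IZR (pt case2) * (sin_unit case2 - gam_unit case2)%F (4 + k)%nat)
    by (simpl pt; field).
  apply (row_limit_tel case2 tel_case2); [reflexivity|unfold psum; simpl; ring|simpl; lra|exact Hk].
Qed.
Lemma diagonal_sum4 : flim7 (fsum (diag_hat case4)) (fun r => - / 3 * (sin_unit case4 - gam_unit case4)%F (4 + r)%nat).
Proof.
  apply diag_hat_limit; [apply admissible4|]. intros k Hk.
  replace (- / 3 * (sin_unit case4 - gam_unit case4)%F (4 + k)%nat) with (/ IZR (pt case4) * (sin_unit case4 - gam_unit case4)%F (4 + k)%nat)
    by (simpl pt; field).
  apply (row_limit_tel case4 tel_case4); [reflexivity|unfold psum; simpl; ring|simpl; lra|exact Hk].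
Qed.

(** * Polynomial dependence on the specialisation *)

(** Functions of the index j = 0, ..., 4 of the family that are given by a
    polynomial of degree at most d.  As an inductive predicate it passes to
    products by a plain induction. *)
Inductive degree_le : nat -> (nat -> R) -> Prop :=
| degree_le_const d c : degree_le d (fun _ => c)
| degree_le_var d u : degree_le d u -> degree_le (S d) (fun j => INR j * u j)
| degree_le_add d u v : degree_le d u -> degree_le d v -> degree_le d (fun j => u j + v j)
| degree_le_ext d u v : (forall j, (j <= 4)%nat -> u j = v j) -> degree_le d u -> degree_le d v.

Lemma degree_le_le d e u : (d <= e)%nat -> degree_le d u -> degree_le e u.
Proof.
  intros Hde H; revert e Hde; induction H as [d c|d u H IH|d u v H1 IH1 H2 IH2|d u v He H IH]; intros e Hde.
  - apply degree_le_const.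
  - destruct e as [|e]; [lia|]. apply degree_le_var, IH; lia.
  - apply degree_le_add; auto.
  - apply (degree_le_ext e u v He); auto.
Qed.
Lemma degree_le_scal d x u : degree_le d u -> degree_le d (fun j => x * u j).
Proof.
  induction 1 as [d c|d u H IH|d u v H1 IH1 H2 IH2|d u v He H IH].
  - apply degree_le_const.
  - apply (degree_le_ext _ (fun j => INR j * (x * u j))); [intros; ring|]. now apply degree_le_var.
  - apply (degree_le_ext _ (fun j => x * u j + x * v j)); [intros; ring|]. now apply degree_le_add.
  - apply (degree_le_ext _ (fun j => x * u j)); [intros j Hj; now rewrite He|assumption].
Qed.
Lemma degree_le_mul d e u v : degree_le d u -> degree_le e v -> degree_le (d + e) (fun j => u j * v j).
Proof.
  intros H Hv; induction H as [d c|d u H IH|d u w H1 IH1 H2 IH2|d u w He H IH].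
  - apply (degree_le_le e); [lia|]. now apply degree_le_scal.
  - apply (degree_le_ext _ (fun j => INR j * (u j * v j))); [intros; ring|]. now apply (degree_le_var (d + e)).
  - apply (degree_le_ext _ (fun j => u j * v j + w j * v j)); [intros; ring|]. now apply degree_le_add.
  - apply (degree_le_ext _ (fun j => u j * v j)); [intros j Hj; now rewrite He|assumption].
Qed.

Definition diff1 (u : nat -> R) := u 1%nat - u 0%nat.
Definition diff2 (u : nat -> R) := u 2%nat - 2 * u 1%nat + u 0%nat.
Definition diff3 (u : nat -> R) := u 3%nat - 3 * u 2%nat + 3 * u 1%nat - u 0%nat.
Definition diff4 (u : nat -> R) := u 4%nat - 4 * u 3%nat + 6 * u 2%nat - 4 * u 1%nat + u 0%nat.

Lemma degree_le_id d : (1 <= d)%nat -> degree_le d INR.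
Proof.
  intros Hd; apply (degree_le_le 1); [assumption|].
  apply (degree_le_ext 1 (fun j => INR j * 1)); [intros; ring|]. apply degree_le_var, degree_le_const.
Qed.

(** Interpolation at five points: the degree is read off from the vanishing of
    the forward differences. *)
Lemma degree_le_newton d u : ((d < 1)%nat -> diff1 u = 0) -> ((d < 2)%nat -> diff2 u = 0) -> ((d < 3)%nat -> diff3 u = 0) ->
  diff4 u = 0 -> degree_le d u.
Proof.
  intros H1 H2 H3 H4.
  assert (Hx : forall i v, ((d < i)%nat -> v = 0) -> forall w, degree_le i w -> degree_le d (fun j => v * w j)).
  { intros i v Hv w Hw. destruct (Nat.le_gt_cases i d) as [L|L].
    - apply degree_le_scal. now apply (degree_le_le i).
    - apply (degree_le_ext d (fun _ => 0)); [intros j _; rewrite Hv by assumption; ring|apply degree_le_const]. }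
  assert (P1 := degree_le_id 1 (le_n 1)).
  assert (P2 : degree_le 2 (fun j => INR j * (INR j - 1))) by (apply degree_le_var, degree_le_add; [exact P1|apply degree_le_const]).
  assert (P3 : degree_le 3 (fun j => INR j * (INR j * (INR j - 1) + -2 * (INR j - 1)))).
  { apply degree_le_var, degree_le_add; [exact P2|]. apply degree_le_scal, degree_le_add; [apply (degree_le_id 2); lia|apply degree_le_const]. }
  apply (degree_le_ext d (fun j => u O + (diff1 u * INR j + (diff2 u * (INR j * (INR j - 1)) + diff3 u * (INR j * (INR j * (INR j - 1) + -2 * (INR j - 1)))) * / 2
    + diff3 u * (INR j * (INR j * (INR j - 1) + -2 * (INR j - 1))) * - / 3))).
  - intros j Hj. unfold diff4 in H4. unfold diff1, diff2, diff3.
    destruct j as [|[|[|[|[|j]]]]]; [simpl; lra..|lia].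
  - apply degree_le_add; [apply degree_le_const|]. apply degree_le_add; [apply degree_le_add|].
    + now apply (Hx 1%nat).
    + apply (degree_le_ext d (fun j => / 2 * (diff2 u * (INR j * (INR j - 1)) + diff3 u * (INR j * (INR j * (INR j - 1) + -2 * (INR j - 1))))));
       [intros; ring|]. apply degree_le_scal, degree_le_add; [now apply (Hx 2%nat (diff2 u) H2)|now apply (Hx 3%nat (diff3 u) H3)].
    + apply (degree_le_ext d (fun j => - / 3 * (diff3 u * (INR j * (INR j * (INR j - 1) + -2 * (INR j - 1))))));
       [intros; ring|]. apply degree_le_scal. now apply (Hx 3%nat (diff3 u) H3).
Qed.
Lemma degree_le_diff4 d u : degree_le d u -> (d <= 3)%nat -> diff4 u = 0.
Proof.
  intros H Hd.
  enough (E : exists a : nat -> R, (forall i, (d < i)%nat -> a i = 0) /\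
    forall j, (j <= 4)%nat -> u j = a 0%nat + a 1%nat * INR j + a 2%nat * INR j ^ 2 + a 3%nat * INR j ^ 3).
  { destruct E as [a [_ E]]. unfold diff4. rewrite !E by lia. simpl. ring. }
  induction H as [d c|d u H IH|d u v H1 IH1 H2 IH2|d u v He H IH].
  - exists (fun i => match i with O => c | _ => 0 end). split; [intros [|i] Hi; [lia|reflexivity]|intros; ring].
  - destruct (IH ltac:(lia)) as [a [Ha E]].
    exists (fun i => match i with O => 0 | S i => a i end). split.
    + intros [|i] Hi; [lia|apply Ha; lia].
    + intros j Hj. rewrite E by assumption. rewrite (Ha 3%nat) by lia. ring.
  - destruct (IH1 Hd) as [a [Ha Ea]], (IH2 Hd) as [b [Hb Eb]].
    exists (fun i => a i + b i). split; [intros i Hi; rewrite Ha, Hb by assumption; ring|].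
    intros j Hj. rewrite Ea, Eb by assumption. ring.
  - destruct (IH Hd) as [a [Ha Ea]]. exists a. split; [assumption|]. intros j Hj. rewrite <- He by assumption. auto.
Qed.

Lemma degree_le_fmulc n : forall (a b : nat -> fps) (da db : nat -> nat) (D : nat),
  (forall i, (i <= n)%nat -> degree_le (da i) (fun j => a j i)) -> (forall i, (i <= n)%nat -> degree_le (db i) (fun j => b j i)) ->
  (forall i, (i <= n)%nat -> (da i + db (n - i) <= D)%nat) -> degree_le D (fun j => fmulc n (a j) (b j)).
Proof.
  induction n as [|n IH]; intros a b da db D Ha Hb HD; cbn [fmulc].
  - apply (degree_le_le (da O + db O)); [exact (HD O (le_n O))|]. apply degree_le_mul; [apply Ha|apply Hb]; lia.
  - apply degree_le_add.
    + apply (degree_le_le (da O + db (S n))); [apply (HD O); lia|]. apply degree_le_mul; [apply Ha|apply Hb]; lia.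
    + apply (IH (fun j => shift (a j)) b (fun i => da (S i)) db).
      * intros i Hi. apply (Ha (S i)); lia.
      * intros i Hi. apply Hb; lia.
      * intros i Hi. apply (HD (S i)); lia.
Qed.

(** If X has weight 1 and j has weight 2, then the coefficient of X^r has
    weight at most r.  This is preserved by products and by [texp]. *)
Definition tame (f : nat -> fps) := forall r, (r <= 7)%nat -> degree_le (r / 2) (fun j => f j r).

Lemma div2_add i k n : (i + k <= n)%nat -> (i / 2 + k / 2 <= n / 2)%nat.
Proof. intros H. pose proof (Nat.div_mod_eq i 2). pose proof (Nat.div_mod_eq k 2). pose proof (Nat.div_mod_eq n 2).
  pose proof (Nat.mod_upper_bound n 2). lia. Qed.

Lemma tame_const a : tame (fun _ => a).
Proof. intros r _; apply degree_le_const. Qed.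
Lemma tame_mul f g : tame f -> tame g -> tame (fun j => (f j * g j)%F).
Proof.
  intros Hf Hg r Hr. apply (degree_le_fmulc r f g (fun i => (i / 2)%nat) (fun i => (i / 2)%nat)).
  - intros i Hi; apply Hf; lia.
  - intros i Hi; apply Hg; lia.
  - intros i Hi; apply div2_add; lia.
Qed.
Lemma tame_opp f : tame f -> tame (fun j => (- f j)%F).
Proof.
  intros Hf r Hr. apply (degree_le_ext _ (fun j => -1 * f j r)); [intros; unfold fopp; ring|].
  apply degree_le_scal; auto.
Qed.
Lemma tame_texp l : tame l -> tame (fun j => texp (l j)).
Proof.
  intros Hl. enough (H : forall n r, (r <= n)%nat -> (n <= 7)%nat -> degree_le (r / 2) (fun j => texp (l j) r)).
  { intros r Hr; apply (H r r); lia. }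
  induction n as [|n IH]; intros r Hr Hn.
  - replace r with O by lia. apply (degree_le_ext _ (fun _ => 1)); [reflexivity|apply degree_le_const].
  - destruct (Nat.eq_dec r (S n)) as [->|Hne]; [|apply IH; lia].
    apply (degree_le_ext _ (fun j => / INR (S n) * fmulc n (shift (l j)) (texp (l j)))).
    { intros j _. rewrite texp_S. unfold Rdiv. ring. }
    apply degree_le_scal. apply (degree_le_fmulc n (fun j => shift (l j)) (fun j => texp (l j)) (fun i => (S i / 2)%nat) (fun i => (i / 2)%nat)).
    + intros i Hi. apply (Hl (S i)); lia.
    + intros i Hi; apply IH; lia.
    + intros i Hi; apply div2_add; lia.
Qed.

(** It suffices that the i-th forward difference in j is divisible by
    X^(2i). *)
Lemma tame_newton f E1 E2 E3 E4 :
  (f 1%nat - f 0%nat = fX ^ 2 * E1)%F ->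
  (f 2%nat - fC 2 * f 1%nat + f 0%nat = fX ^ 4 * E2)%F ->
  (f 3%nat - fC 3 * f 2%nat + fC 3 * f 1%nat - f 0%nat = fX ^ 6 * E3)%F ->
  (f 4%nat - fC 4 * f 3%nat + fC 6 * f 2%nat - fC 4 * f 1%nat + f 0%nat = fX ^ 8 * E4)%F -> tame f.
Proof.
  intros H1 H2 H3 H4 r Hr.
  assert (G1 := f_equal (fun a : fps => a r) H1). assert (G2 := f_equal (fun a : fps => a r) H2).
  assert (G3 := f_equal (fun a : fps => a r) H3). assert (G4 := f_equal (fun a : fps => a r) H4).
  cbv beta in *. unfold fsub, fadd, fopp in *. rewrite ?fC_mul_n in *.
  pose proof (Nat.div_mod_eq r 2). pose proof (Nat.mod_upper_bound r 2).
  apply degree_le_newton; unfold diff1, diff2, diff3, diff4.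
  - intros Hd. rewrite fXpow_low in G1 by lia. lra.
  - intros Hd. rewrite fXpow_low in G2 by lia. lra.
  - intros Hd. rewrite fXpow_low in G3 by lia. lra.
  - rewrite fXpow_low in G4 by lia. lra.
Qed.

Definition family_case (j : nat) : case :=
  match j with 2%nat => case2 | 3%nat => case3 | 4%nat => case4 | _ => case1 end.
Definition fam_num (j : nat) : list Z := match j with O => repeat 1%Z 16 | _ => num_wts (family_case j) end.
Definition fam_den (j : nat) : list Z := match j with O => repeat 2%Z 10 | _ => den_wts (family_case j) end.
Definition P6_series (x : fps) : fps :=
  (fC 5460 * x ^ 4 - fC 8341 * x ^ 3 + fC 4864 * x ^ 2 - fC 1280 * x + fC 128)%F.

(** For j >= 1 the grid variables are y + 2a and y; the symmetric point kappa
    = m = y + a of the first case gives the polynomial P6. *)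
Definition fam_poly (j : nat) (y : fps) : fps :=
  match j with O => (fC 4 * (y + fX) ^ 10 * P6_series (y + fX))%F | _ => diag_poly (family_case j) (y + fC 2 * fX)%F y end.

(** The member 0 is the Taylor series of f6 at n + 1; the others are the
    diagonal terms of the four cases. *)
Definition family (j n : nat) : fps :=
  (texp (lam_full (gam_wts (fam_num j) (fam_den j))) *
   (pfac [4%Z] (4 * n + 1) * pfac (fam_num j) n * pfac_inv (fam_den j) (2 * n + 2)
    * (fC 2 * svar (2 * n)) * fam_poly j (mvar n)))%F.

Lemma kvar_mvar n : kvar n = (mvar n + fC 2 * fX)%F. Proof. reflexivity. Qed.
Lemma family_diag_hat j n : (1 <= j <= 4)%nat -> family j n = diag_hat (family_case j) n.
Proof. intros Hj. destruct j as [|j]; [lia|]. unfold diag_hat. rewrite diag_term_prod, kvar_mvar. reflexivity. Qed.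

(** Coefficients in X of polynomials in y, both in increasing degree. *)
Fixpoint fpoly2 (l : list (list Z)) (y : fps) : fps :=
  match l with nil => fC 0 | p :: l =>
    ((fix go p := match p with nil => fC 0 | x :: p => (fC (IZR x) + y * go p)%F end) p + fX * fpoly2 l y)%F end.

(** The four lists are the quotients of the forward differences by X^2, X^4,
    X^6 and X^8. *)
Lemma fam_poly_tame y : tame (fun j => fam_poly j y).
Proof.
  apply (tame_newton _ (fpoly2 [[0; 0; 0; 0; 0; 0; 0; 0; -512; 5120; -20480; 38760; -29088]; [0; 0; 0; 0; 0; 0; 0; -4096; 46080; -204800; 426360; -349056]; [0; 0; 0; 0; 0; 0; -14336; 184320; -920576; 2125564; -1910224]; [0; 0; 0; 0; 0; -28672; 430080; -2449408; 6339276; -6303520]; [0; 0; 0; 0; -35840; 645120; -4272128; 12567312; -13970288]; [0; 0; 0; -28672; 645120; -5103616; 17390352; -21911680]; [0; 0; -14336; 430080; -4229120; 17142348; -24948080]; [0; -4096; 184320; -2400256; 12039324; -20786080]; [-512; 46080; -892928; 5904856; -12584400]; [5120; -196608; 1926552; -5402048]; [-19456; 376388; -1561456]; [33364; -272992]; [-21840]]%Z y)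
    (fpoly2 [[0; 0; 0; 0; 0; 0; 512; -5120; 21504; -43016; 33824]; [0; 0; 0; 0; 0; 3072; -35840; 172032; -387144; 338240]; [0; 0; 0; 0; 7680; -107520; 600064; -1539584; 1512736]; [0; 0; 0; 10240; -179200; 1191936; -3550400; 3984128]; [0; 0; 7680; -179200; 1474560; -5230776; 6839776]; [0; 3072; -107520; 1163264; -5103256; 7990592]; [512; -35840; 571392; -3294624; 6424800]; [-5120; 159744; -1355904; 3504256]; [19456; -322392; 1237856]; [-33688; 254912]; [23136]]%Z y)
    (fpoly2 [[0; 0; 0; 0; -512; 5120; -22528; 49120; -48000]; [0; 0; 0; -2048; 25600; -135168; 343840; -384000]; [0; 0; -3072; 51200; -334848; 1017744; -1322688]; [0; -2048; 51200; -438272; 1650320; -2560128]; [-512; 25600; -319488; 1580336; -3038976]; [5120; -122880; 890448; -2256384]; [-19456; 271744; -1016640]; [34336; -251520]; [-25728]]%Z y)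
    (fpoly2 [[0; 0; 512; -5120; 23552; -61728; 90240]; [0; 1024; -15360; 94208; -308640; 541440]; [512; -15360; 137216; -592064; 1289600]; [-5120; 86016; -541632; 1548800]; [19456; -233408; 979456]; [-36928; 305152]; [36096]]%Z y));
    unfold fam_poly, family_case, P6_series, diag_poly, wzB, qprod, lin; simpl fpoly2; simpl fold_right; simpl sg; simpl pt; ring.
Qed.

Lemma lam_part_tame (w : nat -> list Z) N :
  (forall k, (1 <= k <= 7)%nat -> degree_le (k / 2) (fun j => psum (w j) k)) ->
  tame (fun j => lam_part (psum (w j)) N).
Proof.
  intros H [|r] Hr; [exact (degree_le_const _ 0)|].
  apply (degree_le_ext _ (fun j => (- (-1) ^ S r * harm N (S r)) * psum (w j) (S r))); [intros; unfold lam_part; ring|].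
  apply degree_le_scal. apply H; lia.
Qed.

Ltac psum_tac := intros k Hk;
  do 8 (destruct k as [|k]; [try lia; apply degree_le_newton; intros;
     first [exfalso; simpl in *; lia | unfold diff1, diff2, diff3, diff4, psum; cbn; ring]|]); lia.
Lemma fam_num_degree_le : forall k, (1 <= k <= 7)%nat -> degree_le (k / 2) (fun j => psum (fam_num j) k).
Proof. psum_tac. Qed.
Lemma fam_den_degree_le : forall k, (1 <= k <= 7)%nat -> degree_le (k / 2) (fun j => psum (fam_den j) k).
Proof. psum_tac. Qed.

Lemma fam_num_len j : length (fam_num j) = 16%nat.
Proof. destruct j as [|[|[|[|[|j]]]]]; reflexivity. Qed.
Lemma fam_den_len j : length (fam_den j) = 10%nat.
Proof. destruct j as [|[|[|[|[|j]]]]]; reflexivity. Qed.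

Lemma pfac_tame (w : nat -> list Z) L N : (forall j, length (w j) = L) ->
  (forall k, (1 <= k <= 7)%nat -> degree_le (k / 2) (fun j => psum (w j) k)) -> tame (fun j => pfac (w j) N).
Proof.
  intros HL H r Hr. apply (degree_le_ext _ (fun j => (fC (INR (fact N) ^ L) * texp (lam_part (psum (w j)) N))%F r)).
  - intros j _. now rewrite pfac_texp, HL.
  - revert r Hr. apply tame_mul; [apply tame_const|]. now apply tame_texp, lam_part_tame.
Qed.
Lemma pfac_inv_tame (w : nat -> list Z) L N : (forall j, length (w j) = L) ->
  (forall k, (1 <= k <= 7)%nat -> degree_le (k / 2) (fun j => psum (w j) k)) -> tame (fun j => pfac_inv (w j) N).
Proof.
  intros HL H r Hr. apply (degree_le_ext _ (fun j => (fC (/ INR (fact N) ^ L) * texp (- lam_part (psum (w j)) N))%F r)).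
  - intros j _. now rewrite pfac_inv_texp, HL.
  - revert r Hr. apply tame_mul; [apply tame_const|]. apply tame_texp, tame_opp. now apply lam_part_tame.
Qed.

Lemma gam_tame : tame (fun j => lam_full (gam_wts (fam_num j) (fam_den j))).
Proof.
  intros [|[|r]] Hr; [exact (degree_le_const _ 0)..|].
  apply (degree_le_ext _ (fun j => (- (-1) ^ S (S r) * zetak (S (S r))) * (psum (fam_den j) (S (S r)) + (-1 * psum (fam_num j) (S (S r)) + - 4 ^ S (S r))))).
  - intros j _. unfold lam_full, gam_wts. ring.
  - apply degree_le_scal, degree_le_add; [apply fam_den_degree_le; lia|]. apply degree_le_add; [apply degree_le_scal, fam_num_degree_le; lia|apply degree_le_const].
Qed.

Lemma family_tame n : tame (fun j => family j n).
Proof.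
  unfold family. apply tame_mul; [apply tame_texp, gam_tame|].
  apply tame_mul; [|apply fam_poly_tame]. apply tame_mul; [|apply tame_const].
  apply tame_mul; [apply tame_mul; [apply tame_const|]|].
  - apply (pfac_tame fam_num 16); [apply fam_num_len|apply fam_num_degree_le].
  - apply (pfac_inv_tame fam_den 10); [apply fam_den_len|apply fam_den_degree_le].
Qed.

Lemma family_fourth_difference n r : (r <= 7)%nat ->
  family 0 n r = 4 * diag_hat case1 n r - 6 * diag_hat case2 n r + 4 * diag_hat case3 n r - diag_hat case4 n r.
Proof.
  intros Hr. assert (H := degree_le_diff4 _ _ (family_tame n r Hr)).
  assert (r / 2 <= 3)%nat by (apply (Nat.Div0.div_le_mono r 7 2); lia).
  specialize (H ltac:(assumption)). unfold diff4 in H.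
  rewrite !(family_diag_hat (S _)) in H by lia. simpl family_case in H. lra.
Qed.

(** The coefficients of 4 S_1 - 6 S_2 + 4 S_3 - S_4. *)
Definition sum_coef (r : nat) : R :=
  4 * (sin_unit case1 * row_series1)%F r - 6 * (sin_unit case2 - gam_unit case2)%F (4 + r)%nat
  + 4 * (sin_unit case3 * row_series3)%F r + / 3 * (sin_unit case4 - gam_unit case4)%F (4 + r)%nat.

Lemma family_sum r : (r <= 7)%nat -> is_series (fun n => family 0 n r) (sum_coef r).
Proof.
  intros Hr.
  assert (E : forall f (l : fps), flim7 (fsum f) l -> is_series (fun n => f n r) (l r)).
  { intros f l H. specialize (H r Hr). apply is_lim_seq_incr_1 in H.
    refine (is_lim_seq_ext _ _ _ _ H). intros N. apply fsum_coef. }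
  assert (H1 := E _ _ diagonal_sum1). assert (H2 := E _ _ diagonal_sum2). assert (H3 := E _ _ diagonal_sum3). assert (H4 := E _ _ diagonal_sum4).
  cbv beta in H2, H4.
  apply (is_series_scal 4) in H1. apply (is_series_scal (-6)) in H2. apply (is_series_scal 4) in H3. apply (is_series_scal (-1)) in H4.
  assert (H := is_series_plus _ _ _ _ (is_series_plus _ _ _ _ H1 H2) (is_series_plus _ _ _ _ H3 H4)).
  unfold plus, scal in H; simpl in H. unfold mult in H; simpl in H.
  replace (sum_coef r) with (4 * (sin_unit case1 * row_series1)%F r + -6 * (sin_unit case2 - gam_unit case2)%F (S (S (S (S r)))) +
      (4 * (sin_unit case3 * row_series3)%F r + -1 * (- / 3 * (sin_unit case4 - gam_unit case4)%F (S (S (S (S r))))))).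
  - refine (is_series_ext _ _ _ _ H). intros n. rewrite family_fourth_difference by assumption. simpl. ring.
  - unfold sum_coef. simpl plus. change (4 + r)%nat with (S (S (S (S r)))). field.
Qed.

(** * The gamma integral *)

Definition gam_int (x t : R) : R := Rpower t (x - 1) * exp (- t).
Notation Gz := (at_right 0).
Notation Gi := (Rbar_locally p_infty).

Lemma Rpower_pos x y : 0 < Rpower x y.
Proof. apply exp_pos. Qed.
Lemma gam_int_pos x t : 0 < gam_int x t.
Proof. apply Rmult_lt_0_compat; [apply Rpower_pos|apply exp_pos]. Qed.
Lemma gam_int_cont x t : 0 < t -> continuous (gam_int x) t.
Proof.
  intros Ht. apply (ex_derive_continuous (V := R_NormedModule)).
  unfold gam_int, Rpower. auto_derive. assumption.
Qed.

(** From ln u <= u - 1 at u = t / (2p). *)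
Lemma Rpower_exp_bound p t : 0 < p -> 0 < t ->
  Rpower t p * exp (- t) <= Rpower (2 * p) p * exp (- (t / 2)).
Proof.
  intros Hp Ht. unfold Rpower. rewrite <- !exp_plus.
  assert (H : ln t <= ln (2 * p) + t / (2 * p) - 1).
  { replace (ln t) with (ln (2 * p) + ln (t / (2 * p))).
    - assert (0 < t / (2 * p)) by (apply Rdiv_lt_0_compat; lra).
      pose proof (exp_ineq1_le (ln (t / (2 * p)))) as E. rewrite exp_ln in E by assumption. lra.
    - rewrite <- ln_mult; [f_equal; field; lra|lra|apply Rdiv_lt_0_compat; lra]. }
  assert (E : p * ln t + - t <= p * ln (2 * p) + - (t / 2)).
  { apply Rmult_le_compat_l with (r := p) in H; [|lra].
    replace (p * (ln (2 * p) + t / (2 * p) - 1)) with (p * ln (2 * p) + t / 2 - p) in H by (field; lra). lra. }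
  destruct E as [E|E]; [left; now apply exp_increasing|right; now rewrite E].
Qed.

Lemma gam_int_S x t : gam_int (x + 1) t = Rpower t x * exp (- t).
Proof. unfold gam_int. now replace (x + 1 - 1) with x by ring. Qed.

Lemma filter_prod_box (P : R * R -> Prop) a0 b0 : 0 < a0 ->
  (forall a b, 0 < a < a0 -> b0 < b -> P (a, b)) -> filter_prod Gz Gi P.
Proof.
  intros Ha H. apply Filter_prod with (fun a => 0 < a < a0) (fun b => b0 < b).
  - exists (mkposreal a0 Ha). intros y Hy H0. split; [assumption|].
    change (Rabs (y - 0) < a0) in Hy. rewrite Rminus_0_r, Rabs_pos_eq in Hy; lra.
  - exists b0. auto.
  - intros a b Q R. apply H; assumption.
Qed.

Lemma gam_int_ex_RInt x a b : 0 < a -> a <= b -> ex_RInt (gam_int x) a b.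
Proof.
  intros Ha Hb. apply (ex_RInt_continuous (V := R_CompleteNormedModule)).
  intros z Hz. rewrite Rmin_left in Hz by assumption. apply gam_int_cont; lra.
Qed.

Lemma gam_int_RInt_bound x a b : 0 < x -> 0 < a -> a <= b ->
  RInt (gam_int (x + 1)) a b <= 2 * Rpower (2 * x) x.
Proof.
  intros Hx Ha Hb. set (A := Rpower (2 * x) x).
  assert (HA : 0 < A) by apply Rpower_pos.
  assert (HI : is_RInt (fun t => A * exp (- (t / 2))) a b (- 2 * A * exp (- (b / 2)) - - 2 * A * exp (- (a / 2)))).
  { apply (is_RInt_derive (fun t => - 2 * A * exp (- (t / 2)))).
    - intros t _. auto_derive; [trivial|]. unfold Rdiv; field.
    - intros t _. apply (ex_derive_continuous (V := R_NormedModule)). auto_derive. trivial. }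
  eapply Rle_trans; [apply (RInt_le (gam_int (x + 1)) (fun t => A * exp (- (t / 2))) a b Hb)|].
  - now apply gam_int_ex_RInt.
  - eexists; exact HI.
  - intros t Ht. rewrite gam_int_S. apply Rpower_exp_bound; lra.
  - rewrite (is_RInt_unique _ _ _ _ HI).
    assert (0 < exp (- (b / 2))) by apply exp_pos.
    assert (exp (- (a / 2)) <= 1).
    { rewrite <- exp_0. left. apply exp_increasing. lra. }
    nra.
Qed.

Lemma gam_int_mono x a0 b0 a b : 0 < a -> a <= a0 -> a0 <= b0 -> b0 <= b ->
  RInt (gam_int x) a0 b0 <= RInt (gam_int x) a b.
Proof.
  intros Ha H1 H2 H3.
  assert (P : forall u v, 0 < u -> u <= v -> 0 <= RInt (gam_int x) u v).
  { intros u v Hu Hv. apply RInt_ge_0; [assumption|now apply gam_int_ex_RInt|]. intros; left; apply gam_int_pos. }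
  rewrite <- (RInt_Chasles (gam_int x) a a0 b) by (apply gam_int_ex_RInt; lra).
  rewrite <- (RInt_Chasles (gam_int x) a0 b0 b) by (apply gam_int_ex_RInt; lra).
  pose proof (P a a0 Ha H1). pose proof (P b0 b ltac:(lra) H3). unfold plus; simpl. lra.
Qed.

(** The partial integrals increase and are bounded.  The exponent x > 0 keeps
    the integrand bounded near 0; smaller exponents are reached by integration
    by parts. *)
Lemma gam_int_ex_S x : 0 < x -> ex_RInt_gen (gam_int (x + 1)) Gz Gi.
Proof.
  intros Hx. set (E := fun y => exists a b, 0 < a /\ a <= b /\ y = RInt (gam_int (x + 1)) a b).
  destruct (completeness E) as [l [Hl1 Hl2]].
  - exists (2 * Rpower (2 * x) x). intros y [a [b [Ha [Hb ->]]]]. now apply gam_int_RInt_bound.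
  - exists (RInt (gam_int (x + 1)) 1 1). exists 1, 1. lra.
  - exists l. intros P [eps HP].
    assert (Hex : exists a b, 0 < a /\ a <= b /\ l - eps < RInt (gam_int (x + 1)) a b).
    { destruct (Classical_Prop.classic (exists a b, 0 < a /\ a <= b /\ l - eps < RInt (gam_int (x + 1)) a b)) as [H|H]; [exact H|].
      exfalso. assert (l <= l - eps); [|pose proof (cond_pos eps); lra]. apply Hl2.
      intros y [a [b [Ha [Hb ->]]]]. apply Rnot_lt_le; intros Hc. apply H. exists a, b. auto. }
    destruct Hex as [a0 [b0 [Ha0 [Hb0 Hlt]]]].
    unfold filtermapi. apply filter_prod_box with a0 b0; [assumption|].
    intros a b Ha Hb. exists (RInt (gam_int (x + 1)) a b). simpl. split.
    + apply (RInt_correct (V := R_CompleteNormedModule)). apply gam_int_ex_RInt; lra.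
    + apply HP. change (Rabs (RInt (gam_int (x + 1)) a b - l) < eps).
      assert (RInt (gam_int (x + 1)) a b <= l) by (apply Hl1; exists a, b; repeat split; lra).
      assert (RInt (gam_int (x + 1)) a0 b0 <= RInt (gam_int (x + 1)) a b) by (apply gam_int_mono; lra).
      rewrite Rabs_left1; lra.
Qed.

Lemma lim_power_exp_0 x : 0 < x -> filterlim (fun t => Rpower t x * exp (- t)) Gz (locally 0).
Proof.
  intros Hx P [eps HP]. unfold filtermap.
  assert (Hd : 0 < Rpower eps (/ x)) by apply Rpower_pos.
  exists (mkposreal _ Hd). intros t Ht Ht0. apply HP.
  change (Rabs (t - 0) < Rpower eps (/ x)) in Ht. rewrite Rminus_0_r, Rabs_pos_eq in Ht by lra.
  change (Rabs (Rpower t x * exp (- t) - 0) < eps). rewrite Rminus_0_r, Rabs_pos_eq.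
  - apply Rle_lt_trans with (Rpower t x * 1).
    + apply Rmult_le_compat_l; [left; apply Rpower_pos|]. rewrite <- exp_0. left; apply exp_increasing; lra.
    + rewrite Rmult_1_r. replace (pos eps) with (Rpower (Rpower eps (/ x)) x).
      * apply Rlt_Rpower_l; lra.
      * rewrite Rpower_mult, Rinv_l by lra. apply Rpower_1, cond_pos.
  - left; apply Rmult_lt_0_compat; [apply Rpower_pos|apply exp_pos].
Qed.
Lemma lim_power_exp_inf x : 0 < x -> filterlim (fun t => Rpower t x * exp (- t)) Gi (locally 0).
Proof.
  intros Hx P [eps HP]. unfold filtermap.
  set (A := Rpower (2 * x) x). assert (HA : 0 < A) by apply Rpower_pos. assert (He := cond_pos eps).
  assert (HM : 0 < 2 * A / eps) by (apply Rdiv_lt_0_compat; lra).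
  exists (2 * A / eps). intros t Ht. apply HP.
  change (Rabs (Rpower t x * exp (- t) - 0) < eps). rewrite Rminus_0_r, Rabs_pos_eq
    by (left; apply Rmult_lt_0_compat; [apply Rpower_pos|apply exp_pos]).
  eapply Rle_lt_trans; [apply Rpower_exp_bound; lra|]. fold A.
  assert (E : t / 2 < exp (t / 2)) by (pose proof (exp_ineq1 (t / 2)); lra).
  rewrite exp_Ropp. apply Rmult_lt_reg_r with (exp (t / 2)); [apply exp_pos|].
  rewrite Rmult_assoc, Rinv_l, Rmult_1_r by (apply Rgt_not_eq, exp_pos).
  apply Rlt_trans with (eps * (t / 2)); [|apply Rmult_lt_compat_l; assumption].
  apply Rmult_lt_reg_l with (2 / eps); [apply Rdiv_lt_0_compat; lra|].
  replace (2 / eps * (eps * (t / 2))) with t by (field; lra). replace (2 / eps * A) with (2 * A / eps) by (field; lra). assumption.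
Qed.

Lemma box_pos (P : R * R -> Prop) : (forall a b, 0 < a -> a <= b -> P (a, b)) -> filter_prod Gz Gi P.
Proof. intros H. apply filter_prod_box with 1 1; [lra|]. intros a b Ha Hb; apply H; lra. Qed.

Lemma Derive_power_exp x t : 0 < t -> is_derive (fun t => Rpower t x * exp (- t)) t (x * gam_int x t - gam_int (x + 1) t).
Proof.
  intros Ht. rewrite gam_int_S. unfold gam_int, Rpower. auto_derive; [assumption|].
  replace ((x - 1) * ln t) with (x * ln t + - ln t) by ring. rewrite exp_plus, (exp_Ropp (ln t)), exp_ln by assumption.
  field. lra.
Qed.

(** The integrand is the derivative of t^x exp (-t), which tends to 0 at both
    ends. *)
Lemma gam_int_parts x : 0 < x -> is_RInt_gen (fun t => x * gam_int x t - gam_int (x + 1) t) Gz Gi 0.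
Proof.
  intros Hx. set (F := fun t => Rpower t x * exp (- t)).
  assert (D : forall t, 0 < t -> Derive F t = x * gam_int x t - gam_int (x + 1) t).
  { intros t Ht. apply is_derive_unique. now apply Derive_power_exp. }
  apply (is_RInt_gen_ext (V := R_NormedModule)) with (Derive F).
  - apply box_pos; intros a b Ha Hb t. simpl. rewrite Rmin_left by assumption. intros Ht. apply D; lra.
  - replace (is_RInt_gen (Derive F) Gz Gi 0) with (is_RInt_gen (Derive F) Gz Gi (0 - 0)) by (f_equal; ring).
    apply is_RInt_gen_Derive.
    + apply box_pos; intros a b Ha Hb t. simpl. rewrite Rmin_left by assumption. intros Ht.
      eexists. apply Derive_power_exp; lra.
    + apply box_pos; intros a b Ha Hb t. simpl. rewrite Rmin_left by assumption. intros Ht.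
      apply continuous_ext_loc with (fun t => x * gam_int x t - gam_int (x + 1) t).
      * assert (Ht0 : 0 < t) by lra. exists (mkposreal t Ht0). intros y Hy. symmetry; apply D.
        change (Rabs (y - t) < t) in Hy. apply Rabs_def2 in Hy. lra.
      * apply (continuous_minus (V := R_NormedModule)); [|apply gam_int_cont; lra].
        apply (continuous_scal_r (V := R_NormedModule) x). apply gam_int_cont; lra.
    + now apply lim_power_exp_0.
    + now apply lim_power_exp_inf.
Qed.

Lemma Gamma_unique x l : is_RInt_gen (gam_int x) Gz Gi l -> Gamma x = l.
Proof. intros H. exact (is_RInt_gen_unique (V := R_CompleteNormedModule) (gam_int x) l H). Qed.

Lemma gam_int_step x l : 0 < x -> is_RInt_gen (gam_int (x + 1)) Gz Gi l -> is_RInt_gen (gam_int x) Gz Gi (/ x * l).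
Proof.
  intros Hx H. assert (H2 := is_RInt_gen_plus _ _ _ _ (gam_int_parts x Hx) H).
  apply (is_RInt_gen_scal _ (/ x)) in H2.
  replace (/ x * l) with (scal (/ x) (plus 0 l)).
  - refine (is_RInt_gen_ext _ _ _ _ H2). apply filter_forall. intros ab t _.
    unfold scal, plus; simpl; unfold mult; simpl. field. lra.
  - unfold scal, plus; simpl; unfold mult; simpl. ring.
Qed.

Lemma Gamma_correct x : 0 < x -> is_RInt_gen (gam_int x) Gz Gi (Gamma x).
Proof.
  intros Hx. destruct (gam_int_ex_S x Hx) as [l Hl]. apply gam_int_step in Hl; [|assumption].
  now rewrite (Gamma_unique _ _ Hl).
Qed.

Lemma Gamma_S x : 0 < x -> Gamma (x + 1) = x * Gamma x.
Proof.
  intros Hx. assert (H := gam_int_step x _ Hx (Gamma_correct (x + 1) ltac:(lra))).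
  rewrite (Gamma_unique _ _ H). field. lra.
Qed.

Lemma Gamma_1 : Gamma 1 = 1.
Proof.
  apply Gamma_unique. set (F := fun t => - exp (- t)).
  assert (D : forall t, Derive F t = exp (- t)).
  { intros t. apply is_derive_unique. unfold F. auto_derive; [trivial|ring]. }
  apply (is_RInt_gen_ext (V := R_NormedModule)) with (Derive F).
  - apply box_pos; intros a b Ha Hb t. simpl. rewrite Rmin_left by assumption. intros Ht.
    rewrite D. unfold gam_int. rewrite Rminus_diag, Rpower_O by lra. ring.
  - replace 1 with (0 - -1) by ring. apply is_RInt_gen_Derive.
    + apply filter_forall. intros ab t _. unfold F. auto_derive. trivial.
    + apply filter_forall. intros ab t _. apply continuous_ext with (fun t => exp (- t)); [intros; now rewrite D|].
      apply (ex_derive_continuous (V := R_NormedModule)). auto_derive. trivial.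
    + assert (C : continuous F 0) by (apply (ex_derive_continuous (V := R_NormedModule)); unfold F; auto_derive; trivial).
      unfold continuous in C. replace (F 0) with (-1) in C by (unfold F; rewrite Ropp_0, exp_0; ring).
      intros P HP. destruct (C P HP) as [d Hd]. exists d. intros y Hy _. now apply Hd.
    + intros P [eps HP]. unfold filtermap. assert (He := cond_pos eps).
      exists (/ eps). intros t Ht. apply HP. assert (0 < / eps) by now apply Rinv_0_lt_compat.
      change (Rabs (F t - 0) < eps). unfold F. rewrite Rminus_0_r, Rabs_Ropp, Rabs_pos_eq by (left; apply exp_pos).
      rewrite exp_Ropp. rewrite <- (Rinv_inv eps). apply Rinv_lt_contravar; [apply Rmult_lt_0_compat; [assumption|apply exp_pos]|].
      pose proof (exp_ineq1 t). lra.
Qed.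

(** Weighted arithmetic-geometric mean inequality for 1 and t / l. *)
Lemma power_convex s l t : 0 <= s <= 1 -> 0 < l -> 0 < t ->
  Rpower t s <= Rpower l s * ((1 - s) + s * (t / l)).
Proof.
  intros Hs Hl Ht. set (u := ln (t / l)). assert (Hu : 0 < t / l) by (apply Rdiv_lt_0_compat; lra).
  assert (E : t / l = exp u) by (unfold u; now rewrite exp_ln).
  replace (Rpower t s) with (Rpower l s * exp (s * u)).
  - apply Rmult_le_compat_l; [left; apply Rpower_pos|]. rewrite E.
    assert (E1 := exp_ineq1_le (- (s * u))). assert (E2 := exp_ineq1_le (u - s * u)).
    assert (P := exp_pos (s * u)).
    assert (F1 : exp (s * u) * exp (- (s * u)) = 1) by (rewrite <- exp_plus, Rplus_opp_r; apply exp_0).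
    assert (F2 : exp (s * u) * exp (u - s * u) = exp u) by (rewrite <- exp_plus; f_equal; ring).
    rewrite <- F2.
    replace (1 - s + s * (exp (s * u) * exp (u - s * u))) with
      ((1 - s) * (exp (s * u) * exp (- (s * u))) + s * (exp (s * u) * exp (u - s * u))) by (rewrite F1; ring).
    replace ((1 - s) * (exp (s * u) * exp (- (s * u))) + s * (exp (s * u) * exp (u - s * u)))
      with (exp (s * u) * ((1 - s) * exp (- (s * u)) + s * exp (u - s * u))) by ring.
    rewrite <- (Rmult_1_r (exp (s * u))) at 1. apply Rmult_le_compat_l; [lra|]. nra.
  - unfold Rpower. rewrite <- exp_plus. f_equal. unfold u. rewrite ln_div by assumption. ring.
Qed.

(** Integrate [power_convex] at l = x; the two terms on the right become 1 - s
    and s times x^s Gamma x. *)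
Lemma Gamma_ineq x s : 0 < x -> 0 <= s <= 1 -> Gamma (x + s) <= Rpower x s * Gamma x.
Proof.
  intros Hx Hs.
  assert (H1 := Gamma_correct (x + s) ltac:(lra)).
  assert (H2 : is_RInt_gen (fun t => plus (scal (Rpower x s * (1 - s)) (gam_int x t)) (scal (Rpower x s * (s / x)) (gam_int (x + 1) t))) Gz Gi
     (plus (scal (Rpower x s * (1 - s)) (Gamma x)) (scal (Rpower x s * (s / x)) (Gamma (x + 1))))).
  { apply (is_RInt_gen_plus (V := R_NormedModule)); apply (is_RInt_gen_scal (V := R_NormedModule)); apply Gamma_correct; lra. }
  apply Rle_trans with (norm (Gamma (x + s))); [apply Rle_abs|].
  eapply Rle_trans; [refine (RInt_gen_norm _ _ _ _ _ _ H1 H2)|].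
  - apply box_pos; intros; simpl; assumption.
  - apply box_pos; intros a b Ha Hb t; simpl; intros Ht.
    unfold norm; simpl; unfold abs; simpl. rewrite Rabs_pos_eq by (left; apply gam_int_pos).
    unfold plus, scal; simpl; unfold mult; simpl.
    assert (Ht0 : 0 < t) by lra. assert (C := power_convex s x t Hs Hx Ht0).
    rewrite gam_int_S. unfold gam_int. replace (x + s - 1) with ((x - 1) + s) by ring. rewrite Rpower_plus.
    replace (Rpower t x) with (Rpower t (x - 1) * t)
      by (rewrite <- (Rpower_1 t) at 2 by assumption; rewrite <- Rpower_plus; f_equal; ring).
    assert (P : 0 < Rpower t (x - 1) * exp (- t)) by (apply Rmult_lt_0_compat; [apply Rpower_pos|apply exp_pos]).
    replace (Rpower x s * (1 - s) * (Rpower t (x - 1) * exp (- t)) + Rpower x s * (s / x) * (Rpower t (x - 1) * t * exp (- t)))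
      with ((Rpower t (x - 1) * exp (- t)) * (Rpower x s * (1 - s + s * (t / x)))) by (field; lra).
    replace (Rpower t (x - 1) * Rpower t s * exp (- t)) with ((Rpower t (x - 1) * exp (- t)) * Rpower t s) by ring.
    apply Rmult_le_compat_l; lra.
  - unfold plus, scal; simpl; unfold mult; simpl. rewrite Gamma_S by assumption. right. field. lra.
Qed.

(** * Gauss product and germs of analytic functions *)

Fixpoint rising (N : nat) (s : R) : R :=
  match N with O => 1 | S n => rising n s * (INR (S n) + s) end.

Lemma Gamma_rising N s : 0 < 1 + s -> Gamma (INR (S N) + s) = Gamma (1 + s) * rising N s.
Proof.
  intros Hs; induction N as [|N IH]; [simpl; ring|].
  cbn [rising]. rewrite (S_INR (S N)). replace (INR (S N) + 1 + s) with ((INR (S N) + s) + 1) by ring.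
  rewrite Gamma_S, IH by (rewrite S_INR; pose proof (pos_INR N); lra). ring.
Qed.
Lemma rising_0 N : rising N 0 = INR (fact N).
Proof.
  induction N as [|N IH]; [reflexivity|]. cbn [rising]. rewrite IH, fact_simpl, mult_INR. ring.
Qed.
Lemma Gamma_fact N : Gamma (INR (S N)) = INR (fact N).
Proof.
  rewrite <- (Rplus_0_r (INR (S N))), Gamma_rising by lra.
  now rewrite Rplus_0_r, Gamma_1, rising_0, Rmult_1_l.
Qed.

Definition gam_ratio (s : R) (N : nat) : R := Gamma (INR (S N) + s) / (Rpower (INR (S N)) s * INR (fact N)).

(** The lower bound is [Gamma_ineq] applied to the step from x + s to x +
    1. *)
Lemma gam_ratio_bounds s N : 0 <= s <= 1 -> INR (S N) / (INR (S N) + 1) <= gam_ratio s N <= 1.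
Proof.
  intros Hs. unfold gam_ratio. set (x := INR (S N)).
  assert (Hx : 1 <= x) by (unfold x; rewrite S_INR; pose proof (pos_INR N); lra).
  assert (HF : 0 < INR (fact N)) by apply INR_fact_lt_0.
  assert (Hp : 0 < Rpower x s) by apply Rpower_pos.
  assert (HG : Gamma x = INR (fact N)) by apply Gamma_fact.
  assert (Hd : 0 < Rpower x s * INR (fact N)) by now apply Rmult_lt_0_compat.
  split.
  - assert (H := Gamma_ineq (x + s) (1 - s) ltac:(lra) ltac:(lra)).
    replace (x + s + (1 - s)) with (x + 1) in H by ring. rewrite Gamma_S, HG in H by lra.
    (* Replacing x by x + s in the second power loses only a factor that tends to 1. *)
    assert (Hxs : Rpower (x + s) (1 - s) * Rpower x s <= x + s).
    { apply Rle_trans with (Rpower (x + s) (1 - s) * Rpower (x + s) s).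
      - apply Rmult_le_compat_l; [left; apply Rpower_pos|]. apply Rle_Rpower_l; lra.
      - rewrite <- Rpower_plus. replace (1 - s + s) with 1 by ring. rewrite Rpower_1; lra. }
    assert (HGp : 0 < Gamma (x + s)).
    { assert (0 < x * INR (fact N)) by (apply Rmult_lt_0_compat; lra).
      assert (0 < Rpower (x + s) (1 - s)) by apply Rpower_pos.
      apply Rmult_lt_reg_l with (Rpower (x + s) (1 - s)); lra. }
    assert (H2 : x * INR (fact N) * Rpower x s <= (x + 1) * Gamma (x + s)).
    { apply Rle_trans with (Rpower (x + s) (1 - s) * Gamma (x + s) * Rpower x s); [apply Rmult_le_compat_r; lra|].
      replace (Rpower (x + s) (1 - s) * Gamma (x + s) * Rpower x s) with (Rpower (x + s) (1 - s) * Rpower x s * Gamma (x + s)) by ring.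
      apply Rmult_le_compat_r; lra. }
    apply Rmult_le_reg_r with ((x + 1) * (Rpower x s * INR (fact N))); [apply Rmult_lt_0_compat; lra|].
    replace (x / (x + 1) * ((x + 1) * (Rpower x s * INR (fact N)))) with (x * INR (fact N) * Rpower x s) by (field; lra).
    replace (Gamma (x + s) / (Rpower x s * INR (fact N)) * ((x + 1) * (Rpower x s * INR (fact N)))) with ((x + 1) * Gamma (x + s))
      by (field; split; lra). exact H2.
  - apply Rmult_le_reg_r with (Rpower x s * INR (fact N)); [assumption|].
    replace (Gamma (x + s) / (Rpower x s * INR (fact N)) * (Rpower x s * INR (fact N))) with (Gamma (x + s)) by (field; split; lra).
    rewrite Rmult_1_l, <- HG. apply Gamma_ineq; lra.
Qed.

Lemma lim_ratio a : -1 < a -> is_lim_seq (fun N => INR (S N) / (INR (S N) + a)) 1.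
Proof.
  intros Ha. apply is_lim_seq_ext with (fun N => 1 - a * / (INR (S N) + a)).
  - intros N. field. rewrite S_INR. pose proof (pos_INR N). lra.
  - replace (Finite 1) with (Finite (1 - a * 0)) by (f_equal; ring).
    apply is_lim_seq_minus'; [apply is_lim_seq_const|].
    apply (is_lim_seq_scal_l _ a 0).
    replace (Finite 0) with (Rbar_inv p_infty) by reflexivity.
    apply is_lim_seq_inv; [|discriminate].
    replace p_infty with (Rbar_plus p_infty a) by reflexivity.
    apply is_lim_seq_plus with p_infty a; [|apply is_lim_seq_const|reflexivity].
    apply -> is_lim_seq_incr_1. apply is_lim_seq_INR.
Qed.

Lemma gam_ratio_lim s : -1 < s < 1 -> is_lim_seq (gam_ratio s) 1.
Proof.
  assert (P : forall s, 0 <= s <= 1 -> is_lim_seq (gam_ratio s) 1).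
  { intros t Ht. apply is_lim_seq_le_le with (fun N => INR (S N) / (INR (S N) + 1)) (fun _ => 1).
    - intros N. now apply gam_ratio_bounds.
    - apply lim_ratio; lra.
    - apply is_lim_seq_const. }
  intros Hs. destruct (Rle_dec 0 s) as [H0|H0]; [apply P; lra|].
  apply is_lim_seq_ext with (fun N => gam_ratio (s + 1) N * (INR (S N) / (INR (S N) + s))).
  - intros N. unfold gam_ratio. set (x := INR (S N)).
    assert (Hx : 1 <= x) by (unfold x; rewrite S_INR; pose proof (pos_INR N); lra).
    replace (x + (s + 1)) with ((x + s) + 1) by ring. rewrite Gamma_S by lra.
    rewrite Rpower_plus, Rpower_1 by lra. field.
    assert (0 < Rpower x s) by apply Rpower_pos. assert (0 < INR (fact N)) by apply INR_fact_lt_0. repeat split; lra.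
  - replace (Finite 1) with (Finite (1 * 1)) by (f_equal; ring).
    apply is_lim_seq_mult'; [apply P; lra|apply lim_ratio; lra].
Qed.

Lemma Gamma_pos s : -1 < s < 1 -> 0 < Gamma (1 + s).
Proof.
  assert (P : forall s, 0 <= s <= 1 -> 0 < Gamma (1 + s)).
  { intros t Ht. destruct (gam_ratio_bounds t 0 Ht) as [H _]. unfold gam_ratio in H. simpl in H.
    assert (E : 0 < Rpower 1 t) by apply Rpower_pos.
    assert (0 < Gamma (1 + t) / (Rpower 1 t * 1)) by lra.
    apply Rmult_lt_reg_r with (/ (Rpower 1 t * 1)); [apply Rinv_0_lt_compat; lra|]. rewrite Rmult_0_l. assumption. }
  intros Hs. destruct (Rle_dec 0 s) as [H0|H0]; [apply P; lra|].
  assert (H := P (1 + s) ltac:(lra)). rewrite Rplus_comm, Gamma_S in H by lra.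
  apply Rmult_lt_reg_l with (1 + s); lra.
Qed.

(** The limit formula of Euler and Gauss, from [gam_ratio_lim] and the
    functional equation. *)
Lemma rising_lim s : -1 < s < 1 ->
  is_lim_seq (fun N => rising N s / (Rpower (INR (S N)) s * INR (fact N))) (/ Gamma (1 + s)).
Proof.
  intros Hs. assert (G := Gamma_pos s Hs).
  apply is_lim_seq_ext with (fun N => / Gamma (1 + s) * gam_ratio s N).
  - intros N. unfold gam_ratio. rewrite Gamma_rising by lra. field.
    assert (0 < Rpower (INR (S N)) s) by apply Rpower_pos. assert (0 < INR (fact N)) by apply INR_fact_lt_0. repeat split; lra.
  - replace (Finite (/ Gamma (1 + s))) with (Finite (/ Gamma (1 + s) * 1)) by (f_equal; ring).
    apply (is_lim_seq_scal_l _ _ 1). now apply gam_ratio_lim.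
Qed.

Definition gam_quot (h : R) : R := Gamma (1 + 4 * h) * Gamma (1 + h) ^ 16 / Gamma (1 + 2 * h) ^ 10.

Lemma is_lim_seq_pow u (l : R) k : is_lim_seq u l -> is_lim_seq (fun n => u n ^ k) (l ^ k).
Proof.
  intros H; induction k as [|k IH]; [apply is_lim_seq_const|].
  simpl. now apply is_lim_seq_mult'.
Qed.

Lemma rising_pos N s : -1 < s -> 0 < rising N s.
Proof.
  intros Hs; induction N as [|N IH]; [simpl; lra|]. cbn [rising].
  apply Rmult_lt_0_compat; [assumption|]. rewrite S_INR; pose proof (pos_INR N); lra.
Qed.

(** The powers of N + 1 cancel because 4 + 16 = 2 * 10. *)
Lemma gam_quot_lim h : Rabs h < / 4 ->
  is_lim_seq (fun N => rising N (2 * h) ^ 10 * INR (fact N) ^ 7 / (rising N (4 * h) * rising N h ^ 16)) (gam_quot h).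
Proof.
  intros Hh. apply Rabs_def2 in Hh.
  assert (L2 := rising_lim (2 * h) ltac:(lra)). assert (L4 := rising_lim (4 * h) ltac:(lra)).
  assert (L1 := rising_lim h ltac:(lra)).
  assert (G2 := Gamma_pos (2 * h) ltac:(lra)). assert (G4 := Gamma_pos (4 * h) ltac:(lra)).
  assert (G1 := Gamma_pos h ltac:(lra)).
  apply is_lim_seq_ext with (fun N => (rising N (2 * h) / (Rpower (INR (S N)) (2 * h) * INR (fact N))) ^ 10 *
    / ((rising N (4 * h) / (Rpower (INR (S N)) (4 * h) * INR (fact N))) * (rising N h / (Rpower (INR (S N)) h * INR (fact N))) ^ 16)).
  - intros N.
    replace (Rpower (INR (S N)) (2 * h)) with (Rpower (INR (S N)) h ^ 2)
      by (rewrite <- Rpower_pow, Rpower_mult by apply Rpower_pos; f_equal; simpl; ring).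
    replace (Rpower (INR (S N)) (4 * h)) with (Rpower (INR (S N)) h ^ 4)
      by (rewrite <- Rpower_pow, Rpower_mult by apply Rpower_pos; f_equal; simpl; ring).
    assert (0 < Rpower (INR (S N)) h) by apply Rpower_pos. assert (0 < INR (fact N)) by apply INR_fact_lt_0.
    assert (0 < rising N (4 * h)) by (apply rising_pos; lra). assert (0 < rising N h) by (apply rising_pos; lra).
    field. repeat split; lra.
  - unfold gam_quot. replace (Finite (Gamma (1 + 4 * h) * Gamma (1 + h) ^ 16 / Gamma (1 + 2 * h) ^ 10)) with
     (Finite ((/ Gamma (1 + 2 * h)) ^ 10 * / (/ Gamma (1 + 4 * h) * (/ Gamma (1 + h)) ^ 16))).
    + apply is_lim_seq_mult'; [now apply is_lim_seq_pow|].
      apply (is_lim_seq_inv _ (Finite (/ Gamma (1 + 4 * h) * (/ Gamma (1 + h)) ^ 16))).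
      * apply is_lim_seq_mult'; [assumption|now apply is_lim_seq_pow].
      * assert (Hp : 0 < / Gamma (1 + 4 * h) * (/ Gamma (1 + h)) ^ 16)
          by (apply Rmult_lt_0_compat; [|apply pow_lt]; now apply Rinv_0_lt_compat).
        intros E. apply (f_equal real) in E. cbn [real] in E. rewrite E in Hp. exact (Rlt_irrefl 0 Hp).
    + f_equal. field. repeat split; lra.
Qed.

Definition germ (d : R) (f : R -> R) (e : fps) : Prop := forall h, Rabs h < d -> is_pseries e h (f h).

Lemma fmulc_sum n : forall a b : fps, fmulc n a b = sum_f_R0 (fun k => a k * b (n - k)%nat) n.
Proof.
  induction n as [|n IH]; intros a b; [simpl; ring|].
  cbn [fmulc]. rewrite (decomp_sum _ (S n)) by lia. rewrite IH. reflexivity.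
Qed.
Lemma fmul_PS (a b : fps) : (a * b)%F = PS_mult a b.
Proof. apply fps_ext; intros n. unfold fmul. rewrite fmulc_sum. reflexivity. Qed.

Lemma ex_pseries_radius (a : fps) x y : Rabs x < Rabs y -> ex_pseries a y -> Rbar_lt (Rabs x) (CV_radius a).
Proof.
  intros Hxy Hy. apply Rbar_lt_le_trans with (Finite (Rabs y)); [exact Hxy|].
  apply Rbar_not_lt_le. intros H. apply (CV_disk_outside a y H).
  apply ex_series_lim_0. apply ex_pseries_R. exact Hy.
Qed.

Lemma germ_ex d f e h : germ d f e -> Rabs h < d -> Rbar_lt (Rabs h) (CV_radius e).
Proof.
  intros H Hh. apply ex_pseries_radius with ((Rabs h + d) / 2).
  - rewrite (Rabs_pos_eq ((Rabs h + d) / 2)); pose proof (Rabs_pos h); lra.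
  - exists (f ((Rabs h + d) / 2)). apply H. rewrite Rabs_pos_eq; pose proof (Rabs_pos h); lra.
Qed.

Lemma germ_mul d f g a b : germ d f a -> germ d g b -> germ d (fun h => f h * g h) (a * b)%F.
Proof.
  intros Ha Hb h Hh. rewrite fmul_PS. apply is_pseries_mult; auto.
  - now apply (germ_ex d f).
  - now apply (germ_ex d g).
Qed.
Lemma germ_add d f g a b : germ d f a -> germ d g b -> germ d (fun h => f h + g h) (a + b)%F.
Proof. intros Ha Hb h Hh. apply (is_pseries_plus a b h (f h) (g h)); auto. Qed.
Lemma germ_opp d f a : germ d f a -> germ d (fun h => - f h) (- a)%F.
Proof. intros Ha h Hh. apply (is_pseries_opp a h (f h)); auto. Qed.
Lemma germ_sub d f g a b : germ d f a -> germ d g b -> germ d (fun h => f h - g h) (a - b)%F.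
Proof. intros Ha Hb. unfold fsub, Rminus. apply germ_add; [assumption|now apply germ_opp]. Qed.
Lemma germ_C d c : germ d (fun _ => c) (fC c).
Proof.
  intros h _. apply is_pseries_R. apply (filterlim_ext (fun _ => c)); [|apply filterlim_const].
  intros n. induction n as [|n IH]; [rewrite sum_O; simpl; ring|].
  rewrite sum_Sn, <- IH. unfold plus; simpl; ring.
Qed.
Lemma germ_X d : germ d (fun h => h) fX.
Proof.
  intros h _. replace fX with (PS_incr_1 (fC 1)).
  - replace h with (scal h 1) at 2 by (unfold scal; simpl; unfold mult; simpl; ring).
    apply (is_pseries_incr_1 (fC 1) h 1). apply (germ_C (Rabs h + 1) 1). lra.
  - apply fps_ext; intros [|[|n]]; reflexivity.
Qed.
Lemma germ_pow d f a n : germ d f a -> germ d (fun h => f h ^ n) (a ^ n)%F.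
Proof. intros H; induction n as [|n IH]; [apply germ_C|]. cbn [fpow pow]. now apply germ_mul. Qed.
Lemma germ_ext d f g e : (forall h, Rabs h < d -> f h = g h) -> germ d f e -> germ d g e.
Proof. intros E H h Hh. rewrite <- E by assumption. auto. Qed.
Lemma germ_le d d' f e : d' <= d -> germ d f e -> germ d' f e.
Proof. intros Hd H h Hh. apply H. lra. Qed.

Definition qprod_eval (l : list Z) (z h : R) : R := fold_right (fun c acc => (z + IZR c * h) * acc) 1 l.
Lemma germ_qprod d l z : germ d (qprod_eval l z) (qprod l (fC z)).
Proof.
  induction l as [|c l IH]; [apply germ_C|].
  change (qprod (c :: l) (fC z)) with (lin (fC z) c * qprod l (fC z))%F.
  apply (germ_mul d (fun h => z + IZR c * h) (qprod_eval l z)); [|exact IH].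
  unfold lin. apply germ_add; [apply germ_C|]. apply germ_mul; [apply germ_C|apply germ_X].
Qed.
Lemma qprod_eval_repeat c k z h : qprod_eval (repeat c k) z h = (z + IZR c * h) ^ k.
Proof. induction k as [|k IH]; [reflexivity|]. cbn [repeat pow]. rewrite <- IH. reflexivity. Qed.
Lemma germ_pfac_repeat d c k N : germ d (fun h => rising N (IZR c * h) ^ k) (pfac (repeat c k) N).
Proof.
  induction N as [|N IH].
  - apply (germ_ext d (fun _ => 1)); [intros; simpl; now rewrite pow1|apply germ_C].
  - cbn [pfac rising]. apply (germ_ext d (fun h => rising N (IZR c * h) ^ k * qprod_eval (repeat c k) (INR (S N)) h)).
    + intros h _. now rewrite qprod_eval_repeat, Rpow_mult_distr.
    + apply germ_mul; [exact IH|apply germ_qprod].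
Qed.

Lemma texp_ex (l : fps) C B h : 0 <= C -> 0 < B -> (forall k, Rabs (l (S k)) <= C * B ^ S k) ->
  Rabs h < / (B * (C + 1)) -> ex_pseries (texp l) h.
Proof.
  intros HC HB Hl Hh. set (K := B * (C + 1)). assert (HK : 0 < K) by (unfold K; apply Rmult_lt_0_compat; lra).
  assert (Hq : Rabs (K * Rabs h) < 1).
  { rewrite Rabs_pos_eq by (apply Rmult_le_pos; [lra|apply Rabs_pos]).
    apply Rmult_lt_reg_l with (/ K); [now apply Rinv_0_lt_compat|].
    rewrite <- Rmult_assoc, Rinv_l, Rmult_1_l, Rmult_1_r by lra. exact Hh. }
  apply ex_pseries_R. apply (ex_series_le (K := R_AbsRing) (V := R_CompleteNormedModule)) with (fun n => (K * Rabs h) ^ n).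
  - intros n. unfold norm; simpl; unfold abs; simpl. rewrite Rabs_mult, <- RPow_abs, Rpow_mult_distr.
    apply Rmult_le_compat_r; [apply pow_le, Rabs_pos|]. apply texp_geom; [assumption|lra|assumption].
  - eexists. now apply is_series_geom.
Qed.

(** Dominated convergence for power series with a common geometric
    majorant. *)
Lemma tannery (u : nat -> fps) (l : fps) K h : 0 <= K -> K * Rabs h < 1 ->
  (forall N n, Rabs (u N n) <= K ^ n) -> (forall n, Rabs (l n) <= K ^ n) -> flim u l ->
  is_lim_seq (fun N => PSeries (u N) h) (PSeries l h).
Proof.
  intros HK Hq Hu Hl HL. set (q := K * Rabs h) in *.
  assert (Hq0 : 0 <= q) by (apply Rmult_le_pos; [assumption|apply Rabs_pos]).
  assert (Hqa : Rabs q < 1) by (now rewrite Rabs_pos_eq).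
  assert (B : forall v : fps, (forall n, Rabs (v n) <= K ^ n) -> forall n, Rabs (v n * h ^ n) <= q ^ n).
  { intros v Hv n. unfold q. rewrite Rabs_mult, <- RPow_abs, Rpow_mult_distr.
    apply Rmult_le_compat_r; [apply pow_le, Rabs_pos|apply Hv]. }
  assert (G : ex_series (fun n => q ^ n)) by (eexists; now apply is_series_geom).
  assert (X : forall v : fps, (forall n, Rabs (v n) <= K ^ n) -> ex_series (fun n => v n * h ^ n)).
  { intros v Hv. apply (ex_series_le (K := R_AbsRing) (V := R_CompleteNormedModule)) with (fun n => q ^ n); [exact (B v Hv)|exact G]. }
  apply is_lim_seq_spec. intros eps.
  assert (Hm : exists m, (0 < m)%nat /\ 2 * (q ^ m * / (1 - q)) < eps / 2).
  { assert (L : is_lim_seq (fun m => 2 * (q ^ m * / (1 - q))) (2 * (0 * / (1 - q)))).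
    { apply (is_lim_seq_scal_l _ 2 (0 * / (1 - q))). apply (is_lim_seq_scal_r _ (/ (1 - q)) 0). now apply is_lim_seq_geom. }
    apply is_lim_seq_spec in L. destruct (L (pos_div_2 eps)) as [m Hm]. exists (S m). split; [lia|].
    specialize (Hm (S m) ltac:(lia)). rewrite Rmult_0_l, Rmult_0_r, Rminus_0_r in Hm. simpl pos in Hm.
    eapply Rle_lt_trans; [apply Rle_abs|exact Hm]. }
  destruct Hm as [m [Hm0 Hm]].
  set (d := fun N n => u N n * h ^ n - l n * h ^ n).
  assert (L : is_lim_seq (fun N => sum_f_R0 (d N) (pred m)) 0).
  { assert (L0 : forall k, is_lim_seq (fun N => sum_f_R0 (d N) k) 0).
    { assert (L1 : forall k, is_lim_seq (fun N => d N k) 0).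
      { intros k. unfold d. replace (Finite 0) with (Finite (l k * h ^ k - l k * h ^ k)) by (f_equal; ring).
        apply is_lim_seq_minus'; [|apply is_lim_seq_const].
        apply (is_lim_seq_scal_r _ (h ^ k) (l k)). apply HL. }
      induction k as [|k IH]; simpl; [apply L1|].
      replace (Finite 0) with (Finite (0 + 0)) by (f_equal; ring). now apply is_lim_seq_plus'. }
    apply L0. }
  apply is_lim_seq_spec in L. destruct (L (pos_div_2 eps)) as [N0 HN0]. exists N0. intros N harm.
  specialize (HN0 N harm). rewrite Rminus_0_r in HN0. simpl pos in HN0.
  unfold PSeries. rewrite <- Series_minus by (apply X; auto).
  change (Rabs (Series (d N)) < eps).
  assert (Bd : forall n, Rabs (d N n) <= 2 * q ^ n).
  { intros n. unfold d, Rminus. eapply Rle_trans; [apply Rabs_triang|]. rewrite Rabs_Ropp.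
    pose proof (B (u N) (Hu N) n). pose proof (B l Hl n). lra. }
  assert (G2 : ex_series (fun n => 2 * q ^ n)) by (apply (ex_series_scal 2 (fun n => q ^ n)); exact G).
  assert (Xd : ex_series (d N)).
  { apply (ex_series_le (K := R_AbsRing) (V := R_CompleteNormedModule)) with (fun n => 2 * q ^ n); [exact Bd|exact G2]. }
  rewrite (Series_incr_n (d N) m) by assumption.
  eapply Rle_lt_trans; [apply Rabs_triang|].
  assert (T : Rabs (Series (fun k => d N (m + k)%nat)) <= 2 * (q ^ m * / (1 - q))).
  { assert (G3 : ex_series (fun k => 2 * (q ^ m * q ^ k))).
    { apply (ex_series_scal 2 (fun k => q ^ m * q ^ k)). apply (ex_series_scal (q ^ m) (fun k => q ^ k)). exact G. }
    assert (Bk : forall k, Rabs (d N (m + k)%nat) <= 2 * (q ^ m * q ^ k)) by (intros k; rewrite <- pow_add; apply Bd).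
    eapply Rle_trans; [apply Series_Rabs|].
    - apply (ex_series_le (K := R_AbsRing) (V := R_CompleteNormedModule)) with (fun k => 2 * (q ^ m * q ^ k)); [|exact G3].
      intros k. unfold norm; simpl; unfold abs; simpl. rewrite Rabs_Rabsolu. apply Bk.
    - rewrite <- (Series_geom q Hqa), <- (Series_scal_l (q ^ m)), <- (Series_scal_l 2).
      apply Series_le; [|exact G3]. intros k; split; [apply Rabs_pos|apply Bk]. }
  lra.
Qed.

Definition fam0_wts : nat -> R := gam_wts (fam_num 0) (fam_den 0).
Lemma psum_repeat c k n : psum (repeat c n) k = INR n * IZR c ^ k.
Proof.
  induction n as [|n IH]; [simpl; ring|]. cbn [repeat].
  change (psum (c :: repeat c n) k) with (IZR c ^ k + psum (repeat c n) k). rewrite IH, S_INR. ring.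
Qed.
Lemma fam0_wts_eq k : fam0_wts k = 10 * 2 ^ k - 16 - 4 ^ k.
Proof. unfold fam0_wts, gam_wts, fam_num, fam_den. rewrite !psum_repeat, pow1. simpl INR. ring. Qed.
Lemma fam0_wts_bound k : Rabs (fam0_wts k) <= 27 * 4 ^ k.
Proof.
  rewrite fam0_wts_eq. assert (H2 : 0 < 2 ^ k <= 4 ^ k) by (split; [apply pow_lt; lra|apply pow_incr; lra]).
  assert (H1 : 1 <= 4 ^ k) by (apply pow_R1_Rle; lra). apply Rabs_le. lra.
Qed.
Lemma lam_bound x k : 0 <= x <= 2 -> Rabs (- (-1) ^ k * (fam0_wts k * x)) <= 54 * 4 ^ k.
Proof.
  intros Hx. rewrite !Rabs_mult, Rabs_Ropp, pow_1_abs, Rmult_1_l.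
  rewrite (Rabs_pos_eq x) by lra. pose proof (fam0_wts_bound k). pose proof (Rabs_pos (fam0_wts k)). nra.
Qed.
Lemma fam0_wts_1 : fam0_wts 1 = 0. Proof. rewrite fam0_wts_eq; simpl; ring. Qed.
Lemma lam_part_fam0_wts_bound N k : Rabs (lam_part fam0_wts N (S k)) <= 54 * 4 ^ S k.
Proof.
  destruct k as [|k]; unfold lam_part.
  - rewrite fam0_wts_1. replace (- (-1) ^ 1 * (0 * harm N 1)) with 0 by ring. rewrite Rabs_R0. simpl; lra.
  - apply lam_bound. split; [apply harm_pos|apply harm_bound; lia].
Qed.
Lemma lam_full_fam0_wts_bound k : Rabs (lam_full fam0_wts (S k)) <= 54 * 4 ^ S k.
Proof.
  destruct k as [|k]; unfold lam_full.
  - rewrite Rabs_R0. simpl; lra.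
  - apply lam_bound. apply zetak_bounds; lia.
Qed.

(** For finite N the series is a rational function, by comparison of
    logarithmic derivatives. *)
Lemma germ_lam_part N h : Rabs h < / 220 ->
  PSeries (texp (lam_part fam0_wts N)) h = rising N (2 * h) ^ 10 * INR (fact N) ^ 7 / (rising N (4 * h) * rising N h ^ 16).
Proof.
  intros Hh.
  assert (Hd : Rabs h < / (4 * (54 + 1))) by (replace (4 * (54 + 1)) with 220 by ring; assumption).
  assert (HU : germ (/ 220) (PSeries (texp (lam_part fam0_wts N))) (texp (lam_part fam0_wts N))).
  { intros y Hy. apply PSeries_correct. apply texp_ex with 54 4; [lra|lra|apply lam_part_fam0_wts_bound|].
    replace (4 * (54 + 1)) with 220 by ring. exact Hy. }
  assert (E : (texp (lam_part fam0_wts N) * (pfac [4%Z] N * pfac (repeat 1%Z 16) N) = fC (INR (fact N) ^ 7) * pfac (repeat 2%Z 10) N)%F).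
  { assert (El : lam_part fam0_wts N = (lam_part (psum (repeat 2%Z 10)) N + (- lam_part (psum [4%Z]) N + - lam_part (psum (repeat 1%Z 16)) N))%F).
    { apply fps_ext; intros [|k]; unfold lam_part, fadd, fopp; [ring|].
      change (fam0_wts (S k)) with (psum (repeat 2%Z 10) (S k) - psum (repeat 1%Z 16) (S k) - 4 ^ S k).
      replace (psum [4%Z] (S k)) with (4 ^ S k) by (unfold psum; cbn [fold_right]; ring). ring. }
    rewrite El, !texp_add by (unfold fadd, fopp; rewrite ?lam_part_0; ring). rewrite !pfac_texp, !repeat_length. cbn [length].
    set (F := INR (fact N)). rewrite <- !fC_pow.
    transitivity ((texp (lam_part (psum [4%Z]) N) * texp (- lam_part (psum [4%Z]) N)) * (texp (lam_part (psum (repeat 1%Z 16)) N) * texp (- lam_part (psum (repeat 1%Z 16)) N))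
      * (fC F ^ 17 * texp (lam_part (psum (repeat 2%Z 10)) N)))%F; [ring|].
    rewrite !texp_opp by reflexivity. ring. }
  assert (R1 := germ_mul _ _ _ _ _ HU (germ_mul _ _ _ _ _ (germ_pfac_repeat (/ 220) 4 1 N) (germ_pfac_repeat (/ 220) 1 16 N))).
  assert (R2 := germ_mul _ _ _ _ _ (germ_C (/ 220) (INR (fact N) ^ 7)) (germ_pfac_repeat (/ 220) 2 10 N)).
  change (repeat 4%Z 1) with [4%Z] in R1. rewrite E in R1.
  assert (EQ := eq_trans (eq_sym (is_pseries_unique _ _ _ (R1 h Hh))) (is_pseries_unique _ _ _ (R2 h Hh))).
  apply Rabs_def2 in Hh.
  assert (0 < rising N (4 * h)) by (apply rising_pos; lra). assert (0 < rising N h) by (apply rising_pos; lra).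
  simpl IZR in EQ. rewrite (Rmult_1_l h), pow_1 in EQ.
  apply Rmult_eq_reg_r with (rising N (4 * h) * rising N h ^ 16);
    [|apply Rgt_not_eq, Rmult_lt_0_compat; [assumption|now apply pow_lt]].
  rewrite EQ. field. split; lra.
Qed.

(** Both sides are limits of the same rational functions, by [gam_quot_lim]
    and by [tannery]. *)
Lemma germ_gam_quot : germ (/ 220) gam_quot (texp (lam_full fam0_wts)).
Proof.
  intros h Hh.
  assert (Hx : ex_pseries (texp (lam_full fam0_wts)) h).
  { apply texp_ex with 54 4; [lra|lra|apply lam_full_fam0_wts_bound|]. replace (4 * (54 + 1)) with 220 by ring. exact Hh. }
  replace (gam_quot h) with (PSeries (texp (lam_full fam0_wts)) h); [now apply PSeries_correct|].
  assert (L1 := gam_quot_lim h ltac:(lra)).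
  assert (L2 : is_lim_seq (fun N => PSeries (texp (lam_part fam0_wts N)) h) (PSeries (texp (lam_full fam0_wts)) h)).
  { apply tannery with 220; [lra|lra| | |].
    - intros N n. replace 220 with (4 * (54 + 1)) by ring. apply texp_geom; [lra|lra|apply lam_part_fam0_wts_bound].
    - intros n. replace 220 with (4 * (54 + 1)) by ring. apply texp_geom; [lra|lra|apply lam_full_fam0_wts_bound].
    - apply flim_texp, lam_part_lim, fam0_wts_1. }
  apply is_lim_seq_ext with (v := fun N => rising N (2 * h) ^ 10 * INR (fact N) ^ 7 / (rising N (4 * h) * rising N h ^ 16)) in L2.
  - apply is_lim_seq_unique in L1. apply is_lim_seq_unique in L2. rewrite L1 in L2. now injection L2.
  - intros N. now apply germ_lam_part.
Qed.

(** * Taylor coefficients of f6 *)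

(** All gamma values are reduced to the arguments 1 + 4h, 1 + h and 1 + 2h. *)
Lemma f6_gamma n h : Rabs h < / 4 ->
  f6 (INR (S n) + h) = P6 (INR (S n) + h) / 256 * gam_quot h *
    (rising (4 * n + 2) (4 * h) * rising n h ^ 16 / rising (2 * n + 1) (2 * h) ^ 10).
Proof.
  intros Hh. apply Rabs_def2 in Hh. unfold f6, gam_quot.
  replace (4 * (INR (S n) + h) - 1) with (INR (S (4 * n + 2)) + 4 * h)
    by (rewrite !S_INR, plus_INR, mult_INR; simpl; ring).
  replace (2 * (INR (S n) + h)) with (INR (S (2 * n + 1)) + 2 * h)
    by (rewrite !S_INR, plus_INR, mult_INR; simpl; ring).
  rewrite !Gamma_rising by lra. rewrite !Rpow_mult_distr.
  assert (0 < Gamma (1 + 2 * h)) by (apply Gamma_pos; lra).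
  assert (0 < rising (2 * n + 1) (2 * h)) by (apply rising_pos; lra).
  field. split; lra.
Qed.

Lemma harm_le_N N k : harm N k <= INR N.
Proof.
  induction N as [|N IH]; [simpl; lra|]. cbn [harm]. rewrite S_INR at 2.
  assert (1 <= INR (S N)) by (rewrite S_INR; pose proof (pos_INR N); lra).
  assert (/ INR (S N) ^ k <= 1); [|lra].
  rewrite <- Rinv_1. apply Rinv_le_contravar; [lra|]. now apply pow_R1_Rle.
Qed.

(** The second bound is the radius that [texp_geom] gives for the inverse of
    the product up to N, with the harmonic sums bounded by N. *)
Definition radius (N : nat) : R := Rmin (/ 220) (/ (2 * (10 * INR N + 1))).
Lemma radius_pos N : 0 < radius N.
Proof. unfold radius. apply Rmin_glb_lt; [lra|]. apply Rinv_0_lt_compat. pose proof (pos_INR N). lra. Qed.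

Lemma germ_Pinv2 N : germ (radius N) (fun h => / rising N (2 * h) ^ 10) (pfac_inv (repeat 2%Z 10) N).
Proof.
  set (l := (- lam_part (psum (repeat 2%Z 10)) N)%F).
  assert (Hex : forall h, Rabs h < radius N -> ex_pseries (pfac_inv (repeat 2%Z 10) N) h).
  { intros h Hh. rewrite pfac_inv_texp. fold l.
    assert (HU : germ (radius N) (PSeries (texp l)) (texp l)).
    { intros y Hy. apply PSeries_correct. pose proof (pos_INR N).
      apply texp_ex with (10 * INR N) 2; [lra|lra| |eapply Rlt_le_trans; [exact Hy|apply Rmin_r]].
      intros k. unfold l, fopp, lam_part. rewrite psum_repeat. replace (INR 10) with 10 by (simpl; ring).
      rewrite Rabs_Ropp, !Rabs_mult, Rabs_Ropp, pow_1_abs, Rmult_1_l.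
      rewrite (Rabs_pos_eq 10), (Rabs_pos_eq (2 ^ S k)), (Rabs_pos_eq (harm N (S k))) by (try apply harm_pos; try lra; apply pow_le; lra).
      pose proof (harm_le_N N (S k)). assert (0 < 2 ^ S k) by (apply pow_lt; lra). nra. }
    eexists. exact (germ_mul _ _ _ _ _ (germ_C (radius N) _) HU h Hh). }
  intros h Hh.
  assert (R1 : germ (radius N) (PSeries (pfac_inv (repeat 2%Z 10) N)) (pfac_inv (repeat 2%Z 10) N)).
  { intros y Hy. apply PSeries_correct. auto. }
  assert (R2 := germ_mul _ _ _ _ _ (germ_pfac_repeat (radius N) 2 10 N) R1). rewrite pfac_pfac_inv in R2.
  assert (E := eq_trans (eq_sym (is_pseries_unique _ _ _ (R2 h Hh))) (is_pseries_unique _ _ _ (germ_C (radius N) 1 h Hh))).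
  assert (Hh2 : Rabs h < / 220) by (eapply Rlt_le_trans; [exact Hh|apply Rmin_l]). apply Rabs_def2 in Hh2.
  assert (Hp : 0 < rising N (2 * h) ^ 10) by (apply pow_lt, rising_pos; lra).
  simpl IZR in E. cbv beta in E.
  replace (/ rising N (2 * h) ^ 10) with (PSeries (pfac_inv (repeat 2%Z 10) N) h); [now apply R1|].
  apply Rmult_eq_reg_l with (rising N (2 * h) ^ 10); [|now apply Rgt_not_eq]. rewrite Rinv_r by (now apply Rgt_not_eq). exact E.
Qed.

Lemma germ_family0 n : germ (radius (2 * n + 2)) (fun h => f6 (INR (S n) + h)) (family 0 n).
Proof.
  set (d := radius (2 * n + 2)). assert (Hd : d <= / 220) by apply Rmin_l.
  apply (germ_ext d (fun h => gam_quot h * (rising (4 * n + 1) (4 * h) ^ 1 * rising n (1 * h) ^ 16 * / rising (2 * n + 2) (2 * h) ^ 10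
    * (2 * (INR (S (2 * n)) + 2 * h)) * (4 * (INR (S n) + h) ^ 10 *
       (5460 * (INR (S n) + h) ^ 4 - 8341 * (INR (S n) + h) ^ 3 + 4864 * (INR (S n) + h) ^ 2 - 1280 * (INR (S n) + h) + 128))))).
  - intros h Hh. assert (Hh2 : Rabs h < / 220) by lra. rewrite f6_gamma by lra. apply Rabs_def2 in Hh2.
    replace (4 * n + 2)%nat with (S (4 * n + 1)) by lia. replace (2 * n + 2)%nat with (S (2 * n + 1)) by lia. cbn [rising].
    replace (INR (S (4 * n + 1)) + 4 * h) with (2 * (INR (S (2 * n)) + 2 * h))
      by (rewrite !S_INR, plus_INR, !mult_INR; simpl; ring).
    replace (INR (S (2 * n + 1)) + 2 * h) with (2 * (INR (S n) + h))
      by (rewrite !S_INR, plus_INR, !mult_INR; simpl; ring).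
    unfold P6. rewrite (Rmult_1_l h), pow_1.
    assert (0 < rising (2 * n + 1) (2 * h)) by (apply rising_pos; lra).
    assert (0 < INR (S n) + h) by (rewrite S_INR; pose proof (pos_INR n); lra).
    field. split; lra.
  - unfold family.
    apply germ_mul; [apply (germ_le (/ 220)); [assumption|exact germ_gam_quot]|].
    apply germ_mul.
    + apply germ_mul; [apply germ_mul; [apply germ_mul|]|].
      * exact (germ_pfac_repeat d 4 1 _).
      * exact (germ_pfac_repeat d 1 16 _).
      * apply germ_Pinv2.
      * apply germ_mul; [apply germ_C|]. unfold svar. apply germ_add; [apply germ_C|]. apply germ_mul; [apply germ_C|apply germ_X].
    + assert (Hx : germ d (fun h => INR (S n) + h) (mvar n + fX)%F) by (apply germ_add; [apply germ_C|apply germ_X]).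
      unfold fam_poly, P6_series. apply germ_mul; [apply germ_mul; [apply germ_C|now apply germ_pow]|].
      apply germ_add; [apply germ_sub; [apply germ_add; [apply germ_sub|]|]|apply germ_C];
        (apply germ_mul; [apply germ_C|first [now apply germ_pow | exact Hx]]).
Qed.

Lemma Derive_n_germ d f e x r : 0 < d -> germ d (fun h => f (x + h)) e -> Derive_n f r x = INR (fact r) * e r.
Proof.
  intros Hd H.
  replace (Derive_n f r x) with (Derive_n f r (0 + x)) by (f_equal; ring).
  rewrite <- (Derive_n_comp_trans f r 0 x).
  rewrite (Derive_n_ext_loc _ (PSeries e)).
  - rewrite Derive_n_coef; [ring|]. replace (Finite 0) with (Finite (Rabs 0)) by (now rewrite Rabs_R0).
    apply (germ_ex d (fun h => f (x + h))); [assumption|now rewrite Rabs_R0].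
  - exists (mkposreal d Hd). intros y Hy. change (Rabs (y - 0) < d) in Hy. rewrite Rminus_0_r in Hy.
    symmetry. rewrite (Rplus_comm y x). apply is_pseries_unique. now apply H.
Qed.

Lemma derivative_sum r : (r <= 7)%nat ->
  is_series (fun n => Derive_n f6 r (INR (S n))) (INR (fact r) * sum_coef r).
Proof.
  intros Hr. apply is_series_ext with (fun n => scal (INR (fact r)) (family 0 n r)).
  - intros n. symmetry. exact (Derive_n_germ _ f6 _ _ r (radius_pos _) (germ_family0 n)).
  - apply (is_series_scal (INR (fact r)) _ (sum_coef r)). now apply family_sum.
Qed.

(** * The sine product and the even zeta values *)

Definition cos_int (M : nat) (z : R) : R := RInt (fun t => cos (z * t) * cos t ^ (2 * M)) 0 (PI / 2).

Lemma cos_int_cont M z t : continuous (fun t => cos (z * t) * cos t ^ (2 * M)) t.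
Proof. apply (ex_derive_continuous (V := R_NormedModule)). auto_derive. trivial. Qed.
Lemma cos_int_is M z : is_RInt (fun t => cos (z * t) * cos t ^ (2 * M)) 0 (PI / 2) (cos_int M z).
Proof.
  apply (RInt_correct (V := R_CompleteNormedModule)). apply (ex_RInt_continuous (V := R_CompleteNormedModule)).
  intros t _. apply cos_int_cont.
Qed.

(** The function G in the proof is a primitive of the difference of the two
    integrands and vanishes at both ends. *)
Lemma cos_int_rec M z : ((2 * INR (S M)) ^ 2 - z ^ 2) * cos_int (S M) z = 2 * INR (S M) * (2 * INR (S M) - 1) * cos_int M z.
Proof.
  set (n := 2 * INR (S M)).
  set (G := fun t => n * cos (z * t) * cos t ^ (2 * M + 1) * sin t - z * sin (z * t) * cos t ^ (2 * M + 2)).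
  assert (H1 : is_RInt (fun t => (n ^ 2 - z ^ 2) * (cos (z * t) * cos t ^ (2 * S M)) - n * (n - 1) * (cos (z * t) * cos t ^ (2 * M)))
     0 (PI / 2) (G (PI / 2) - G 0)).
  { apply (is_RInt_derive G).
    - intros t _. unfold G. auto_derive; [trivial|].
      replace (2 * S M)%nat with (S (S (2 * M))) by lia. replace (M + (M + 0) + 1)%nat with (S (2 * M)) by lia.
      replace (M + (M + 0) + 2)%nat with (S (S (2 * M))) by lia.
      assert (E1 : INR (S (2 * M)) = n - 1) by (unfold n; rewrite !S_INR, mult_INR; simpl; ring).
      assert (E2 : INR (S (S (2 * M))) = n) by (unfold n; rewrite !S_INR, mult_INR; simpl; ring).
      rewrite ?E1, ?E2. cbn [Nat.pred pow].
      assert (Es : sin t * sin t = 1 - cos t * cos t) by (pose proof (sin2_cos2 t); unfold Rsqr in *; lra).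
      set (C := cos t ^ (2 * M)). set (s := sin t) in *. set (c := cos t) in *. set (u := cos (z * t)). set (v := sin (z * t)).
      transitivity (- (n * (n - 1)) * u * C * (s * s) + (n - z ^ 2) * (u * (c * (c * C)))); [|rewrite Es]; ring.
    - intros t _. apply (ex_derive_continuous (V := R_NormedModule)). auto_derive. trivial. }
  assert (H2 : is_RInt (fun t => minus (scal (n ^ 2 - z ^ 2) (cos (z * t) * cos t ^ (2 * S M))) (scal (n * (n - 1)) (cos (z * t) * cos t ^ (2 * M))))
     0 (PI / 2) (minus (scal (n ^ 2 - z ^ 2) (cos_int (S M) z)) (scal (n * (n - 1)) (cos_int M z)))).
  { apply (is_RInt_minus (V := R_NormedModule)); apply (is_RInt_scal (V := R_NormedModule)); apply cos_int_is. }
  assert (E := eq_trans (eq_sym (is_RInt_unique _ _ _ _ H1)) (is_RInt_unique _ _ _ _ H2)).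
  assert (G0 : G 0 = 0) by (unfold G; rewrite Rmult_0_r, sin_0; ring).
  assert (G1 : G (PI / 2) = 0).
  { unfold G. rewrite cos_PI2, !pow_i by lia. ring. }
  rewrite G0, G1 in E. unfold minus, plus, opp, scal in E; simpl in E. unfold mult in E; simpl in E. lra.
Qed.

Lemma cos_int_pos M : 0 < cos_int M 0.
Proof.
  induction M as [|M IH].
  - unfold cos_int. rewrite (RInt_ext _ (fun _ => 1)).
    + rewrite RInt_const. unfold scal; simpl; unfold mult; simpl. pose proof PI_RGT_0. lra.
    + intros t _. simpl. rewrite Rmult_0_l, cos_0. ring.
  - assert (H := cos_int_rec M 0). assert (1 <= INR (S M)) by (rewrite S_INR; pose proof (pos_INR M); lra).
    set (x := INR (S M)) in *.
    assert (0 < 2 * x * (2 * x - 1) * cos_int M 0) by (repeat apply Rmult_lt_0_compat; lra).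
    apply Rmult_lt_reg_l with ((2 * x) ^ 2 - 0 ^ 2); [|lra].
    replace ((2 * x) ^ 2 - 0 ^ 2) with ((2 * x) * (2 * x)) by ring. apply Rmult_lt_0_compat; lra.
Qed.

Lemma cos_int_0 z : z <> 0 -> cos_int 0 z = sin (z * (PI / 2)) / z.
Proof.
  intros Hz. unfold cos_int.
  assert (H : is_RInt (fun t => cos (z * t) * cos t ^ (2 * 0)) 0 (PI / 2) (sin (z * (PI / 2)) / z - sin (z * 0) / z)).
  { apply (is_RInt_derive (fun t => sin (z * t) / z)).
    - intros t _. auto_derive; [trivial|]. simpl. field. assumption.
    - intros t _. apply (cos_int_cont 0). }
  rewrite (is_RInt_unique _ _ _ _ H), Rmult_0_r, sin_0. field. assumption.
Qed.

(** The derivative of sin t - t cos t is t sin t. *)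
Lemma tcos_le_sin t : 0 <= t <= PI / 2 -> 0 <= t * cos t <= sin t.
Proof.
  intros Ht. assert (HP := PI_RGT_0). split.
  - apply Rmult_le_pos; [lra|]. apply cos_ge_0; lra.
  - destruct (Req_dec t 0) as [->|H0]; [rewrite sin_0; lra|].
    destruct (MVT_gen (fun t => sin t - t * cos t) 0 t (fun t => t * sin t)) as [c [Hc E]].
    + intros x _. auto_derive; [trivial|ring].
    + intros x _. apply continuity_pt_filterlim. change (continuous (fun t => sin t - t * cos t) x). apply (ex_derive_continuous (V := R_NormedModule)). auto_derive. trivial.
    + rewrite Rmin_left, Rmax_right in Hc by lra. rewrite sin_0 in E.
      assert (0 <= sin c) by (apply sin_ge_0; lra).
      assert (0 <= c * sin c * (t - 0)) by (repeat apply Rmult_le_pos; lra). lra.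
Qed.

Lemma one_minus_cos y : 0 <= 1 - cos y <= y ^ 2 / 2.
Proof.
  split; [pose proof (COS_bound y); lra|].
  replace (cos y) with (1 - 2 * sin (y / 2) * sin (y / 2)).
  - assert (A : Rabs (sin (y / 2)) <= Rabs (y / 2)).
    { assert (P : forall x, 0 <= x -> Rabs (sin x) <= x).
      { intros x Hx. destruct (Req_dec x 0) as [->|Hx0]; [rewrite sin_0, Rabs_R0; lra|].
        apply Rabs_le. split.
        - destruct (Rle_dec x 1) as [H1|H1].
          + assert (0 <= sin x) by (apply sin_ge_0; pose proof PI_4; pose proof PI2_3_2; pose proof PI2_1; lra). lra.
          + pose proof (SIN_bound x). lra.
        - left. apply sin_lt_x. lra. }
      destruct (Rle_dec 0 (y / 2)) as [H|H]; [rewrite (Rabs_pos_eq (y / 2)) by assumption; auto|].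
      rewrite (Rabs_left (y / 2)) by lra. rewrite <- Rabs_Ropp, <- sin_neg. apply P. lra. }
    assert (Q : sin (y / 2) * sin (y / 2) <= (y / 2) * (y / 2)).
    { apply Rsqr_le_abs_1 in A. exact A. }
    lra.
  - replace (cos y) with (cos (2 * (y / 2))) by (f_equal; field). rewrite cos_2a_sin. ring.
Qed.

(** By [tcos_le_sin], t^2 cos^(2M+2) is at most sin^2 cos^(2M), whose integral
    is a difference of consecutive values at z = 0. *)
Lemma cos_int_close M z : 0 <= cos_int (S M) 0 - cos_int (S M) z <= z ^ 2 / 2 * (cos_int M 0 - cos_int (S M) 0).
Proof.
  assert (HP := PI_RGT_0).
  assert (H1 : is_RInt (fun t => cos (0 * t) * cos t ^ (2 * S M) - cos (z * t) * cos t ^ (2 * S M)) 0 (PI / 2) (cos_int (S M) 0 - cos_int (S M) z))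
    by exact (is_RInt_minus (V := R_NormedModule) _ _ _ _ _ _ (cos_int_is (S M) 0) (cos_int_is (S M) z)).
  assert (H2 : is_RInt (fun t => z ^ 2 / 2 * (cos (0 * t) * cos t ^ (2 * M) - cos (0 * t) * cos t ^ (2 * S M))) 0 (PI / 2)
      (z ^ 2 / 2 * (cos_int M 0 - cos_int (S M) 0)))
    by exact (is_RInt_scal (V := R_NormedModule) _ _ _ (z ^ 2 / 2) _ (is_RInt_minus (V := R_NormedModule) _ _ _ _ _ _ (cos_int_is M 0) (cos_int_is (S M) 0))).
  assert (H0 : is_RInt (fun _ => 0) 0 (PI / 2) ((PI / 2 - 0) * 0)) by exact (is_RInt_const (V := R_NormedModule) 0 (PI / 2) 0).
  assert (B : forall t, 0 < t < PI / 2 -> 0 <= t * cos t <= sin t /\ 0 <= cos t ^ (2 * M)).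
  { intros t Ht. split; [apply tcos_le_sin; lra|]. rewrite pow_mult. apply pow_le, pow2_ge_0. }
  split.
  - rewrite Rmult_0_r in H0.
    refine (is_RInt_le _ _ 0 (PI / 2) _ _ _ H0 H1 _); [lra|].
    intros t Ht. rewrite Rmult_0_l, cos_0.
    pose proof (one_minus_cos (z * t)).
    assert (0 <= cos t ^ (2 * S M)) by (rewrite pow_mult; apply pow_le, pow2_ge_0). nra.
  - refine (is_RInt_le _ _ 0 (PI / 2) _ _ _ H1 H2 _); [lra|].
    intros t Ht. destruct (B t Ht) as [[B0 B1] B2]. rewrite Rmult_0_l, cos_0.
    replace (2 * S M)%nat with (S (S (2 * M))) by lia.
    replace (cos t ^ S (S (2 * M))) with (cos t * cos t * cos t ^ (2 * M)) by (simpl; ring).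
    set (C := cos t ^ (2 * M)) in *. set (c := cos t) in *.
    assert (Es : sin t * sin t = 1 - c * c) by (pose proof (sin2_cos2 t); unfold Rsqr in *; unfold c; lra).
    pose proof (one_minus_cos (z * t)) as [O1 O2].
    apply Rle_trans with ((z * t) ^ 2 / 2 * (c * c * C)).
    + replace (1 * (c * c * C) - cos (z * t) * (c * c * C)) with ((1 - cos (z * t)) * (c * c * C)) by ring.
      apply Rmult_le_compat_r; [|assumption]. apply Rmult_le_pos; [apply Rle_0_sqr|assumption].
    + replace ((z * t) ^ 2 / 2 * (c * c * C)) with (z ^ 2 / 2 * ((t * c) * (t * c) * C)) by field.
      replace (1 * C - 1 * (c * c * C)) with (sin t * sin t * C) by (rewrite Es; ring).
      apply Rmult_le_compat_l; [pose proof (pow2_ge_0 z); lra|]. apply Rmult_le_compat_r; [assumption|].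
      apply Rmult_le_compat; lra.
Qed.

Lemma cos_int_ratio_lim z : is_lim_seq (fun M => cos_int M z / cos_int M 0) 1.
Proof.
  apply is_lim_seq_incr_1. apply is_lim_seq_le_le with (fun M => 1 - z ^ 2 / 2 * / INR (S M)) (fun _ => 1).
  - intros M. pose proof (cos_int_pos (S M)) as P. pose proof (cos_int_pos M) as P0. destruct (cos_int_close M z) as [H1 H2].
    pose proof (cos_int_rec M 0) as R. assert (Hx : 1 <= INR (S M)) by (rewrite S_INR; pose proof (pos_INR M); lra).
    set (x := INR (S M)) in *.
    assert (E : cos_int M 0 - cos_int (S M) 0 = cos_int (S M) 0 * / (2 * x - 1)).
    { apply Rmult_eq_reg_l with (2 * x * (2 * x - 1)); [|apply Rgt_not_eq, Rmult_lt_0_compat; lra].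
      rewrite Rmult_minus_distr_l, <- R. field. lra. }
    rewrite E in H2. assert (Hz : 0 <= z ^ 2 / 2) by (pose proof (pow2_ge_0 z); lra).
    assert (Hi : / (2 * x - 1) <= / x) by (apply Rinv_le_contravar; lra).
    split; apply Rmult_le_reg_r with (cos_int (S M) 0); try assumption.
    + replace (cos_int (S M) z / cos_int (S M) 0 * cos_int (S M) 0) with (cos_int (S M) z) by (field; lra).
      assert (z ^ 2 / 2 * (cos_int (S M) 0 * / (2 * x - 1)) <= z ^ 2 / 2 * (cos_int (S M) 0 * / x)).
      { apply Rmult_le_compat_l; [assumption|]. apply Rmult_le_compat_l; lra. }
      lra.
    + replace (cos_int (S M) z / cos_int (S M) 0 * cos_int (S M) 0) with (cos_int (S M) z) by (field; lra). lra.
  - replace (Finite 1) with (Finite (1 - z ^ 2 / 2 * 0)) by (f_equal; ring).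
    apply is_lim_seq_minus'; [apply is_lim_seq_const|]. apply (is_lim_seq_scal_l _ (z ^ 2 / 2) 0).
    replace (Finite 0) with (Rbar_inv p_infty) by reflexivity.
    apply is_lim_seq_inv; [|discriminate]. apply -> is_lim_seq_incr_1. apply is_lim_seq_INR.
  - apply is_lim_seq_const.
Qed.

Fixpoint sinprod (M : nat) (a : R) : R :=
  match M with O => 1 | S m => sinprod m a * (1 - a ^ 2 / INR (S m) ^ 2) end.

Lemma sinprod_cos_int M a : a <> 0 -> cos_int M (2 * a) * sinprod M a * (PI * a) = sin (PI * a) * cos_int M 0.
Proof.
  intros Ha. induction M as [|M IH].
  - assert (E0 : cos_int 0 0 = PI / 2).
    { unfold cos_int. rewrite (RInt_ext _ (fun _ => 1)).
      - rewrite RInt_const. unfold scal; simpl; unfold mult; simpl. ring.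
      - intros t _. simpl. rewrite Rmult_0_l, cos_0. ring. }
    rewrite E0, cos_int_0 by lra. simpl. replace (2 * a * (PI / 2)) with (PI * a) by field. field. assumption.
  - cbn [sinprod]. pose proof (cos_int_rec M (2 * a)) as R1. pose proof (cos_int_rec M 0) as R0.
    assert (Hx : 1 <= INR (S M)) by (rewrite S_INR; pose proof (pos_INR M); lra). set (x := INR (S M)) in *.
    apply Rmult_eq_reg_l with (4 * x ^ 2); [|apply Rgt_not_eq; pose proof (pow_lt x 2); lra].
    transitivity (((2 * x) ^ 2 - (2 * a) ^ 2) * cos_int (S M) (2 * a) * sinprod M a * (PI * a)); [field; lra|].
    rewrite R1. transitivity (sin (PI * a) * (((2 * x) ^ 2 - 0 ^ 2) * cos_int (S M) 0)); [|ring].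
    rewrite R0. transitivity (2 * x * (2 * x - 1) * (cos_int M (2 * a) * sinprod M a * (PI * a))); [ring|]. rewrite IH. ring.
Qed.

Definition sin_wts : nat -> R := psum [1; -1]%Z.

Lemma sin_wts_bound k x : 0 <= x <= 2 -> Rabs (- (-1) ^ k * (sin_wts k * x)) <= 4 * 1 ^ k.
Proof.
  intros Hx. rewrite !Rabs_mult, Rabs_Ropp, pow_1_abs, Rmult_1_l, pow1, (Rabs_pos_eq x) by lra.
  assert (Rabs (sin_wts k) <= 2).
  { unfold sin_wts, psum; cbn [fold_right]. rewrite pow1, Rplus_0_r.
    eapply Rle_trans; [apply Rabs_triang|]. rewrite pow_1_abs, Rabs_R1. lra. }
  pose proof (Rabs_pos (sin_wts k)). nra.
Qed.
Lemma sin_wts_1 : sin_wts 1 = 0. Proof. unfold sin_wts, psum; simpl; ring. Qed.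
Lemma lam_part_sin_wts_bound N k : Rabs (lam_part sin_wts N (S k)) <= 4 * 1 ^ S k.
Proof.
  destruct k as [|k]; unfold lam_part.
  - rewrite sin_wts_1. replace (- (-1) ^ 1 * (0 * harm N 1)) with 0 by ring. rewrite Rabs_R0. simpl; lra.
  - apply sin_wts_bound. split; [apply harm_pos|apply harm_bound; lia].
Qed.
Lemma lam_full_sin_wts_bound k : Rabs (lam_full sin_wts (S k)) <= 4 * 1 ^ S k.
Proof.
  destruct k as [|k]; unfold lam_full.
  - rewrite Rabs_R0. simpl; lra.
  - apply sin_wts_bound. apply zetak_bounds; lia.
Qed.

Lemma sinprod_pfac M h : qprod_eval [1; -1]%Z (INR (S M)) h = INR (S M) ^ 2 * (1 - h ^ 2 / INR (S M) ^ 2).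
Proof. unfold qprod_eval; cbn [fold_right]. field. apply INR_S_neq. Qed.

Lemma PSeries_sinprod M h : PSeries (texp (lam_part sin_wts M)) h = sinprod M h.
Proof.
  assert (R1 : germ (Rabs h + 1) (fun h => / INR (fact M) ^ 2 * (INR (fact M) ^ 2 * sinprod M h)) (fC (/ INR (fact M) ^ 2) * pfac [1; -1]%Z M)%F).
  { apply germ_mul; [apply germ_C|]. induction M as [|M IH].
    - apply (germ_ext _ (fun _ => 1)); [intros; simpl; ring|apply germ_C].
    - cbn [pfac sinprod]. apply (germ_ext _ (fun h => INR (fact M) ^ 2 * sinprod M h * qprod_eval [1; -1]%Z (INR (S M)) h)).
      + intros y _. rewrite sinprod_pfac, fact_simpl, mult_INR. ring.
      + apply germ_mul; [exact IH|apply germ_qprod]. }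
  specialize (R1 h ltac:(lra)). rewrite pfac_texp in R1. cbn [length] in R1. fold sin_wts in R1.
  assert (E : (fC (/ INR (fact M) ^ 2) * (fC (INR (fact M) ^ 2) * texp (lam_part sin_wts M)))%F = texp (lam_part sin_wts M)).
  { transitivity ((fC (INR (fact M) ^ 2) * fC (/ INR (fact M) ^ 2)) * texp (lam_part sin_wts M))%F; [ring|].
    rewrite fC_inv by (apply pow_nonzero, INR_fact_neq_0). ring. }
  rewrite E in R1. rewrite (is_pseries_unique _ _ _ R1). field. apply INR_fact_neq_0.
Qed.

(** [cos_int M (2h)] is a multiple of sin (PI h) divided by the partial
    product, and its ratio to [cos_int M 0] tends to 1. *)
Lemma sine_product h : Rabs h < / 5 -> PI * h * PSeries (texp (lam_full sin_wts)) h = sin (PI * h).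
Proof.
  intros Hh. destruct (Req_dec h 0) as [->|H0]; [rewrite Rmult_0_r, sin_0; ring|].
  assert (L : is_lim_seq (fun M => PSeries (texp (lam_part sin_wts M)) h) (PSeries (texp (lam_full sin_wts)) h)).
  { apply tannery with 5; [lra|lra| | |].
    - intros N n. replace 5 with (1 * (4 + 1)) by ring. apply texp_geom; [lra|lra|apply lam_part_sin_wts_bound].
    - intros n. replace 5 with (1 * (4 + 1)) by ring. apply texp_geom; [lra|lra|apply lam_full_sin_wts_bound].
    - apply flim_texp, lam_part_lim, sin_wts_1. }
  assert (L2 : is_lim_seq (fun M => cos_int M (2 * h) / cos_int M 0 * (PI * h * PSeries (texp (lam_part sin_wts M)) h))
      (1 * (PI * h * PSeries (texp (lam_full sin_wts)) h))).
  { apply is_lim_seq_mult'; [apply cos_int_ratio_lim|]. now apply (is_lim_seq_scal_l _ (PI * h) (PSeries (texp (lam_full sin_wts)) h)). }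
  apply is_lim_seq_ext with (v := fun _ => sin (PI * h)) in L2.
  - apply is_lim_seq_unique in L2. rewrite Lim_seq_const in L2. injection L2 as L2. lra.
  - intros M. rewrite PSeries_sinprod. pose proof (cos_int_pos M).
    apply Rmult_eq_reg_r with (cos_int M 0); [|lra]. rewrite <- sinprod_cos_int by assumption. field. lra.
Qed.

Lemma germ_sine : germ (/ 5) (fun h => sin (PI * (0 + h))) (fC PI * fX * texp (lam_full sin_wts))%F.
Proof.
  apply (germ_ext _ (fun h => PI * h * PSeries (texp (lam_full sin_wts)) h)).
  - intros h Hh. rewrite Rplus_0_l. now apply sine_product.
  - apply germ_mul; [apply germ_mul; [apply germ_C|apply germ_X]|].
    intros y Hy. apply PSeries_correct. apply texp_ex with 4 1; [lra|lra|apply lam_full_sin_wts_bound|].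
    replace (1 * (4 + 1)) with 5 by ring. exact Hy.
Qed.

Lemma Derive_n_sine k : forall x, Derive_n (fun x => sin (PI * x)) (2 * k + 1) x = (-1) ^ k * PI ^ (2 * k + 1) * cos (PI * x).
Proof.
  induction k as [|k IH]; intros x.
  - simpl. apply is_derive_unique. auto_derive; [trivial|ring].
  - replace (2 * S k + 1)%nat with (S (S (2 * k + 1))) by lia. cbn [Derive_n].
    rewrite (Derive_ext _ (fun x => (-1) ^ k * PI ^ (2 * k + 1) * (- PI * sin (PI * x)))).
    + replace ((-1) ^ S k * PI ^ S (S (2 * k + 1)) * cos (PI * x)) with ((-1) ^ k * PI ^ (2 * k + 1) * (- PI * (PI * cos (PI * x))))
        by (cbn [pow]; ring).
      generalize ((-1) ^ k * PI ^ (2 * k + 1)). intros A. apply is_derive_unique. auto_derive; [trivial|ring].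
    + intros t. rewrite (Derive_ext _ (fun x => (-1) ^ k * PI ^ (2 * k + 1) * cos (PI * x))) by (intros; apply IH).
      generalize ((-1) ^ k * PI ^ (2 * k + 1)). intros A. apply is_derive_unique. auto_derive; [trivial|ring].
Qed.

(** Compare the Taylor coefficients of sin (PI x) with those of its
    product. *)
Lemma texp_sin_wts k : INR (fact (2 * k + 1)) * texp (lam_full sin_wts) (2 * k)%nat = (-1) ^ k * PI ^ (2 * k).
Proof.
  assert (E := Derive_n_germ (/ 5) (fun x => sin (PI * x)) _ 0 (2 * k + 1) ltac:(lra) germ_sine).
  rewrite Derive_n_sine, Rmult_0_r, cos_0, Rmult_1_r in E.
  replace (fC PI * fX * texp (lam_full sin_wts))%F with (fC PI * (fX * texp (lam_full sin_wts)))%F in E by ring.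
  replace (2 * k + 1)%nat with (S (2 * k)) in * by lia. rewrite fC_mul_n, fX_mul_S in E.
  pose proof PI_RGT_0. apply Rmult_eq_reg_l with PI; [|lra].
  transitivity (INR (fact (S (2 * k))) * (PI * texp (lam_full sin_wts) (2 * k)%nat)); [ring|]. rewrite <- E. cbn [pow]. ring.
Qed.

(** The coefficients of [texp l] up to 11 when l_1 = 0: the sum over the
    partitions of n into parts k >= 2 of the products of (l_k / k)^m / m!,
    where m is the multiplicity of k. *)
Definition texp_low (l : fps) : list R :=
  [1;
   0;
   l 2%nat / 2;
   l 3%nat / 3;
   l 4%nat / 4 + l 2%nat^2 / 8;
   l 5%nat / 5 + l 2%nat*l 3%nat / 6;
   l 6%nat / 6 + l 2%nat*l 4%nat / 8 + l 3%nat^2 / 18 + l 2%nat^3 / 48;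
   l 7%nat / 7 + l 2%nat*l 5%nat / 10 + l 3%nat*l 4%nat / 12 + l 2%nat^2*l 3%nat / 24;
   l 8%nat / 8 + l 2%nat*l 6%nat / 12 + l 3%nat*l 5%nat / 15 + l 4%nat^2 / 32 + l 2%nat^2*l 4%nat / 32 + l 2%nat*l 3%nat^2 / 36 + l 2%nat^4 / 384;
   l 9%nat / 9 + l 2%nat*l 7%nat / 14 + l 3%nat*l 6%nat / 18 + l 4%nat*l 5%nat / 20 + l 2%nat^2*l 5%nat / 40 + l 2%nat*l 3%nat*l 4%nat / 24 + l 3%nat^3 / 162 + l 2%nat^3*l 3%nat / 144;
   l 10%nat / 10 + l 2%nat*l 8%nat / 16 + l 3%nat*l 7%nat / 21 + l 4%nat*l 6%nat / 24 + l 2%nat^2*l 6%nat / 48 + l 5%nat^2 / 50 + l 2%nat*l 3%nat*l 5%nat / 30 + l 2%nat*l 4%nat^2 / 64 + l 3%nat^2*l 4%nat / 72 + l 2%nat^3*l 4%nat / 192 + l 2%nat^2*l 3%nat^2 / 144 + l 2%nat^5 / 3840;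
   l 11%nat / 11 + l 2%nat*l 9%nat / 18 + l 3%nat*l 8%nat / 24 + l 4%nat*l 7%nat / 28 + l 2%nat^2*l 7%nat / 56 + l 5%nat*l 6%nat / 30 + l 2%nat*l 3%nat*l 6%nat / 36 + l 2%nat*l 4%nat*l 5%nat / 40 + l 3%nat^2*l 5%nat / 90 + l 2%nat^3*l 5%nat / 240 + l 3%nat*l 4%nat^2 / 96 + l 2%nat^2*l 3%nat*l 4%nat / 96 + l 2%nat*l 3%nat^3 / 324 + l 2%nat^4*l 3%nat / 1152].

Lemma texp_low_coef (l : fps) n : l 1%nat = 0 -> (n <= 11)%nat -> texp l n = nth n (texp_low l) 0.
Proof.
  intros L1 Hn. enough (H : forall m k, (k <= m)%nat -> (m <= 11)%nat -> texp l k = nth k (texp_low l) 0) by (apply (H n); lia).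
  induction m as [|m IH]; intros k Hk Hm; [now replace k with O by lia|].
  destruct (Nat.eq_dec k (S m)) as [->|Hne]; [|apply IH; lia].
  rewrite texp_S, (fmulc_ext m _ _ (shift l) (fun k => nth k (texp_low l) 0));
    [|reflexivity|intros i Hi; apply IH; lia].
  do 11 (destruct m as [|m]; [unfold fmulc, shift, texp_low; cbn [nth]; rewrite L1; simpl INR; field|]). lia.
Qed.

(** The even zeta values are the successive unknowns of the expansion of the
    sine product. *)
Lemma zeta_even : zetak 2 = PI ^ 2 / 6 /\ zetak 4 = PI ^ 4 / 90 /\ zetak 6 = PI ^ 6 / 945 /\ zetak 8 = PI ^ 8 / 9450 /\ zetak 10 = PI ^ 10 / 93555.
Proof.
  assert (L1 : lam_full sin_wts 1%nat = 0) by reflexivity.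
  assert (Lo : forall k, lam_full sin_wts (2 * k + 3)%nat = 0).
  { intros k. replace (2 * k + 3)%nat with (S (S (2 * k + 1))) by lia. unfold lam_full, sin_wts, psum; cbn [fold_right].
    replace (S (S (2 * k + 1))) with (S (2 * (k + 1))) by lia. rewrite pow1, pow_1_odd. ring. }
  assert (Le : forall k, lam_full sin_wts (2 * k + 2)%nat = - 2 * zetak (2 * k + 2)).
  { intros k. replace (2 * k + 2)%nat with (S (S (2 * k))) by lia. unfold lam_full, sin_wts, psum; cbn [fold_right].
    replace (S (S (2 * k))) with (2 * (k + 1))%nat by lia. rewrite pow1, pow_1_even. ring. }
  assert (L3 : lam_full sin_wts 3%nat = 0) by exact (Lo 0%nat).
  assert (L5 : lam_full sin_wts 5%nat = 0) by exact (Lo 1%nat).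
  assert (L7 : lam_full sin_wts 7%nat = 0) by exact (Lo 2%nat).
  assert (L2 : lam_full sin_wts 2%nat = - 2 * zetak 2) by exact (Le 0%nat).
  assert (L4 : lam_full sin_wts 4%nat = - 2 * zetak 4) by exact (Le 1%nat).
  assert (L6 : lam_full sin_wts 6%nat = - 2 * zetak 6) by exact (Le 2%nat).
  assert (L8 : lam_full sin_wts 8%nat = - 2 * zetak 8) by exact (Le 3%nat).
  assert (L10 : lam_full sin_wts 10%nat = - 2 * zetak 10) by exact (Le 4%nat).
  assert (V2 : INR (fact 3) * texp (lam_full sin_wts) 2%nat = (-1) ^ 1 * PI ^ 2) by exact (texp_sin_wts 1).
  assert (V4 : INR (fact 5) * texp (lam_full sin_wts) 4%nat = (-1) ^ 2 * PI ^ 4) by exact (texp_sin_wts 2).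
  assert (V6 : INR (fact 7) * texp (lam_full sin_wts) 6%nat = (-1) ^ 3 * PI ^ 6) by exact (texp_sin_wts 3).
  assert (V8 : INR (fact 9) * texp (lam_full sin_wts) 8%nat = (-1) ^ 4 * PI ^ 8) by exact (texp_sin_wts 4).
  assert (V10 : INR (fact 11) * texp (lam_full sin_wts) 10%nat = (-1) ^ 5 * PI ^ 10) by exact (texp_sin_wts 5).
  clear Lo Le. revert V2 V4 V6 V8 V10. rewrite !(texp_low_coef (lam_full sin_wts)) by (exact L1 || lia). unfold texp_low; cbn [nth]. rewrite L2, L3, L4, L5, L6, L7, L8, L10.
  rewrite ?fact_simpl, ?mult_INR. simpl INR. intros V2 V4 V6 V8 V10.
  assert (Z2 : zetak 2 = PI ^ 2 / 6) by lra. rewrite Z2 in *.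
  assert (Z4 : zetak 4 = PI ^ 4 / 90) by lra. rewrite Z4 in *.
  assert (Z6 : zetak 6 = PI ^ 6 / 945) by lra. rewrite Z6 in *.
  assert (Z8 : zetak 8 = PI ^ 8 / 9450) by lra. rewrite Z8 in *.
  repeat split; lra.
Qed.

(** * The coefficients of the sum *)

Lemma zeta_nat k : zeta (INR k) = zetak k.
Proof.
  unfold zeta, zetak. apply Series_ext. intros n. rewrite Rpower_pow; [reflexivity|]. apply lt_0_INR; lia.
Qed.

Ltac lam_tac k := intros Hk;
  do 12 (destruct k as [|k]; [unfold lam_full, gam_wts, psum, num_wts, den_wts, shift2; simpl app; cbn [fold_right nth mus case2 case3 case4]; ring|]); lia.

Lemma lam_gam2 k : (k <= 11)%nat ->
  lam_full (gam_wts (num_wts case2) (den_wts case2)) k = IZR (nth k [0; 0; 8; 0; -16; 240; -1552; 8400; -40816; 186480; -818512; 3498000]%Z 0%Z) * zetak k.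
Proof. lam_tac k. Qed.
Lemma lam_gam4 k : (k <= 11)%nat ->
  lam_full (gam_wts (num_wts case4) (den_wts case4)) k = IZR (nth k [0; 0; 24; 0; 240; -720; 6864; -35280; 226320; -1224720; 6913104; -36772560]%Z 0%Z) * zetak k.
Proof. lam_tac k. Qed.
Lemma lam_sin2 k : (k <= 11)%nat ->
  lam_full (fun k => - psum (mus case2) k) k = IZR (nth k [0; 0; 8; 0; 8; 0; 8; 0; 8; 0; 8; 0]%Z 0%Z) * zetak k.
Proof. lam_tac k. Qed.
Lemma lam_sin3 k : (k <= 11)%nat ->
  lam_full (fun k => - psum (mus case3) k) k = IZR (nth k [0; 0; 16; 0; 64; 0; 256; 0; 1024; 0; 4096; 0]%Z 0%Z) * zetak k.
Proof. lam_tac k. Qed.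
Lemma lam_sin4 k : (k <= 11)%nat ->
  lam_full (fun k => - psum (mus case4) k) k = IZR (nth k [0; 0; 24; 0; 168; 0; 1464; 0; 13128; 0; 118104; 0]%Z 0%Z) * zetak k.
Proof. lam_tac k. Qed.

Lemma sin_unit1_eq : sin_unit case1 = fC 1.
Proof.
  unfold sin_unit. replace (lam_full (fun k => - psum (mus case1) k)) with (fC 0); [apply texp_zero|].
  apply fps_ext; intros [|[|k]]; [reflexivity..|]. unfold lam_full.
  replace (psum (mus case1) (S (S k))) with 0; [simpl; ring|]. unfold psum; simpl; ring.
Qed.

Lemma sum_coef_eq r : sum_coef r = 4 * row_series1 r - 6 * (sin_unit case2 (4 + r)%nat - gam_unit case2 (4 + r)%nat)
  + 4 * fmulc r (sin_unit case3) row_series3 + / 3 * (sin_unit case4 (4 + r)%nat - gam_unit case4 (4 + r)%nat).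
Proof.
  unfold sum_coef. rewrite sin_unit1_eq. replace (fC 1 * row_series1)%F with row_series1 by ring. reflexivity.
Qed.

(** Only the parts with j = 2, 4 need coefficients up to 11, because of the
    shift by four. *)
Lemma sum_coef_values :
  INR (fact 0) * sum_coef 0 = PI ^ 4 / 15 /\
  INR (fact 1) * sum_coef 1 = -48 * zetak 5 /\
  INR (fact 2) * sum_coef 2 = 356 * zetak 6 /\
  INR (fact 3) * sum_coef 3 = 288 * (4 * zetak 2 * zetak 5 - 15 * zetak 7) /\
  INR (fact 4) * sum_coef 4 = 12512 * zetak 8 /\
  INR (fact 5) * sum_coef 5 = 5760 * (60 * zetak 2 * zetak 7 - 48 * zetak 4 * zetak 5 - 49 * zetak 9) /\
  INR (fact 6) * sum_coef 6 = 1728 * (1440 * zetak 5 ^ 2 - 1999 * zetak 10) /\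
  INR (fact 7) * sum_coef 7 = 241920 * (885 * zetak 11 + 196 * zetak 2 * zetak 9 - 720 * zetak 4 * zetak 7 - 336 * zetak 5 * zetak 6).
Proof.
  destruct zeta_even as [Z2 [Z4 [Z6 [Z8 Z10]]]].
  repeat split; rewrite sum_coef_eq; unfold sin_unit, gam_unit; cbn [Nat.add]; unfold fmulc, shift, row_series1, row_series3, row_coef1, row_coef3;
    rewrite !texp_low_coef by (reflexivity || lia); unfold texp_low; cbn [nth Nat.add];
    rewrite ?lam_gam2, ?lam_gam4, ?lam_sin2, ?lam_sin3, ?lam_sin4 by lia; cbn [nth];
    rewrite ?Z2, ?Z4, ?Z6, ?Z8, ?Z10, ?fact_simpl, ?mult_INR; simpl INR; field.
Qed.

Theorem theorem15p7 :
  is_series (fun n : nat => f6 (INR (S n))) (PI ^ 4 / 15) /\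
  is_series (fun n : nat => Derive_n f6 1 (INR (S n))) (- 48 * zeta 5) /\
  is_series (fun n : nat => Derive_n f6 2 (INR (S n))) (356 * zeta 6) /\
  is_series (fun n : nat => Derive_n f6 3 (INR (S n)))
    (288 * (4 * zeta 2 * zeta 5 - 15 * zeta 7)) /\
  is_series (fun n : nat => Derive_n f6 4 (INR (S n))) (12512 * zeta 8) /\
  is_series (fun n : nat => Derive_n f6 5 (INR (S n)))
    (5760 * (60 * zeta 2 * zeta 7 - 48 * zeta 4 * zeta 5 - 49 * zeta 9)) /\
  is_series (fun n : nat => Derive_n f6 6 (INR (S n)))
    (1728 * (1440 * zeta 5 ^ 2 - 1999 * zeta 10)) /\
  (ex_series (fun n : nat => Derive_n f6 7 (INR (S n))) /\
   1 / 241920 * Series (fun n : nat => Derive_n f6 7 (INR (S n)))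
   = 885 * zeta 11 + 196 * zeta 2 * zeta 9
     - 720 * zeta 4 * zeta 7 - 336 * zeta 5 * zeta 6).
Proof.
  assert (Z : forall x k, x = INR k -> zeta x = zetak k) by (intros x k ->; apply zeta_nat).
  rewrite (Z 2 2%nat), (Z 4 4%nat), (Z 5 5%nat), (Z 6 6%nat), (Z 7 7%nat), (Z 8 8%nat), (Z 9 9%nat),
    (Z 10 10%nat), (Z 11 11%nat) by (simpl; ring).
  destruct sum_coef_values as [T0 [T1 [T2 [T3 [T4 [T5 [T6 T7]]]]]]].
  assert (D : forall r v, (r <= 7)%nat -> INR (fact r) * sum_coef r = v ->
     is_series (fun n => Derive_n f6 r (INR (S n))) v) by (intros r v Hr <-; now apply derivative_sum).
  repeat split; try (apply D; [lia|assumption]).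
  - exact (D 0%nat _ ltac:(lia) T0).
  - eexists. exact (D 7%nat _ ltac:(lia) T7).
  - rewrite (is_series_unique _ _ (D 7%nat _ ltac:(lia) T7)). field.
Qed.
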